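(* Let $\alpha=\log 3/\log 5$, let $N_N$, $N_D$ and $\widetilde N$ be the eigenvalue counting functions of $-\Delta$ on the Sierpinski gasket $SG$ with Neumann boundary conditions, on $SG$ with Dirichlet boundary conditions, and on the double cover $\widetilde{SG}$, respectively, and let $G:(0,\infty)\to\mathbb{R}$ be the multiplicatively periodic function ($G(5t)=G(t)$) occurring in the asymptotics $N_N(t)=G(t)t^\alpha+O(1)$, $N_D(t)=G(t)t^{\alpha}+O(1)$ as $t\to\infty$. Then there exist an open set $A\subset(0,\infty)$, whose complement in $(0,\infty)$ has Lebesgue measure zero and which satisfies $5A=A$, and a bounded function $G_1:A\to\mathbb{R}$ with $G_1(5t)=G_1(t)$ for all $t\in A$, such that $G$ is continuous on $A$ and for each $t\in A$ there exists an integer $m_0(t)$ such that for all integers $m\ge m_0(t)$: $$\widetilde N(5^m t)=2G(5^m t)(5^m t)^{\alpha}=2G(t)t^{\alpha}3^m,$$ $$N_N(5^m t)=G(t)t^{\alpha}3^m+G_1(t),$$ $$N_D(5^m t)=G(t)t^{\alpha}3^m-G_1(t).$$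
   Context: **Sierpinski gasket and its Laplacian.** Let $q_0,q_1,q_2$ be the vertices of an equilateral triangle in $\mathbb{R}^2$ and $F_i(x)=\tfrac12(x+q_i)$, $i=0,1,2$. $SG$ is the unique nonempty compact set with $SG=\bigcup_i F_i(SG)$. Its boundary is $V_0=\{q_0,q_1,q_2\}$; put $V_m=\bigcup_i F_i(V_{m-1})$ and $V_*=\bigcup_m V_m$. Points $x\ne y$ of $V_m$ are neighbors at level $m$ ($x\sim_m y$) if both lie in $F_{i_1}\circ\cdots\circ F_{i_m}(V_0)$ for some word $(i_1,\dots,i_m)$. For $x\in V_m\setminus V_0$ let $\Delta_m u(x)=\sum_{y\sim_m x}(u(y)-u(x))$. For continuous functions $u,f$ on $SG$, $\Delta u=f$ means that $\frac32 5^m\Delta_m u(x)\to f(x)$ uniformly over $x\in V_m\setminus V_0$ as $m\to\infty$. The normal derivatives at boundary points are $\partial_n u(q_i)=\lim_{m\to\infty}(5/3)^m\bigl(2u(q_i)-u(F_i^m q_{i+1})-u(F_i^mq_{i-1})\bigr)$ (indices mod 3). **Eigenvalues.** A Dirichlet (resp. Neumann) eigenfunction on $SG$ with eigenvalue $\lambda$ is a nonzero continuous $u$ with $-\Delta u=\lambda u$ and $u=0$ (resp. $\partial_n u=0$) on $V_0$. The double cover $\widetilde{SG}$ is two copies of $SG$ glued together at corresponding boundary points (a fractafold without boundary). An eigenfunction on $\widetilde{SG}$ with eigenvalue $\lambda$ is a nonzero continuous function whose restriction to each copy satisfies $-\Delta u=\lambda u$ and for which the two normal derivatives at each of the three glued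 points sum to zero. Neumann eigenfunctions extended evenly and Dirichlet eigenfunctions extended oddly give a complete set of eigenfunctions on $\widetilde{SG}$. **Counting functions.** In each of the three cases the eigenvalues of $-\Delta$ form a discrete set of nonnegative numbers with finite multiplicities, and $N(t)$ denotes the number of eigenvalues $\lambda\le t$, counted with multiplicity. Thus $\widetilde N(t)=N_N(t)+N_D(t)$. **The function $G$.** It is known (Fukushima–Shima, Kigami–Lapidus, Kigami) that there is a function $G:(0,\infty)\to\mathbb{R}$ with $G(5t)=G(t)$ for all $t>0$, bounded away from zero, such that $N(t)=G(t)t^\alpha+O(1)$ as $t\to\infty$ for both $N=N_N$ and $N=N_D$. Since $5^\alpha=3$, $G$ is uniquely determined: $G(t)=\lim_{m\to\infty}3^{-m}t^{-\alpha}N(5^mt)$. For a set $A$, $5A=\{5t:t\in A\}$. *)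

(* Defs.v *)
From HB Require Import structures.
From mathcomp Require Import all_boot all_order all_algebra.
From mathcomp Require Import all_classical all_reals all_analysis.

Set Implicit Arguments.
Unset Strict Implicit.
Unset Printing Implicit Defensive.

Import Order.TTheory GRing.Theory Num.Theory.
Import numFieldNormedType.Exports.

Local Open Scope classical_set_scope.
Local Open Scope ring_scope.

(* Euclidean: the library norm on 'rV[R]_2 is the sup norm. *)
Definition sqdist (R : realType) (x y : 'rV[R]_2) : R :=
  \sum_(k < 2) (x ord0 k - y ord0 k) ^+ 2.

Definition equilateral (R : realType) (q : 'I_3 -> 'rV[R]_2) : Prop :=
  exists2 s : R, 0 < s & forall i j : 'I_3, i != j -> sqdist (q i) (q j) = s.

Definition Fmap (R : realType) (q : 'I_3 -> 'rV[R]_2) (i : 'I_3)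
    (x : 'rV[R]_2) : 'rV[R]_2 :=
  2%:R^-1 *: (x + q i).

(* [Fword q [:: i1; ...; im]] is F_i1 o ... o F_im. *)
Definition Fword (R : realType) (q : 'I_3 -> 'rV[R]_2) (w : seq 'I_3)
    (x : 'rV[R]_2) : 'rV[R]_2 :=
  foldr (Fmap q) x w.

Definition is_gasket (R : realType) (q : 'I_3 -> 'rV[R]_2)
    (SG : set 'rV[R]_2) : Prop :=
  [/\ compact SG, SG !=set0 & SG = \bigcup_(i in [set: 'I_3]) Fmap q i @` SG].

Fixpoint Vset (R : realType) (q : 'I_3 -> 'rV[R]_2) (m : nat) :
    set 'rV[R]_2 :=
  if m is m'.+1 then \bigcup_(i in [set: 'I_3]) Fmap q i @` Vset q m'
  else range q.

Definition neighbor (R : realType) (q : 'I_3 -> 'rV[R]_2) (m : nat)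
    (x y : 'rV[R]_2) : Prop :=
  x <> y /\
  exists w : m.-tuple 'I_3,
    (Fword q w @` Vset q 0) x /\ (Fword q w @` Vset q 0) y.

Definition graph_laplacian (R : realType) (q : 'I_3 -> 'rV[R]_2) (m : nat)
    (u : 'rV[R]_2 -> R) (x : 'rV[R]_2) : R :=
  \sum_(y \in [set y | neighbor q m x y]) (u y - u x).

(* Functions on SG are represented by functions on the plane; only their
   values on SG matter, here and in every definition below. *)
Definition has_laplacian (R : realType) (q : 'I_3 -> 'rV[R]_2)
    (SG : set 'rV[R]_2) (u f : 'rV[R]_2 -> R) : Prop :=
  [/\ {within SG, continuous u}, {within SG, continuous f} &
    forall e : R, 0 < e -> \forall m \near \oo,
      forall x, (Vset q m `\` Vset q 0) x ->
        `| 3%:R / 2%:R * 5%:R ^+ m * graph_laplacian q m u x - f x | < e].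

(* Indices are taken mod 3: [+] and [-] are those of the ring structure
   on 'I_3. *)
Definition has_normal_derivative (R : realType) (q : 'I_3 -> 'rV[R]_2)
    (u : 'rV[R]_2 -> R) (i : 'I_3) (d : R) : Prop :=
  (fun m : nat => (5%:R / 3%:R) ^+ m *
     (2%:R * u (q i) - u (iter m (Fmap q i) (q (i + 1)))
        - u (iter m (Fmap q i) (q (i - 1))))) @ \oo --> d.

Definition eigen_equation (R : realType) (q : 'I_3 -> 'rV[R]_2)
    (SG : set 'rV[R]_2) (lambda : R) (u : 'rV[R]_2 -> R) : Prop :=
  has_laplacian q SG u (fun x => - (lambda * u x)).

(* The three eigenspaces, zero function included. *)
Definition dirichlet_space (R : realType) (q : 'I_3 -> 'rV[R]_2)
    (SG : set 'rV[R]_2) (lambda : R) : set ('rV[R]_2 -> R) :=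
  [set u | eigen_equation q SG lambda u /\ forall i, u (q i) = 0].

Definition neumann_space (R : realType) (q : 'I_3 -> 'rV[R]_2)
    (SG : set 'rV[R]_2) (lambda : R) : set ('rV[R]_2 -> R) :=
  [set u | eigen_equation q SG lambda u /\
           forall i, has_normal_derivative q u i 0].

(* The double cover is two copies of SG, indexed by bool, glued at
   (true, q i) ~ (false, q i).  A continuous function on it is a function on
   bool * SG that is continuous on each copy and takes equal values at glued
   points. *)
Definition double_cover_space (R : realType) (q : 'I_3 -> 'rV[R]_2)
    (SG : set 'rV[R]_2) (lambda : R) : set (bool * 'rV[R]_2 -> R) :=
  [set u | [/\ forall b, eigen_equation q SG lambda (fun x => u (b, x)),
    forall i, u (true, q i) = u (false, q i) &
    forall i, exists d d' : R,
      [/\ has_normal_derivative q (fun x => u (true, x)) i d,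
          has_normal_derivative q (fun x => u (false, x)) i d' &
          d + d' = 0]]].

(* [E] has dimension [n] as a space of functions on [D]: functions that agree
   on [D] are identified. *)
Definition has_dim (R : realType) (T : Type) (D : set T) (E : set (T -> R))
    (n : nat) : Prop :=
  exists b : 'I_n -> T -> R,
    [/\ forall i, E (b i),
        forall c : 'I_n -> R,
          (forall x, D x -> \sum_(i < n) c i * b i x = 0) ->
          forall i, c i = 0 &
        forall u, E u -> exists c : 'I_n -> R,
          forall x, D x -> u x = \sum_(i < n) c i * b i x].

(* Default value 0 if the dimension is infinite; no eigenspace above is. *)
Definition fdim (R : realType) (T : Type) (D : set T) (E : set (T -> R)) :
    nat :=
  get [set n | has_dim D E n].

Definition eigenvalue_of (R : realType) (T : Type) (D : set T)
    (E : R -> set (T -> R)) (lambda : R) : Prop :=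
  exists u, E lambda u /\ exists2 x, D x & u x != 0.

(* The eigenvalues <= t are finite in number in the three cases below; on an
   infinite index set the sum would take the default value 0. *)
Definition counting (R : realType) (T : Type) (D : set T)
    (E : R -> set (T -> R)) (t : R) : nat :=
  \big[addn/0%N]_(lambda \in
     [set lambda | eigenvalue_of D E lambda /\ lambda <= t])
    fdim D (E lambda).

Definition N_neumann (R : realType) (q : 'I_3 -> 'rV[R]_2)
    (SG : set 'rV[R]_2) : R -> nat :=
  counting SG (neumann_space q SG).

Definition N_dirichlet (R : realType) (q : 'I_3 -> 'rV[R]_2)
    (SG : set 'rV[R]_2) : R -> nat :=
  counting SG (dirichlet_space q SG).

Definition N_double (R : realType) (q : 'I_3 -> 'rV[R]_2)
    (SG : set 'rV[R]_2) : R -> nat :=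
  counting [set p : bool * 'rV[R]_2 | SG p.2] (double_cover_space q SG).

Definition alpha (R : realType) : R := ln 3%:R / ln 5%:R.

(* N(t) = G(t) t^alpha + O(1) as t -> +oo. *)
Definition has_asymptotics (R : realType) (N : R -> nat) (G : R -> R) : Prop :=
  exists C : R, \forall t \near +oo,
    `| (N t)%:R - G t * t `^ alpha R | <= C.

(* Main.v *)
(* Spectral decimation. Let D_m(z) be the number of eigenvalues at most z, with
   multiplicity, of the graph Laplacian on V_m, with the Dirichlet or the Neumann
   boundary condition; all of them lie in [0, 6]. Away from z = 2, 5, 6,
   restriction to V_m identifies the z-eigenfunctions on V_{m+1} with the
   z(5 - z)-eigenfunctions on V_m, and this determines the spectrum recursively:
   on ]2, 3[ and ]5, 6[ the count D_m is a 3^m +- b for m >= 2, and on the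
   remaining intervals D_{m+1}(z) is read off from D_m(z(5 - z)). So the set of z near
   which D_m is eventually of the form a 3^m +- b, with + for Neumann and - for
   Dirichlet, is open, and its complement in ]0, 6[ is covered by intervals of
   arbitrarily small total length.

   If phi is the branch of the inverse of z(5 - z) that fixes 0, and
   psi(x) = lim 3/2 5^k phi^k(x), then the eigenfunctions on SG with eigenvalue
   5^m psi(x), x in [0, 1], restrict bijectively to the x-eigenfunctions on V_m:
   the residual of an eigenfunction in the discrete equation at level m + k is
   o(5^-k), whereas the decimation identities give its exact decay, so that it
   is zero; conversely the discrete extensions oscillate geometrically less and
   less on smaller cells. Hence N(5^m psi(x)) = D_m(x). Since psi is bilipschitz,
   null sets are preserved, and the asymptotics of N identifies a with
   G(t) t^alpha. *)
Require Import Defs.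
From HB Require Import structures.
From mathcomp Require Import all_boot all_order all_algebra.
From mathcomp Require Import all_classical all_reals all_analysis.
From mathcomp Require Import ring lra.
From mathcomp Require Import complex.

Set Implicit Arguments.
Unset Strict Implicit.
Unset Printing Implicit Defensive.

Import Order.TTheory GRing.Theory Num.Theory.
Import numFieldNormedType.Exports.

Local Open Scope classical_set_scope.
Local Open Scope ring_scope.

(** The sign in a 3^m +- b comes from counting vertices: V_m has 3/2 3^m + 3/2 points, and 3/2 3^m -
    3/2 off the boundary. Where the recursion does not merely copy a count, it combines counts and
    numbers of vertices linearly, with the same coefficients for both boundary conditions, so
    opposite offsets stay opposite and cancel on the double cover. Multiplicities cause no trouble:
    2 is no eigenvalue from level 2 on, 6 has at level m + 1 one eigenfunction per vertex of level
    m, and that of 5 is never evaluated, since the count on ]5, 6[ is the total minus the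
    multiplicity of 6.

    The analytic difficulty is a tie of rates: a residual may grow by a factor 5 when passed down
    one level, which is just the rate at which the renormalized Laplacian makes it small. Each step
    must therefore cost 5 - z and no more. Infinite products near 1 are controlled throughout by
    explicit bounds such as 2 - 4^-k, shaped to close under induction. Negative eigenvalues are
    excluded by the same decimation, with x in [-1, 0[, so that no integration by parts on SG is
    used. *)

(** * Dimensions of function spaces *)

Lemma has_dim_inj (R : realType) (T : Type) (D : set T) (E : set (T -> R)) n n' :
  has_dim D E n -> has_dim D E n' -> n = n'.
Proof.
suff H k k' : has_dim D E k -> has_dim D E k' -> (k' <= k)%N.
  by move=> h h'; apply/eqP; rewrite eqn_leq (H _ _ h' h) (H _ _ h h').
move=> {n n'}; move: k k' => n n' [b [Eb fb gb]] [b' [Eb' fb' gb']].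
have /choice[C HC] : forall i : 'I_n', exists c : 'I_n -> R,
    forall x, D x -> b' i x = \sum_(j < n) c j * b j x.
  by move=> i; apply: gb; exact: Eb'.
pose M : 'M[R]_(n', n) := \matrix_(i, j) C i j.
rewrite leqNgt; apply/negP => nn'.
have : kermx M != 0.
  rewrite -mxrank_eq0 mxrank_ker subn_eq0 -ltnNge.
  exact: leq_ltn_trans (rank_leq_col M) nn'.
case/rowV0Pn => v /sub_kermxP vM /eqP; apply; apply/rowP => i; rewrite !mxE.
apply: (fb' (v 0)) => x Dx.
under eq_bigr do rewrite HC // mulr_sumr.
rewrite exchange_big big1 // => j _.
under eq_bigr do rewrite mulrA.
rewrite -mulr_suml.
have /rowP/(_ j) := vM; rewrite !mxE.
under eq_bigr do rewrite mxE.
by move->; rewrite mul0r.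
Qed.

Lemma has_dim_fdim (R : realType) (T : Type) (D : set T) (E : set (T -> R)) n :
  has_dim D E n -> fdim D E = n.
Proof.
move=> h; apply: (has_dim_inj _ h).
by rewrite /fdim; apply: (@getPex _ [set n | has_dim D E n]); exists n.
Qed.

Definition lin_closed (R : realType) (T : Type) (E : set (T -> R)) : Prop :=
  forall n (c : 'I_n -> R) (b : 'I_n -> T -> R), (forall i, E (b i)) ->
  E (fun x => \sum_(i < n) c i * b i x).

Lemma lin_closedP (R : realType) (T : Type) (E : set (T -> R)) :
  E (fun=> 0) -> (forall a u v, E u -> E v -> E (fun x => a * u x + v x)) ->
  lin_closed E.
Proof.
move=> E0 Ea; elim=> [|n IH] c b Eb.
  by rewrite (_ : (fun _ => _) = fun=> 0) //; apply/funext => x; rewrite big_ord0.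
rewrite (_ : (fun _ => _) = fun x =>
  c ord0 * b ord0 x + \sum_(i < n) c (lift ord0 i) * b (lift ord0 i) x).
  by apply: Ea => //; apply: IH.
by apply/funext => x; rewrite big_ord_recl.
Qed.

(** Transfers dimensions along a restriction map that is bijective up to agreement on [D] and [D'];
    it serves both from one level to the next and from the gasket to a graph. *)
Lemma has_dim_pullback (R : realType) (T T' : Type) (D : set T) (D' : set T')
    (E : set (T -> R)) (E' : set (T' -> R)) (f : T' -> T) n :
  (forall x, D' x -> D (f x)) -> lin_closed E ->
  (forall u, E u -> E' (u \o f)) ->
  (forall u, E u -> (forall x, D' x -> u (f x) = 0) -> forall x, D x -> u x = 0) ->
  (forall v, E' v -> exists2 u, E u & forall x, D' x -> u (f x) = v x) ->
  has_dim D' E' n -> has_dim D E n.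
Proof.
move=> Df linE EE' inj surj [b' [Eb fb gb]].
have /choice[b Hb] : forall i : 'I_n, exists u, E u /\ forall x, D' x -> u (f x) = b' i x.
  by move=> i; have [u Eu uf] := surj _ (Eb i); exists u.
exists b; split.
- by move=> i; case: (Hb i).
- move=> c c0; apply: fb => x Dx; rewrite -[RHS](c0 (f x) (Df _ Dx)).
  by apply: eq_bigr => i _; rewrite (Hb i).2.
- move=> u Eu; have [c Hc] := gb _ (EE' _ Eu); exists c => x Dx.
  (* The difference of [u] and its candidate expansion, written as one combination of [n.+1] members
     so that [lin_closed] applies. *)
  pose w : 'I_n.+1 -> T -> R := fun i => if unlift ord0 i is Some j then b j else u.
  pose d : 'I_n.+1 -> R := fun i => if unlift ord0 i is Some j then - c j else 1.
  have Ew i : E (w i).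
    by rewrite /w; case: unliftP => [j|] _ //; case: (Hb j).
  have sumE y : \sum_(i < n.+1) d i * w i y = u y - \sum_(i < n) c i * b i y.
    rewrite big_ord_recl /d /w unlift_none mul1r -sumrN; congr (_ + _).
    by apply: eq_bigr => i _; rewrite liftK mulNr.
  apply/eqP; rewrite -subr_eq0 -sumE; apply/eqP.
  apply: (inj _ (linE _ d w Ew)) => // y Dy; rewrite sumE.
  under eq_bigr do rewrite (Hb _).2 //.
  by rewrite -Hc //= subrr.
Qed.

Lemma has_dim0 (R : realType) (T : Type) (D : set T) (E : set (T -> R)) :
  (forall u, E u -> forall x, D x -> u x = 0) -> has_dim D E 0.
Proof.
move=> E0; exists (fun i _ => 0); split; [by case|by move=> ? _; case|].
by move=> u Eu; exists (fun=> 0) => x Dx; rewrite big_ord0 E0.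
Qed.

Lemma eigenvalue_has_dim (R : realType) (T : Type) (D : set T)
    (E : R -> set (T -> R)) l n :
  has_dim D (E l) n -> eigenvalue_of D E l <-> (0 < n)%N.
Proof.
move=> [b [Eb fb gb]]; split.
  case=> u [Eu [x Dx]]; case: n b Eb fb gb => // b Eb fb gb.
  by have [c ->//] := gb _ Eu; rewrite big_ord0 eqxx.
move=> n0; exists (b (Ordinal n0)); split => //.
apply: contrapT => H.
have : (1 : R) = 0; last by move/eqP; rewrite oner_eq0.
pose c := fun i : 'I_n => (i == Ordinal n0)%:R : R.
have := fb c _ (Ordinal n0); rewrite /c eqxx; apply => x Dx.
rewrite (bigD1 (Ordinal n0)) //= big1 ?addr0; last first.
  by move=> i /negbTE ->; rewrite mul0r.
rewrite ?eqxx mul1r; apply/eqP/negPn/negP => bx; apply: H; by exists x.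
Qed.

(** * Eigenvalue lists of symmetric matrices and forms *)

Lemma mxrank_diag (F : fieldType) n (d : 'rV[F]_n) :
  \rank (diag_mx d) = #|[pred i | d 0 i != 0]|.
Proof.
elim: n d => [|n IH] d.
  by rewrite thinmx0 mxrank0 eq_card0 // => -[].
rewrite -[n.+1]add1n in d *; rewrite -(hsubmxK d) diag_mx_row.
rewrite rank_diag_block_mx IH rank_rV.
have -> : (diag_mx (lsubmx d) != 0) = (d 0 0 != 0).
  congr (~~ _); apply/eqP/eqP => [/matrixP/(_ 0 0)|H].
    by rewrite !mxE eqxx mulr1n => <-; congr (d _ _); apply: val_inj.
  apply/matrixP => i j; rewrite !mxE !ord1 eqxx mulr1n -[RHS]H.
  by congr (d _ _); apply: val_inj.
rewrite -!sum1_card big_mkcond [RHS]big_mkcond big_split_ord big_ord1 /=.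
congr addn.
  rewrite !inE row_mxEl mxE (_ : lshift n 0 = 0); last exact: val_inj.
  by case: (_ != _).
by apply: eq_bigr => i _; rewrite !inE row_mxEr.
Qed.

Lemma realsym_spectrum (R : realType) n (A : 'M[R]_n) : A^T = A ->
  exists2 s : seq R, size s = n &
    forall z, \rank (kermx (A - z%:M)) = count_mem z s.
Proof.
move=> Asym; pose f := complex.real_complex_def (Phant R).
pose AC := map_mx f A.
have ACh : AC \is hermsymmx.
  apply: realsym_hermsym.
    by apply/is_hermitianmxP; rewrite expr0 scale1r map_mx_id // /AC map_trmx Asym.
  by apply/mxOverP => i j; rewrite mxE; apply/complex.complex_realP; exists (A i j).
have /mxOverP dreal := hermitian_spectral_diag_real ACh.
have /hermitian_normalmx/orthomx_spectralP := ACh.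
set P := spectralmx AC; set d := spectral_diag AC => ACE.
have Pu : P \in unitmx by exact: spectral_unit.
exists [seq complex.Re (d 0 i) | i <- enum 'I_n]; first by rewrite size_map size_enum_ord.
move=> z; rewrite mxrank_ker -(mxrank_map f) map_mxB map_scalar_mx -/AC.
have -> : AC - (f z)%:M = invmx P *m diag_mx (\row_i (d 0 i - f z)) *m P.
  rewrite (_ : diag_mx _ = diag_mx d - (f z)%:M); last first.
    by apply/matrixP => i j; rewrite !mxE; case: eqP => _; rewrite ?mulr1n ?mulr0n ?subr0.
  rewrite mulmxBr mulmxBl -ACE; congr (_ - _).
  by rewrite -[RHS]mulmxA -scalar_mxC mulmxA mulVmx // mul1mx.
rewrite mxrankMfree ?row_free_unit // -mxrank_tr trmx_mul mxrankMfree; last first.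
  by rewrite row_free_unit unitmx_tr unitmx_inv.
rewrite mxrank_tr mxrank_diag count_map.
set p := [pred i | _ != 0]; have pC := cardC p; rewrite card_ord in pC.
transitivity #|predC p|; first by rewrite -[X in (X - _)%N]pC addKn.
rewrite cardE size_filter -enumT; apply: eq_count => i /=.
rewrite !inE mxE subr_eq0 negbK.
apply/eqP/eqP => [->//|<-]; exact/esym/complex.RRe_real.
Qed.

Lemma has_dim_kermx (R : realType) (X : finType) (m : nat) (s : X -> R)
    (M : 'M[R]_(#|X|, m)) : (forall x, s x != 0) ->
  has_dim setT [set u : X -> R |
    (\row_i (s (enum_val i) * u (enum_val i))) *m M = 0] (\rank (kermx M)).
Proof.
move=> s0; move: (row_base (kermx M)) (row_base_free (kermx M)) (eq_row_base (kermx M)).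
move=> K Kfree KE.
have E (v : 'rV[R]_#|X|) : (v <= kermx M)%MS -> forall u : X -> R,
    (forall i, u (enum_val i) = (s (enum_val i))^-1 * v 0 i) ->
    (\row_i (s (enum_val i) * u (enum_val i))) *m M = 0.
  move=> /sub_kermxP vM u uE; rewrite (_ : \row_i _ = v) //.
  by apply/rowP => i; rewrite mxE uE mulVKf.
exists (fun i x => (s x)^-1 * K i (enum_rank x)); split.
- move=> i; apply: (E (row i K) _ (fun x => (s x)^-1 * K i (enum_rank x))).
    by apply: submx_trans (row_sub _ _) _; rewrite KE.
  by move=> j /=; rewrite enum_valK !mxE.
- move=> c c0; have cK : (\row_i c i) *m K = 0.
    apply/rowP => j; rewrite !mxE; have := c0 (enum_val j) Logic.I.
    rewrite enum_valK => H; apply: (mulfI (invr_neq0 (s0 (enum_val j)))).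
    rewrite mulr0 -[RHS]H mulr_sumr; apply: eq_bigr => i _.
    by rewrite mxE mulrCA.
  move=> i; have /rowP/(_ i) : \row_i c i = 0; last by rewrite !mxE.
  by apply/eqP; rewrite -(mulmx_free_eq0 _ Kfree); apply/eqP.
- move=> u /= /sub_kermxP; rewrite -KE => /submxP[c Hc].
  exists (c 0) => x _; have /rowP/(_ (enum_rank x)) := Hc.
  rewrite !mxE enum_rankK => H; apply: (mulfI (s0 x)); rewrite H mulr_sumr.
  by apply: eq_bigr => i _; rewrite mulrCA mulVKf.
Qed.

(** In the unknowns r u, with r the square root of n, the weighted problem becomes an ordinary one
    for the symmetric matrix K x y / (r x r y). *)
Lemma symmetric_form_spectrum (R : realType) (X : finType) (K : X -> X -> R)
    (n : X -> R) : (forall x y, K x y = K y x) -> (forall x, 0 < n x) ->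
  exists2 s : seq R, size s = #|X| & forall z,
    has_dim setT [set u : X -> R | forall x, \sum_y K x y * u y = z * (n x * u x)]
      (count_mem z s).
Proof.
move=> Ksym n0; pose r x := Num.sqrt (n x).
have r0 x : r x != 0 by rewrite sqrtr_eq0 -ltNge.
have rr x : r x * r x = n x by rewrite -expr2 sqr_sqrtr // ltW.
pose A : 'M[R]_#|X| := \matrix_(i, j)
  (K (enum_val i) (enum_val j) / r (enum_val i) / r (enum_val j)).
have Asym : A^T = A by apply/matrixP => i j; rewrite !mxE Ksym mulrAC.
have [s sz Hs] := realsym_spectrum Asym; exists s => // z.
rewrite -Hs (_ : [set u | _] = [set u : X -> R |
    (\row_i (r (enum_val i) * u (enum_val i))) *m (A - z%:M) = 0]).
  exact: has_dim_kermx.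
apply/seteqP; split => u /=.
- move=> H; apply/rowP => j; rewrite !mxE.
  have := H (enum_val j); set x := enum_val j => Hx.
  apply: (mulfI (r0 x)); rewrite mulr0 mulr_sumr.
  transitivity (\sum_y K x y * u y - z * (n x * u x)); last by rewrite Hx subrr.
  rewrite (reindex (@enum_val X predT)) /=; last exact: onW_bij (enum_val_bij _).
  rewrite (_ : z * _ = \sum_i (i == j)%:R * (z * (n x * u x))); last first.
    rewrite (bigD1 j) //= eqxx mul1r big1 ?addr0 // => i /negbTE ->.
    by rewrite mul0r.
  rewrite -sumrB; apply: eq_bigr => i _; rewrite !mxE -/x mulrBr mulrBr; congr (_ - _).
    rewrite (Ksym x); rewrite -[RHS]mulr1 -(divff (r0 x)) -[K _ _ in RHS]mulr1.
    rewrite -(divff (r0 (enum_val i))); ring.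
  have [->|_] := eqVneq i j; last by rewrite mulr0n !mulr0 mul0r.
  by rewrite -rr -/x; ring.
- move=> H x; have /rowP/(_ (enum_rank x)) := H; rewrite !mxE => Hx.
  apply/eqP; rewrite -subr_eq0; apply/eqP; rewrite -[RHS](mulr0 (r x)) -[X in r x * X]Hx.
  rewrite mulr_sumr (reindex (@enum_val X predT)) /=; last exact: onW_bij (enum_val_bij _).
  rewrite (_ : z * _ = \sum_i (i == enum_rank x)%:R * (z * (n x * u x))); last first.
    rewrite (bigD1 (enum_rank x)) //= eqxx mul1r big1 ?addr0 // => i /negbTE ->.
    by rewrite mul0r.
  rewrite -sumrB; apply: eq_bigr => i _; rewrite !mxE enum_rankK mulrBr mulrBr; congr (_ - _).
    rewrite (Ksym x); rewrite -[LHS]mulr1 -(divff (r0 x)) -[K _ _ in LHS]mulr1.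
    rewrite -(divff (r0 (enum_val i))); ring.
  have [->|_] := eqVneq i (enum_rank x); last by rewrite mulr0n !mulr0 mul0r.
  by rewrite enum_rankK -rr; ring.
Qed.

(** * Combinatorial model of the graphs on V_m *)

(* The word (c, w) denotes the cell of w at its corner c, so the innermost letter
   comes first. *)
Fixpoint word (m : nat) : finType :=
  if m is m'.+1 then ('I_3 * word m')%type else unit.

(* All vertices of level m if b is true, those off the boundary if b is false;
   inr (w, j) is the midpoint of the side of the cell w opposite to its corner j. *)
Fixpoint vertex (b : bool) (m : nat) : finType :=
  if m is m'.+1 then (vertex b m' + word m' * 'I_3)%type
  else if b then ('I_3 : finType) else (void : finType).

(* The i-th corner of a cell, None if it is a boundary vertex and b is false;
   - (c + i) is the third element of 'I_3 when c != i. *)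
Fixpoint corner (b : bool) (m : nat) : word m -> 'I_3 -> option (vertex b m) :=
  match m return word m -> 'I_3 -> option (vertex b m) with
  | 0 => fun _ i =>
      (if b as b0 return option (vertex b0 0) then Some i else None)
  | m'.+1 => fun cw i =>
      if cw.1 == i then omap inl (corner b cw.2 i)
      else Some (inr (cw.2, - (cw.1 + i)))
  end.

Lemma I3P (P : 'I_3 -> Prop) : P 0 -> P 1 -> P (-1) -> forall i, P i.
Proof.
move=> P0 P1 P2 [[|[|[|//]]] Hi].
- by rewrite (_ : Ordinal Hi = 0) //; apply: val_inj.
- by rewrite (_ : Ordinal Hi = 1) //; apply: val_inj.
- by rewrite (_ : Ordinal Hi = -1) //; apply: val_inj.
Qed.

Lemma sumI3 (V : nmodType) (F : 'I_3 -> V) : \sum_i F i = F 0 + F 1 + F (-1).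
Proof.
rewrite !big_ord_recl big_ord0 addr0 addrA; congr (F _ + F _ + F _); exact: val_inj.
Qed.

Lemma sum_word (V : nmodType) m (G : word m.+1 -> V) :
  \sum_w G w = \sum_c \sum_w G (c, w).
Proof.
rewrite (pair_bigA _ (fun c (w : word m) => G (c, w))).
by apply: eq_bigr => -[].
Qed.

Lemma thirdE : (- (0 + 1) = -1 :> 'I_3) * (- (1 + 0) = -1 :> 'I_3) *
  (- (0 - 1) = 1 :> 'I_3) * (- (-1 + 0) = 1 :> 'I_3) *
  (- (1 - 1) = 0 :> 'I_3) * (- (-1 + 1) = 0 :> 'I_3).
Proof. by do !split; apply: val_inj. Qed.

(** * Residuals and the decimation identities *)

Section Residual.
Variables (R : realType) (b : bool).
Implicit Types (m : nat) (z : R).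

Definition incid m (w : word m) (i : 'I_3) (x : vertex b m) : R :=
  (corner b w i == Some x)%:R.

(* - Delta u - z u at x, assembled cell by cell: a vertex off the boundary belongs
   to two cells, whence z / 2, and a boundary vertex belongs to only one, which
   encodes the Neumann condition. *)
Definition residual m z (f : word m -> 'I_3 -> R) (x : vertex b m) : R :=
  \sum_w \sum_i incid w i x * ((3%:R - z / 2%:R) * f w i - \sum_j f w j).

(** [a] gives the values at the corners of the old cells and [p w j] the value at the midpoint
    opposite to corner [j] of [w]. The subcell at corner c keeps that corner; its other two corners
    are midpoints. *)
Definition subdivide m (a p : word m -> 'I_3 -> R) (cw : word m.+1) (i : 'I_3) : R :=
  if cw.1 == i then a cw.2 i else p cw.2 (- (cw.1 + i)).

(** The equation at a midpoint, whose four neighbours are two corners and the other two midpoints of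
    the same cell; the term p j of the last sum turns 4 into 5. *)
Definition midres z (a p : 'I_3 -> R) (j : 'I_3) : R :=
  (5%:R - z) * p j - (\sum_i a i - a j) - \sum_i p i.

Lemma sum_incid_inl m (F : word m.+1 -> 'I_3 -> R) (x : vertex b m) :
  \sum_w \sum_i @incid m.+1 w i (inl x) * F w i =
  \sum_w \sum_c incid w c x * F (c, w) c.
Proof.
rewrite sum_word exchange_big; apply: eq_bigr => w _; apply: eq_bigr => c _.
rewrite (bigD1 c) //= big1 ?addr0 => [|i /negbTE ic].
  congr (_ * _); rewrite /incid /= eqxx; congr ((_ : bool)%:R).
  by case: (corner b w c) => [y|] //=; rewrite /eq_op /=.
by rewrite /incid /= (eq_sym c i) ic /= mul0r.
Qed.

Lemma sum_incid_inr m (F : word m.+1 -> 'I_3 -> R) (w : word m) (j : 'I_3) :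
  \sum_w' \sum_i @incid m.+1 w' i (inr (w, j)) * F w' i =
  \sum_(c | c != j) F (c, w) (- (c + j)).
Proof.
rewrite sum_word [RHS]big_mkcond; apply: eq_bigr => c _.
rewrite (bigD1 w) //= [X in _ + X]big1 ?addr0 => [|w' /negbTE w'w]; last first.
  apply: big1 => i _; rewrite /incid /=; case: ifP => _.
    by case: (corner b w' i) => [y|] /=; rewrite ?mul0r.
  by rewrite /eq_op /= /eq_op /= /eq_op /= w'w mul0r.
rewrite (bigD1 (- (c + j))) //= [X in _ + X]big1 ?addr0 => [|i ij]; last first.
  rewrite /incid /=; case: ifP => _.
    by case: (corner b w i) => [y|] /=; rewrite ?mul0r.
  rewrite (_ : (Some _ == Some _) = false) ?mul0r //.
  apply/negP => /eqP[/esym jE]; move: ij; rewrite jE.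
  by rewrite opprD opprK addKr eqxx.
rewrite /incid /= (_ : (c == - (c + j)) = (c == j)); last first.
  by move: c j; apply: I3P; apply: I3P.
case: ifP => cj /=.
  by case: (corner b w _) => [y|] /=; rewrite ?mul0r.
by rewrite opprD opprK addKr eqxx mul1r.
Qed.

Lemma residual_inr m z (a p : word m -> 'I_3 -> R) (w : word m) (j : 'I_3) :
  residual z (subdivide a p) (inr (w, j) : vertex b m.+1) = midres z (a w) (p w) j.
Proof.
rewrite /residual sum_incid_inr /midres big_mkcond !sumI3 /subdivide /=.
by move: j; apply: I3P => /=; rewrite !thirdE; field.
Qed.

Lemma residual_inl m z (a p : word m -> 'I_3 -> R) (x : vertex b m) :
  residual z (subdivide a p) (inl x : vertex b m.+1) =
  \sum_w \sum_c incid w c x *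
    ((2%:R - z / 2%:R) * a w c - \sum_i p w i + p w c).
Proof.
rewrite /residual sum_incid_inl; apply: eq_bigr => w _; apply: eq_bigr => c _.
congr (_ * _); rewrite !sumI3 /subdivide /=.
by move: c; apply: I3P => /=; rewrite !thirdE; field.
Qed.

Lemma midres_sum z (a p : 'I_3 -> R) :
  \sum_j midres z a p j = (2%:R - z) * \sum_i p i - 2%:R * \sum_i a i.
Proof. by rewrite !sumI3 /midres !sumI3; ring. Qed.

(** Valid for all functions and all z, with the midpoint residuals kept as error terms and no
    division. Hence it serves exact eigenfunctions, approximate ones, and the boundary residuals
    behind normal derivatives. *)
Lemma residual_decimation m z (a p : word m -> 'I_3 -> R) (x : vertex b m) :
  (2%:R - z) * (5%:R - z) * residual z (subdivide a p) (inl x : vertex b m.+1) =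
  (6%:R - z) * residual (z * (5%:R - z)) a x +
  \sum_w \sum_c incid w c x * ((2%:R - z) * midres z (a w) (p w) c +
     (z - 4%:R) * \sum_j midres z (a w) (p w) j).
Proof.
rewrite residual_inl /residual !mulr_sumr -big_split; apply: eq_bigr => w _ /=.
rewrite !mulr_sumr -big_split; apply: eq_bigr => c _ /=.
by rewrite !sumI3 /midres !sumI3; field.
Qed.

(** The default 0 is the Dirichlet condition: [corner] is [None] exactly at the boundary vertices
    that the model leaves out. *)
Definition vval m (u : vertex b m -> R) (w : word m) (i : 'I_3) : R :=
  oapp u 0 (corner b w i).

Definition deigen m z : set (vertex b m -> R) :=
  [set u | forall x, residual z (vval u) x = 0].

Lemma vval_subdivide m (u : vertex b m.+1 -> R) :
  vval u = subdivide (vval (u \o inl)) (fun w j => u (inr (w, j))).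
Proof.
apply/funext => -[c w]; apply/funext => i; rewrite /vval /subdivide /=.
by case: eqP => // _; case: (corner b w i).
Qed.

Lemma deigen_lin m z : lin_closed (@deigen m z).
Proof.
apply: lin_closedP => [|k u v Eu Ev] x.
  apply: big1 => w _; apply: big1 => i _; rewrite big1 => [|j _].
    by rewrite /vval; case: corner => [y|] /=; rewrite mulr0 subrr mulr0.
  by rewrite /vval; case: corner.
rewrite -[RHS](addr0 0) -{1}(mulr0 k) -{1}(Eu x) -(Ev x) /residual.
rewrite mulr_sumr -big_split; apply: eq_bigr => w _ /=.
rewrite mulr_sumr -big_split; apply: eq_bigr => i _ /=.
have vE j : vval (fun y => k * u y + v y) w j = k * vval u w j + vval v w j.
  by rewrite /vval; case: corner => [y|] //=; rewrite mulr0 addr0.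
by rewrite !sumI3 !vE; field.
Qed.

Lemma deigen_restrict m z (u : vertex b m.+1 -> R) : z != 6%:R ->
  deigen z u -> deigen (z * (5%:R - z)) (u \o inl).
Proof.
move=> z6 Eu x; have z6' : 6%:R - z != 0 by rewrite subr_eq0 eq_sym.
apply: (mulfI z6'); rewrite mulr0.
have := residual_decimation z (vval (u \o inl)) (fun w j => u (inr (w, j))) x.
rewrite -vval_subdivide Eu mulr0 => ->; rewrite big1 ?addr0 // => w _.
have M j : midres z (vval (u \o inl) w) (fun j => u (inr (w, j))) j = 0.
  have := Eu (inr (w, j)); rewrite vval_subdivide residual_inr; exact.
by apply: big1 => c _; rewrite M big1 // !mulr0 addr0 mulr0.
Qed.

(* The solution p of midres z a p = 0. *)
Definition midext z (a : 'I_3 -> R) (j : 'I_3) : R :=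
  ((4%:R - z) * (\sum_i a i) - (2%:R - z) * a j) / ((2%:R - z) * (5%:R - z)).

Lemma midres_midext z (a : 'I_3 -> R) j : z != 2%:R -> z != 5%:R ->
  midres z a (midext z a) j = 0.
Proof.
move=> z2 z5; rewrite /midres /midext !sumI3; field.
by rewrite ![_ - z == 0]subr_eq0 (eq_sym 5%:R) (eq_sym 2%:R) z2 z5.
Qed.

(** The sum of the three equations determines the sum of the p j, after which each equation involves
    a single unknown. *)
Lemma midres0_midext z (a p : 'I_3 -> R) : z != 2%:R -> z != 5%:R ->
  (forall j, midres z a p j = 0) -> p = midext z a.
Proof.
move=> z2 z5 M; apply/funext => j.
have z2' : 2%:R - z != 0 by rewrite subr_eq0 eq_sym.
have z5' : 5%:R - z != 0 by rewrite subr_eq0 eq_sym.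
have /eqP := midres_sum z a p; rewrite big1 // eq_sym subr_eq0 => /eqP PA.
apply: (mulfI (mulf_neq0 z2' z5')); rewrite /midext mulrCA mulfV ?mulf_neq0 // mulr1.
have := congr1 (fun y => (2%:R - z) * y) (M j); rewrite mulr0 /midres => H.
have : (2%:R - z) * (5%:R - z) * p j = (2%:R - z) * (\sum_i a i - a j) +
   (2%:R - z) * \sum_i p i.
  by apply: subr0_eq; rewrite -[RHS]H; ring.
by rewrite PA => ->; ring.
Qed.

Definition dext m z (v : vertex b m -> R) (x : vertex b m.+1) : R :=
  match x with inl y => v y | inr (w, j) => midext z (vval v w) j end.

Lemma dext_deigen m z (v : vertex b m -> R) : z != 2%:R -> z != 5%:R ->
  z = 6%:R \/ deigen (z * (5%:R - z)) v -> deigen z (dext z v).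
Proof.
move=> z2 z5 Ev.
have E : vval (dext z v) = subdivide (vval v) (fun w => midext z (vval v w)).
  by rewrite vval_subdivide.
move=> [x|[w j]]; rewrite E.
  have z2' : 2%:R - z != 0 by rewrite subr_eq0 eq_sym.
  have z5' : 5%:R - z != 0 by rewrite subr_eq0 eq_sym.
  apply: (mulfI (mulf_neq0 z2' z5')); rewrite residual_decimation mulr0.
  rewrite [X in _ + X]big1 => [|w _]; last first.
    apply: big1 => c _; rewrite midres_midext // big1 ?mulr0 ?addr0 ?mulr0 //.
    by move=> i _; rewrite midres_midext.
  by case: Ev => [->|->]; rewrite ?subrr ?mul0r ?mulr0 addr0.
by rewrite residual_inr midres_midext.
Qed.

Lemma deigen_unique m z (u : vertex b m.+1 -> R) : z != 2%:R -> z != 5%:R ->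
  deigen z u -> u = dext z (u \o inl).
Proof.
move=> z2 z5 Eu; apply/funext => -[x|[w j]] //=.
rewrite -(@midres0_midext z _ (fun j => u (inr (w, j)))) // => i.
by have := Eu (inr (w, i)); rewrite vval_subdivide residual_inr; exact.
Qed.

Lemma deigen_dim_decimation m z n : z != 2%:R -> z != 5%:R -> z != 6%:R ->
  has_dim setT (@deigen m (z * (5%:R - z))) n -> has_dim setT (@deigen m.+1 z) n.
Proof.
move=> z2 z5 z6.
apply: (@has_dim_pullback R (vertex b m.+1) (vertex b m) _ setT _
  (deigen (z * (5%:R - z))) inl) => //.
- exact: deigen_lin.
- by move=> u; apply: deigen_restrict.
- move=> u Eu u0 x _; rewrite (deigen_unique z2 z5 Eu).
  have -> : u \o inl = fun=> 0 by apply/funext => y; apply: u0.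
  case: x => [//|[w j]] /=.
  have v0 i : vval (fun=> 0 : R) w i = 0 by rewrite /vval; case: corner.
  by rewrite /midext big1 ?v0 // !mulr0 subrr mul0r.
- by move=> v Ev; exists (dext z v) => //; apply: dext_deigen => //; right.
Qed.

(** At z = 6 the factor 6 - z removes the condition on the coarse level: arbitrary values on V_m
    extend, and do so uniquely since 6 is neither 2 nor 5. *)
Lemma deigen6_dim m : has_dim setT (@deigen m.+1 6%:R) #|vertex b m|.
Proof.
have n2 : (6%:R : R) != 2%:R by rewrite eqr_nat.
have n5 : (6%:R : R) != 5%:R by rewrite eqr_nat.
apply: (@has_dim_pullback R (vertex b m.+1) (vertex b m) _ setT _ setT inl) => //.
- exact: deigen_lin.
- move=> u Eu u0 x _; rewrite (deigen_unique n2 n5 Eu).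
  have -> : u \o inl = fun=> 0 by apply/funext => y; apply: u0.
  case: x => [//|[w j]] /=.
  have v0 i : vval (fun=> 0 : R) w i = 0 by rewrite /vval; case: corner.
  by rewrite /midext big1 ?v0 // !mulr0 subrr mul0r.
- by move=> v Ev; exists (dext 6%:R v) => //; apply: dext_deigen => //; left.
pose X := vertex b m.
exists (fun (i : 'I_#|X|) (x : X) => (i == enum_rank x)%:R); split => //.
- move=> c c0 i; rewrite -[RHS](c0 (enum_val i) Logic.I) enum_valK.
  rewrite (bigD1 i) //= eqxx mulr1 big1 ?addr0 // => j /negbTE ->.
  by rewrite mulr0.
- move=> u _; exists (fun i => u (enum_val i)) => x _.
  rewrite (bigD1 (enum_rank x)) //= eqxx mulr1 enum_rankK big1 ?addr0 //.
  by move=> j /negbTE ->; rewrite mulr0.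
Qed.

End Residual.

(** * The spectrum of a graph and its recursion *)

Lemma corner_surj b m (x : vertex b m) : exists w i, corner b w i = Some x.
Proof.
elim: m x => [|m IH] x; first by case: b x => //= x; exists tt, x.
case: x => [x|[w j]].
  by have [w [i wi]] := IH x; exists (i, w), i; rewrite /= eqxx wi.
exists (j + 1, w), (- (j + 1 + j)); rewrite /=.
rewrite (_ : (_ == _) = false); last by move: j; apply: I3P.
by rewrite opprD opprK addKr.
Qed.

Section Spectrum.
Variables (R : realType) (b : bool).
Implicit Types (m : nat) (z : R).

Lemma vvalE m (u : vertex b m -> R) w i :
  vval u w i = \sum_x incid R w i x * u x.
Proof.
rewrite /vval /incid; case: corner => [y|] /=; last by rewrite big1 // => x _; rewrite mul0r.
rewrite (bigD1 y) //= eqxx mul1r big1 ?addr0 // => x /negbTE xy.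
rewrite (_ : (_ == _) = false) ?mul0r //; apply/negP => /eqP[yx].
by rewrite yx eqxx in xy.
Qed.

(** Two subdivisions are needed: at level 1 the function equal to 1 at the three midpoints is a
    Dirichlet eigenfunction for 2. *)
Lemma deigen2_trivial m (u : vertex b m.+2 -> R) : deigen 2%:R u -> forall x, u x = 0.
Proof.
move=> Eu; pose a := vval (u \o inl : vertex b m.+1 -> R).
pose p (w : word m.+1) (j : 'I_3) := u (inr (w, j)).
have uE : vval u = subdivide a p by exact: vval_subdivide.
have M w j : midres 2%:R (a w) (p w) j = 0.
  by have := Eu (inr (w, j)); rewrite uE residual_inr.
have A0 w : \sum_i a w i = 0.
  have := midres_sum 2%:R (a w) (p w); rewrite big1 // subrr mul0r sub0r => /esym/eqP.
  by rewrite oppr_eq0 mulf_eq0 pnatr_eq0 => /eqP.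
have pE w j : p w j = (\sum_i p w i - a w j) / 3%:R.
  have := M w j; rewrite /midres A0 => H.
  have -> : \sum_i p w i = (5%:R - 2%:R) * p w j - (0 - a w j).
    by apply/esym/subr0_eq; exact: H.
  by field.
have vtx (x : vertex b m.+1) : \sum_w \sum_c incid R w c x * (a w c - \sum_i p w i) = 0.
  have := Eu (inl x); rewrite uE residual_inl => H.
  have t0 : (2%:R / 3%:R : R) != 0 by rewrite mulf_neq0 ?invr_eq0 ?pnatr_eq0.
  apply: (mulfI t0); rewrite mulr0 -[RHS]H mulr_sumr; apply: eq_bigr => w _.
  rewrite mulr_sumr; apply: eq_bigr => c _; rewrite (pE w c).
  by field.
(* The vertex equations are paired with [u]. The cross terms contain the sums of [a] over a cell,
   which vanish by [A0], so a sum of squares is left. *)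
have a0 w i : a w i = 0.
  have S0 : \sum_w \sum_c a w c ^+ 2 = 0.
    transitivity (\sum_(x : vertex b m.+1) u (inl x) *
        \sum_w \sum_c @incid R b m.+1 w c x * (a w c - \sum_i p w i)).
      under [RHS]eq_bigr do rewrite mulr_sumr.
      rewrite [RHS]exchange_big; apply: eq_bigr => v _ /=.
      under [RHS]eq_bigr do rewrite mulr_sumr.
      rewrite [RHS]exchange_big /=.
      transitivity (\sum_c a v c * (a v c - \sum_i p v i)).
        transitivity (\sum_c (a v c * a v c) - (\sum_c a v c) * (\sum_i p v i)).
          by rewrite A0 mul0r subr0; apply: eq_bigr => c _; rewrite expr2.
        by rewrite mulr_suml -sumrB; apply: eq_bigr => c _; rewrite mulrBr.
      apply: eq_bigr => c _; rewrite {1}/a vvalE mulr_suml.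
      by apply: eq_bigr => x _ /=; rewrite mulrA; congr (_ * _); rewrite mulrC.
    by rewrite big1 // => x _; rewrite vtx mulr0.
  have Sw : \sum_c a w c ^+ 2 = 0.
    by apply: psumr_eq0P S0 w isT => v _; apply: sumr_ge0 => c _; exact: sqr_ge0.
  have /eqP := psumr_eq0P (fun c _ => sqr_ge0 (a w c)) Sw (i := i) isT.
  by rewrite sqrf_eq0 => /eqP.
(* At each midpoint of the grandparent cell two of its three subcells meet, and their sums of [p]
   cancel; three numbers that cancel pairwise vanish. *)
have P0 w : \sum_i p w i = 0.
  case: w => c w.
  have F j : \sum_(c | c != j) \sum_i p (c, w) i = 0.
    have := vtx (inr (w, j)); under eq_bigr do under eq_bigr do rewrite a0 sub0r.
    rewrite (sum_incid_inr b (fun w' _ => - \sum_i p w' i)) sumrN.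
    by move/eqP; rewrite oppr_eq0 => /eqP.
  have := F 0; rewrite big_mkcond !sumI3 /= => e0.
  have := F 1; rewrite big_mkcond !sumI3 /= => e1.
  have := F (-1); rewrite big_mkcond !sumI3 /= => e2.
  move: c; apply: I3P; rewrite ?sumI3; lra.
move=> [x|[w j]].
  have [w [i wi]] := @corner_surj b m.+1 x.
  by have := a0 w i; rewrite /a /vval wi.
by rewrite -/(p w j) pE P0 a0 subrr mul0r.
Qed.

(** The weight multiplying z in the residual: half the number of cells at a vertex, positive because
    every vertex is a corner of some cell. *)
Lemma incid_sum_gt0 m (x : vertex b m) : 0 < (\sum_w \sum_i incid R w i x) / 2%:R.
Proof.
rewrite divr_gt0 ?ltr0n //; have [w [i wi]] := @corner_surj b _ x.
rewrite (bigD1 w) //= (bigD1 i) //= {1}/incid wi eqxx -addrA ltr_pwDl // addr_ge0 //.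
  by apply: sumr_ge0 => j _; rewrite /incid ler0n.
by apply: sumr_ge0 => v _; apply: sumr_ge0 => j _; rewrite /incid ler0n.
Qed.

Lemma deigen_spectrum m : exists2 s : seq R, size s = #|vertex b m| &
  forall z, has_dim setT (@deigen R b m z) (count_mem z s).
Proof.
pose K (x y : vertex b m) : R := \sum_w (3%:R * (\sum_i incid R w i x * incid R w i y)
   - (\sum_i incid R w i x) * (\sum_i incid R w i y)).
have Ksym x y : K x y = K y x.
  apply: eq_bigr => w _; congr (_ * _ - _); last by rewrite mulrC.
  by apply: eq_bigr => i _; rewrite mulrC.
have [s sz Hs] := symmetric_form_spectrum Ksym (@incid_sum_gt0 m); exists s => // z.
rewrite (_ : @deigen R b m z = [set u | forall x, \sum_y K x y * u y =
    z * ((\sum_w \sum_i incid R w i x) / 2 * u x)]) //.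
have resE (u : vertex b m -> R) x : residual z (vval u) x =
    \sum_y K x y * u y - z * ((\sum_w \sum_i incid R w i x) / 2 * u x).
  rewrite !mulr_suml mulr_sumr.
  have -> : \sum_y K x y * u y = \sum_w (3%:R * (\sum_i incid R w i x * vval u w i)
     - (\sum_i incid R w i x) * (\sum_i vval u w i)).
    under eq_bigr do rewrite /K mulr_suml.
    rewrite exchange_big; apply: eq_bigr => w _ /=.
    under eq_bigr do rewrite mulrBl.
    rewrite sumrB; congr (_ - _).
      transitivity (3%:R * \sum_y (\sum_i incid R w i x * incid R w i y) * u y).
        by rewrite mulr_sumr; apply: eq_bigr => y _; rewrite mulrA.
      congr (_ * _).
      transitivity (\sum_y \sum_i incid R w i x * incid R w i y * u y).
        by apply: eq_bigr => y _; rewrite mulr_suml.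
      rewrite exchange_big; apply: eq_bigr => i _ /=.
      by rewrite vvalE mulr_sumr; apply: eq_bigr => y _; rewrite mulrA.
    transitivity ((\sum_i incid R w i x) * \sum_y (\sum_i incid R w i y) * u y).
      by rewrite mulr_sumr; apply: eq_bigr => y _; rewrite mulrA.
    congr (_ * _).
    transitivity (\sum_y \sum_i incid R w i y * u y).
      by apply: eq_bigr => y _; rewrite mulr_suml.
    by rewrite exchange_big; apply: eq_bigr => i _ /=; rewrite vvalE.
  rewrite -sumrB; apply: eq_bigr => w _.
  have -> : z * ((\sum_i incid R w i x) / 2 * u x) = \sum_i z * (incid R w i x / 2 * u x).
    by rewrite !mulr_suml mulr_sumr.
  have -> : (\sum_i incid R w i x) * \sum_i vval u w i =
      \sum_i incid R w i x * \sum_j vval u w j by rewrite mulr_suml.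
  rewrite mulr_sumr -!sumrB; apply: eq_bigr => i _.
  have -> : incid R w i x * ((3 - z / 2) * vval u w i - \sum_j vval u w j) =
    (3 - z / 2) * (incid R w i x * vval u w i) - incid R w i x * \sum_j vval u w j.
    by ring.
  have -> : incid R w i x * vval u w i = incid R w i x * u x.
    by rewrite /incid /vval; case: eqP => [->|] //=; rewrite ?mul0r.
  by move: (\sum_j _) => S; field.
apply/seteqP; split => u /= H x; have := H x; rewrite resE.
  by move/subr0_eq.
by move=> ->; rewrite subrr.
Qed.

Definition dspec m : seq R := projT1 (cid2 (deigen_spectrum m)).

Lemma size_dspec m : size (dspec m) = #|vertex b m|.
Proof. by rewrite /dspec; case: cid2. Qed.

Lemma dspec_dim m z : has_dim setT (@deigen R b m z) (count_mem z (dspec m)).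
Proof. by rewrite /dspec; case: cid2. Qed.

Lemma count_dspec m z : z != 2%:R -> z != 5%:R -> z != 6%:R ->
  count_mem z (dspec m.+1) = count_mem (z * (5%:R - z)) (dspec m).
Proof.
move=> z2 z5 z6; apply: has_dim_inj (dspec_dim _ _) _.
by apply: deigen_dim_decimation => //; apply: dspec_dim.
Qed.

Lemma count_dspec6 m : count_mem 6%:R (dspec m.+1) = #|vertex b m|.
Proof. exact: has_dim_inj (dspec_dim _ _) (deigen6_dim _ _ _). Qed.

Lemma count_dspec2 m : count_mem 2%:R (dspec m.+2) = 0%N.
Proof.
apply: has_dim_inj (dspec_dim _ _) _; apply: has_dim0 => u Eu x _.
exact: deigen2_trivial.
Qed.

End Spectrum.

(** * Counting eigenvalues through the two inverse branches *)

Section SpectrumRecursion.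
Variable R : realType.
Implicit Types (b : bool) (m : nat) (x y z : R).

Lemma dspec0_range b z : z \in dspec R b 0 -> z = 0 \/ z = 6%:R.
Proof.
case: b => [|]; last first.
  by move=> zs; have := size_dspec R false 0; rewrite card_void; case: dspec zs.
move=> zs; have [->|/eqP z6] := eqVneq z 6%:R; [by right|left].
have : (0 < count_mem z (dspec R true 0))%N by rewrite -has_count has_pred1.
move=> /(eigenvalue_has_dim (E := @deigen R true 0) (dspec_dim true 0 z)).
move=> [u [Eu [x _ ux]]].
have E i : (3%:R - z / 2%:R) * u i = \sum_j u j.
  have := Eu i; rewrite /residual.
  rewrite (bigD1 tt) //= [X in _ + X]big1 ?addr0; last by case.
  rewrite (bigD1 i) //= [X in _ + X]big1 ?addr0 => [|j /negbTE ji]; last first.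
    rewrite /incid /=; case: eqP => [[jE]|_]; last by rewrite mul0r.
    by rewrite jE eqxx in ji.
  by rewrite /incid /= eqxx mul1r => /subr0_eq.
have t0 : 3%:R - z / 2%:R != 0.
  by apply/eqP => h; apply: z6; lra.
have : (3%:R - z / 2%:R) * (\sum_j u j) = 3%:R * \sum_j u j.
  by rewrite mulr_sumr sumI3 !E; ring.
move/eqP; rewrite -subr_eq0 -mulrBl mulf_eq0 => /orP[/eqP|/eqP u0].
  by move=> h; lra.
by have /eqP := E x; rewrite u0 mulf_eq0 (negbTE t0) (negbTE ux).
Qed.

(** An eigenvalue other than 2, 5, 6 has z(5 - z) in the previous spectrum; this is nonnegative by
    induction, so z lies in [0, 5]. *)
Lemma dspec_range b m z : z \in dspec R b m -> 0 <= z <= 6%:R.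
Proof.
elim: m z => [|m IH] z zs.
  by case: (dspec0_range zs) => ->; lra.
have [->|z2] := eqVneq z 2%:R; first by lra.
have [->|z5] := eqVneq z 5%:R; first by lra.
have [->|z6] := eqVneq z 6%:R; first by lra.
have /IH : z * (5%:R - z) \in dspec R b m.
  by rewrite -has_pred1 has_count -count_dspec // -has_count has_pred1.
by move=> /andP[h _]; nra.
Qed.

Definition phi_lo x : R := (5%:R - Num.sqrt (25%:R - 4%:R * x)) / 2%:R.
Definition phi_hi x : R := 5%:R - phi_lo x.

Lemma phi_loP x : x <= 25%:R / 4%:R ->
  x = phi_lo x * (5%:R - phi_lo x) /\ phi_lo x <= 5%:R / 2%:R.
Proof.
move=> hx; rewrite /phi_lo; have h0 : 0 <= 25%:R - 4%:R * x by lra.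
have := sqr_sqrtr h0; have := sqrtr_ge0 (25%:R - 4%:R * x).
move: (Num.sqrt _) => s s0 s2; split; last by lra.
have -> : x = (25%:R - s ^+ 2) / 4%:R by lra.
by field.
Qed.

Lemma phi_loK z : z <= 5%:R / 2%:R -> phi_lo (z * (5%:R - z)) = z.
Proof.
move=> hz; have [] := @phi_loP (z * (5%:R - z)); first by nra.
move: (phi_lo _) => y; nra.
Qed.

Lemma phi_lo_eq x z : x <= 25%:R / 4%:R ->
  (phi_lo x == z) = (x == z * (5%:R - z)) && (z <= 5%:R / 2%:R).
Proof.
move=> hx; have [xE xl] := phi_loP hx; apply/eqP/andP => [<-|[/eqP -> zl]].
  by split => //; apply/eqP.
exact: phi_loK.
Qed.

Lemma phi_hi_eq x z : x <= 25%:R / 4%:R ->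
  (phi_hi x == z) = (x == z * (5%:R - z)) && (5%:R / 2%:R <= z).
Proof.
move=> hx; rewrite /phi_hi (_ : (_ == z) = (phi_lo x == 5%:R - z)); last first.
  by apply/eqP/eqP => h; lra.
rewrite phi_lo_eq // opprB addrCA subrr addr0 mulrC; congr (_ && _).
by apply/idP/idP => h; lra.
Qed.

(** The value 6 is left out of the lower branch because [phi_lo] sends it to 2, which is no
    eigenvalue at this level; 0 is left out of the upper branch because [phi_hi] sends it to 5,
    listed apart with its unevaluated multiplicity. *)
Definition dspec_decimation b m : seq R :=
  nseq #|vertex b m.+1| 6%:R ++ nseq (count_mem 5%:R (dspec R b m.+2)) 5%:R ++
  [seq phi_lo y | y <- dspec R b m.+1 & y != 6%:R] ++
  [seq phi_hi y | y <- dspec R b m.+1 & y != 0].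

Lemma dspec_perm b m : perm_eq (dspec R b m.+2) (dspec_decimation b m).
Proof.
apply/allP => z _ /=; apply/eqP.
rewrite /dspec_decimation !count_cat !count_nseq !count_map !count_filter /=.
have r s y : s = dspec R b m.+1 -> y \in s -> y <= 25%:R / 4%:R.
  by move=> -> /dspec_range; lra.
rewrite [X in (_ + (_ + (X + _)))%N](_ : _ = count
   (fun y => [&& y == z * (5%:R - z), z <= 5%:R / 2%:R & y != 6%:R]) (dspec R b m.+1)); last first.
  by apply: eq_in_count => y ys /=; rewrite phi_lo_eq ?andbA // (r _ _ erefl ys).
rewrite [X in (_ + (_ + (_ + X)))%N](_ : _ = count
   (fun y => [&& y == z * (5%:R - z), 5%:R / 2%:R <= z & y != 0]) (dspec R b m.+1)); last first.
  by apply: eq_in_count => y ys /=; rewrite phi_hi_eq ?andbA // (r _ _ erefl ys).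
have c0 (a : pred R) : {in dspec R b m.+1, forall y, a y = false} ->
    count a (dspec R b m.+1) = 0%N.
  by move=> h; rewrite (@eq_in_count _ _ pred0) ?count_pred0.
have [->|z6] := eqVneq z 6%:R.
  rewrite count_dspec6 mul1n (_ : (5%:R == 6%:R) = false) ?eqr_nat // mul0n add0n.
  rewrite c0 => [|y /dspec_range /andP[y0 y6]]; last first.
    by apply/negbTE/negP => /and3P[/eqP yE _ _]; lra.
  rewrite c0 ?addn0 // => y /dspec_range /andP[y0 y6].
  by apply/negbTE/negP => /and3P[/eqP yE _ _]; lra.
rewrite /= ?mul0n ?add0n.
have [<-|z5] := eqVneq 5%:R z.
  rewrite mul1n c0 => [|y ys]; last by apply/negbTE/negP => /and3P[_ h _]; lra.
  rewrite c0 ?addn0 // => y ys.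
  by apply/negbTE/negP => /and3P[/eqP yE _ /eqP]; apply; lra.
rewrite /= ?mul0n ?add0n.
have [->|z2] := eqVneq z 2%:R.
  rewrite count_dspec2 c0 => [|y ys]; last first.
    by apply/negbTE/negP => /and3P[/eqP yE _ /eqP]; apply; lra.
  by rewrite c0 // => y ys; apply/negbTE/negP => /and3P[_ h _]; lra.
rewrite count_dspec //; last by rewrite eq_sym.
have [zl|zg|zE] := ltgtP z (5%:R / 2%:R).
- rewrite [X in _ = (_ + X)%N]c0 ?addn0 => [|y ys]; last by rewrite andbF.
  apply: eq_in_count => y ys /=; case: eqP => //= yE.
  apply/esym/negP => /eqP y6; move: z2; apply/negP/negPn/eqP; nra.
- rewrite [X in _ = (X + _)%N]c0 ?add0n => [|y ys]; last by rewrite andbF.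
  apply: eq_in_count => y ys /=; case: eqP => //= yE.
  apply/esym/negP => /eqP y6; move: z5; apply/negP/negPn/eqP; nra.
(* At the branch point 5/2 the preimage equation would need y = 25/4, beyond the range [0, 6]. *)
- have F y : y \in dspec R b m.+1 -> (y == z * (5%:R - z)) = false.
    move=> /dspec_range /andP[y0 y6].
    by apply/negbTE/negP => /eqP yE; rewrite zE in yE; lra.
  by rewrite !c0 // => y /F /= ->.
Qed.

Definition dcount b m x : nat := count (fun z => z <= x) (dspec R b m).

Lemma dcountE b m x : dcount b m.+2 x =
  ((6%:R <= x)%R * #|vertex b m.+1| + ((5%:R <= x)%R * count_mem 5%:R%R (dspec R b m.+2) +
  (count (fun y => (phi_lo y <= x) && (y != 6%:R))%R (dspec R b m.+1) +
   count (fun y => (phi_hi y <= x) && (y != 0))%R (dspec R b m.+1))))%N.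
Proof.
rewrite /dcount (permP (dspec_perm b m)) /dspec_decimation.
by rewrite !count_cat !count_nseq !count_map !count_filter.
Qed.

Lemma count_dspec_neq6 b m :
  (count (fun y => y != 6%:R)%R (dspec R b m.+1) + #|vertex b m|)%N = #|vertex b m.+1|.
Proof. by rewrite -(count_dspec6 R b m) addnC count_predC size_dspec. Qed.

Lemma phi_lo_range b m y : y \in dspec R b m ->
  [/\ 0 <= y <= 6%:R, y = phi_lo y * (5%:R - phi_lo y), 0 <= phi_lo y & phi_lo y <= 2%:R].
Proof.
move=> /dspec_range/andP[y0 y6]; have [] := @phi_loP y; first by lra.
by rewrite y0 y6; move: (phi_lo y) => p pE pl; split=> //; nra.
Qed.

Lemma dcount_low b m x : 0 < x < 2%:R ->
  dcount b m.+2 x = dcount b m.+1 (x * (5%:R - x)).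
Proof.
move=> /andP[x0 x2].
have h6 : (6%:R <= x) = false by apply/negbTE; rewrite -ltNge; lra.
have h5 : (5%:R <= x) = false by apply/negbTE; rewrite -ltNge; lra.
rewrite dcountE h6 h5 !mul0n !add0n.
rewrite [X in (_ + X)%N](@eq_in_count _ _ pred0) ?count_pred0 ?addn0 => [|y ys] /=.
  apply: eq_in_count => y /phi_lo_range[/andP[y0 y6] yE p0 p2] /=.
  apply/andP/idP => [[h _]|h]; first by nra.
  by split; [nra | apply/eqP => y6E; nra].
apply/negbTE/negP => /andP[]; rewrite /phi_hi.
by have [_ _ ? ?] := phi_lo_range ys; lra.
Qed.

(** Such x lies above the whole lower branch, which stays within [0, 2], and below the upper one,
    which stays within [3, 5]. *)
Lemma dcount_mid b m x : 2%:R < x < 3%:R ->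
  (dcount b m.+2 x + #|vertex b m|)%N = #|vertex b m.+1|.
Proof.
move=> /andP[x2 x3];
have h6 : (6%:R <= x) = false by apply/negbTE; rewrite -ltNge; lra.
have h5 : (5%:R <= x) = false by apply/negbTE; rewrite -ltNge; lra.
rewrite dcountE h6 h5 !mul0n !add0n.
rewrite [X in (_ + X + _)%N](@eq_in_count _ _ pred0) ?count_pred0 ?addn0 => [|y ys] /=.
  rewrite -[RHS]count_dspec_neq6; congr addn; apply: eq_in_count => y /phi_lo_range[_ _ p0 p2] /=.
  by rewrite (le_trans p2) // ltW.
apply/negbTE/negP => /andP[]; rewrite /phi_hi.
by have [_ _ ? ?] := phi_lo_range ys; lra.
Qed.

(** The upper branch reverses the order: [phi_hi y <= x] means that y is at least x(5 - x), so the
    smaller y are the ones to discount, with a strict inequality. *)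
Lemma dcount_high b m x : 3%:R < x < 5%:R ->
  (dcount b m.+2 x + #|vertex b m| + count (fun y => y < x * (5%:R - x))%R (dspec R b m.+1))%N
    = (#|vertex b m.+1| + #|vertex b m.+1|)%N.
Proof.
move=> /andP[x3 x5];
have h6 : (6%:R <= x) = false by apply/negbTE; rewrite -ltNge; lra.
have h5 : (5%:R <= x) = false by apply/negbTE; rewrite -ltNge; lra.
rewrite dcountE h6 h5 !mul0n !add0n.
rewrite (addnAC _ _ #|vertex b m|) -addnA; congr addn.
  rewrite -[RHS]count_dspec_neq6; congr addn; apply: eq_in_count => y /phi_lo_range[_ _ p0 p2] /=.
  by have -> : phi_lo y <= x by lra.
rewrite -(size_dspec R) -(count_predC (fun y => y < x * (5%:R - x))) addnC; congr addn.
apply: eq_in_count => y /phi_lo_range[/andP[y0 y6] yE p0 p2] /=; rewrite -leNgt /phi_hi.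
apply/andP/idP => [[h _]|h]; first by nra.
by split; [nra | apply/eqP => y6E; nra].
Qed.

(** An eigenvalue in ]5, 6[ would give a negative z(5 - z) in the previous spectrum. *)
Lemma dcount_top b m x : 5%:R < x < 6%:R ->
  (dcount b m.+2 x + #|vertex b m.+1|)%N = #|vertex b m.+2|.
Proof.
move=> /andP[x5 x6]; rewrite -[RHS]count_dspec_neq6; congr addn.
apply: eq_in_count => z zs /=.
have [->|z2] := eqVneq z 2%:R.
  by rewrite eqr_nat /=; lra.
have [->|z5] := eqVneq z 5%:R.
  by rewrite eqr_nat /=; lra.
have [->|z6] := eqVneq z 6%:R; first by apply/negbTE; rewrite -ltNge.
have /dspec_range : z * (5%:R - z) \in dspec R b m.+1.
  by rewrite -has_pred1 has_count -count_dspec // -has_count has_pred1.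
move=> /andP[h _]; have /andP[h0 h6] := dspec_range zs.
by nra.
Qed.

Definition bsign b : R := if b then 1 else -1.

Lemma card_word m : #|word m| = (3 ^ m)%N.
Proof. by elim: m => [|m IH]; rewrite ?card_unit //= card_prod card_ord IH expnS. Qed.

Lemma card_vertex b m : #|vertex b m|%:R = 3%:R / 2%:R * 3%:R ^+ m + bsign b * (3%:R / 2%:R) :> R.
Proof.
elim: m => [|m IH].
  by case: b; rewrite /= ?card_ord ?card_void /bsign; lra.
rewrite /= card_sum card_prod card_ord card_word natrD IH natrM natrX exprS.
by field.
Qed.

End SpectrumRecursion.

(** * Spectral gaps and a covering of the exceptional points *)

Section GoodPoints.
Variable R : realType.
Implicit Types (b : bool) (m : nat) (x y z : R).

(** One pair A, B serves both boundary conditions and all y near x. In particular the count is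
    constant near x, so that x lies in a gap of all spectra from level m0 on. *)
Definition gap_point x : Prop :=
  exists e A B : R, exists m0 : nat, 0 < e /\
    forall y, `|y - x| < e -> forall m, (m0 <= m)%N -> forall b,
      (dcount b m y)%:R = A * 3%:R ^+ m + bsign R b * B.

Lemma gap_point_mid x : 2%:R < x < 3%:R -> gap_point x.
Proof.
move=> /andP[x2 x3].
(* The count at level m + 2 is a difference of two numbers of vertices, 3^(m+1); the offsets
   cancel. *)
exists (Num.min (x - 2%:R) (3%:R - x)), (3%:R^-1), 0, 2%N.
split; first by rewrite lt_min; apply/andP; split; lra.
move=> y; rewrite lt_min !ltr_norml => /andP[/andP[h1 h2] /andP[h3 h4]] [|[|m]] // _ b.
have hy : 2%:R < y < 3%:R by lra.
have /(congr1 (fun n : nat => n%:R : R)) := dcount_mid b m hy.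
rewrite natrD !card_vertex !exprS; move: (3%:R ^+ m) => t H.
have -> : (dcount b m.+2 y)%:R = 3%:R * t.
  by move: H; lra.
by field.
Qed.

Lemma gap_point_top x : 5%:R < x < 6%:R -> gap_point x.
Proof.
move=> /andP[x5 x6].
exists (Num.min (x - 5%:R) (6%:R - x)), 1, 0, 2%N.
split; first by rewrite lt_min; apply/andP; split; lra.
move=> y; rewrite lt_min !ltr_norml => /andP[/andP[h1 h2] /andP[h3 h4]] [|[|m]] // _ b.
have hy : 5%:R < y < 6%:R by lra.
have /(congr1 (fun n : nat => n%:R : R)) := dcount_top b m hy.
rewrite natrD !card_vertex !exprS; move: (3%:R ^+ m) => t H.
by rewrite mulr0 addr0; lra.
Qed.

Lemma decimation_near x e : 0 < x < 6%:R -> 0 < e -> exists2 d, 0 < d &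
  forall y, `|y - x| < d -> `|y * (5%:R - y) - x * (5%:R - x)| < e.
Proof.
(* 20 is a crude bound for |5 - x - y|. *)
move=> /andP[x0 x6] e0; exists (Num.min 1 (e / 20%:R)).
  by rewrite lt_min ltr01 divr_gt0.
move=> y; rewrite lt_min => /andP[h1 h2].
have -> : y * (5%:R - y) - x * (5%:R - x) = (y - x) * (5%:R - x - y) by ring.
rewrite normrM; move: h1; rewrite ltr_norml => /andP[h3 h4].
apply: (@le_lt_trans _ _ (`|y - x| * 20%:R)); last by rewrite -ltr_pdivlMr.
by apply: ler_wpM2l => //; rewrite ler_norml; lra.
Qed.

Lemma gap_point_low x : 0 < x < 2%:R -> gap_point (x * (5%:R - x)) -> gap_point x.
Proof.
move=> /andP[x0 x2] [e [A [B [m0 [e0 H]]]]].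
have [|d d0 Hd] := @decimation_near x e _ e0; first by lra.
exists (Num.min d (Num.min x (2%:R - x))), (A / 3%:R), B, m0.+2.
split; first by rewrite !lt_min d0; apply/andP; split; lra.
move=> y; rewrite !lt_min => /and3P[h1 h2 h3] [|[|m]] // mm b.
have hy : 0 < y < 2%:R by move: h2 h3; rewrite !ltr_norml; lra.
rewrite (dcount_low b m hy) (H _ (Hd _ h1)) //; last exact: ltnW.
by rewrite !exprS; field.
Qed.

(** Needed for the upper branch, where strict counts occur: in a gap they agree with the weak ones,
    being squeezed between the weak counts at y and at a slightly smaller point. *)
Lemma count_lt_dcount b m x y e A : 0 < e ->
  (forall z, `|z - x| < e -> (dcount b m z)%:R = A :> R) -> `|y - x| < e ->
  (count (fun z => z < y) (dspec R b m))%:R = A.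
Proof.
move=> e0 H hy; pose y' := (y + x - e) / 2%:R.
have hy' : `|y' - x| < e by move: hy; rewrite /y' !ltr_norml; lra.
have lt_y'y : y' < y by move: hy; rewrite /y' ltr_norml; lra.
have h1 : (dcount b m y' <= count (fun z => z < y)%R (dspec R b m))%N.
  by apply: sub_count => z /= /le_lt_trans; apply.
have h2 : (count (fun z => z < y)%R (dspec R b m) <= dcount b m y)%N.
  by apply: sub_count => z /= /ltW.
apply/eqP; rewrite eq_le; apply/andP; split.
  by rewrite -(H _ hy) ler_nat.
by rewrite -(H _ hy') ler_nat.
Qed.

Lemma gap_point_high x : 3%:R < x < 5%:R -> gap_point (x * (5%:R - x)) -> gap_point x.
Proof.
move=> /andP[x3 x5] [e [A [B [m0 [e0 H]]]]].
have [|d d0 Hd] := @decimation_near x e _ e0; first by lra.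
(* From 2 |V_(m+1)| - |V_m| - (A 3^(m+1) +- B), where the numbers of vertices contribute 15/2 3^m +-
   3/2; the division by 9 refers it to level m + 2. *)
exists (Num.min d (Num.min (x - 3%:R) (5%:R - x))), ((15%:R / 2%:R - 3%:R * A) / 9%:R),
  (3%:R / 2%:R - B), m0.+2.
split; first by rewrite !lt_min d0; apply/andP; split; lra.
move=> y; rewrite !lt_min => /and3P[h1 h2 h3] [|[|m]] // mm b.
have hy : 3%:R < y < 5%:R by move: h2 h3; rewrite !ltr_norml; lra.
have mm' : (m0 <= m.+1)%N by exact: ltnW.
have C := count_lt_dcount e0 (fun z hz => H z hz m.+1 mm' b) (Hd _ h1).
have /(congr1 (fun n : nat => n%:R : R)) := dcount_high b m hy.
rewrite !natrD C !card_vertex !exprS; move: (3%:R ^+ m) => t E.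
have -> : (dcount b m.+2 y)%:R = 2%:R * (3%:R / 2%:R * (3%:R * t) + bsign R b * (3%:R / 2%:R))
  - (3%:R / 2%:R * t + bsign R b * (3%:R / 2%:R)) - (A * (3%:R * t) + bsign R b * B).
  by move: E; lra.
by field.
Qed.

Definition bad_point x : Prop := 0 < x < 6%:R /\ ~ gap_point x.

Lemma bad_point_le5 x : bad_point x -> x <= 5%:R.
Proof.
move=> [/andP[x0 x6] ng]; rewrite leNgt; apply/negP => x5.
by apply/ng/gap_point_top/andP.
Qed.

Lemma bad_point_step x : bad_point x ->
  [\/ x = 2%:R, x = 3%:R, x = 5%:R | bad_point (x * (5%:R - x))].
Proof.
move=> bx; have x5 := bad_point_le5 bx; have [/andP[x0 x6] ng] := bx.
have [->|/eqP n2] := eqVneq x 2%:R; first by constructor 1.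
have [->|/eqP n3] := eqVneq x 3%:R; first by constructor 2.
have [->|/eqP n5] := eqVneq x 5%:R; first by constructor 3.
constructor 4.
have [x2|x2] := ltP x 2%:R.
  by split; [nra|move=> g; apply: ng; apply: gap_point_low g; lra].
have [x3|x3] := ltP x 3%:R.
  by case: ng; apply: gap_point_mid; lra.
by split; [nra|move=> g; apply: ng; apply: gap_point_high g; lra].
Qed.

Lemma decimation_homo x y : y <= 5%:R / 2%:R -> x <= 5%:R / 2%:R ->
  y * (5%:R - y) <= x * (5%:R - x) -> y <= x.
Proof.
move=> y5 x5 h; rewrite leNgt; apply/negP => xy.
have : 0 < (y - x) * (5%:R - y - x) by apply: mulr_gt0; lra.
by nra.
Qed.

(** The difference quotient of the branch is 1/(5 - p - r) for its values p and r. Below 5 these are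
    at most 7/5, since 7/5 times 18/5 exceeds 5, whence 5/11. Up to 6 the slope would reach 1 and
    two branches would not contract the total length. *)
Lemma phi_lo_dist x y : 0 <= x -> x <= y -> y <= 5%:R ->
  [/\ 0 <= phi_lo x, phi_lo x <= phi_lo y, phi_lo y <= 7%:R / 5%:R &
      phi_lo y - phi_lo x <= 5%:R / 11%:R * (y - x)].
Proof.
move=> x0 xy y5.
have [|] := @phi_loP _ x; first by lra.
have [|] := @phi_loP _ y; first by lra.
move: (phi_lo x) (phi_lo y) => p r hy r2 hx p2.
have rle : r <= 7%:R / 5%:R by nra.
have p0 : 0 <= p by nra.
have pr : p <= r by nra.
by split => //; nra.
Qed.

(* At bad points both inverse branches of z(5 - z) contract by 5/11, whence the
   factor 10/11. *)
Lemma bad_point_cover (k : nat) : exists s : seq (R * R),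
  [/\ forall p, p \in s -> [/\ 0 <= p.1, p.1 <= p.2 & p.2 <= 5%:R],
      \sum_(p <- s) (p.2 - p.1) <= 5%:R * (10%:R / 11%:R) ^+ k &
      forall x, bad_point x -> exists2 p, p \in s & p.1 <= x <= p.2].
Proof.
elim: k => [|k [s [s1 s2 s3]]].
  exists [:: (0, 5%:R)]; split => [p||x bx].
  - by rewrite inE => /eqP -> /=; split; lra.
  - by rewrite big_seq1 /= expr0; lra.
  - exists (0, 5%:R); rewrite ?inE //=.
    by have := bad_point_le5 bx; have [? _] := bx; lra.
exists ([:: (2%:R, 2%:R); (3%:R, 3%:R); (5%:R, 5%:R)] ++
  ([seq (phi_lo p.1, phi_lo p.2) | p <- s] ++ [seq (phi_hi p.2, phi_hi p.1) | p <- s])).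
split => [p||x].
- rewrite !mem_cat => /or3P[||].
  + by rewrite !inE => /or3P[] /eqP -> /=; split; lra.
  + case/mapP => -[a c] /s1 /= [h1 h2 h3] ->.
    by have [? ? ? _] := phi_lo_dist h1 h2 h3; split => /=; lra.
  + case/mapP => -[a c] /s1 /= [h1 h2 h3] ->.
    by have [? ? ? _] := phi_lo_dist h1 h2 h3; rewrite /phi_hi; split => /=; lra.
- rewrite !big_cat /= !big_cons big_nil !big_map /= !subrr !add0r -big_split /=.
  apply: (@le_trans _ _ (\sum_(p <- s) 10%:R / 11%:R * (p.2 - p.1))).
    rewrite big_seq [leRHS]big_seq; apply: ler_sum => -[a c] /s1 /= [h1 h2 h3].
    by have [_ _ _ h] := phi_lo_dist h1 h2 h3; rewrite /phi_hi; lra.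
  by rewrite -mulr_sumr exprS mulrCA; apply: ler_wpM2l => //; lra.
- move=> /[dup] bx /bad_point_step[->|->|->|].
  + by exists (2%:R, 2%:R); rewrite ?mem_cat ?inE ?eqxx //= lexx.
  + by exists (3%:R, 3%:R); rewrite ?mem_cat ?inE ?eqxx ?orbT //= lexx.
  + by exists (5%:R, 5%:R); rewrite ?mem_cat ?inE ?eqxx ?orbT //= lexx.
  + move=> /s3[[a c] ps /= /andP[h4 h5]]; have /= [h1 h2 h3] := s1 _ ps.
    have [? ? ? _] := phi_lo_dist h1 h2 h3.
    have [|E1 _] := @phi_loP _ a; first by lra.
    have [|E2 _] := @phi_loP _ c; first by lra.
    have x5 := bad_point_le5 bx; have [/andP[x0 _] _] := bx.
    have [x2|x2] := leP x (5%:R / 2%:R).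
      exists (phi_lo a, phi_lo c).
        by rewrite !inE mem_cat (map_f (fun p => (phi_lo p.1, phi_lo p.2)) ps) !orbT.
      by apply/andP; split => /=; apply: decimation_homo; lra.
    exists (phi_hi c, phi_hi a).
      by rewrite !inE mem_cat (map_f (fun p => (phi_hi p.2, phi_hi p.1)) ps) !orbT.
    have E (y : R) : (5%:R - y) * (5%:R - (5%:R - y)) = y * (5%:R - y) by ring.
    rewrite /phi_hi /=; apply/andP; split.
      rewrite lerBlDl -lerBlDr; apply: decimation_homo; rewrite ?E; lra.
    rewrite lerBrDr -lerBrDl; apply: decimation_homo; rewrite ?E; lra.
Qed.

End GoodPoints.

(** * The function psi and its bilipschitz bounds *)

Section Linearizer.
Variable R : realType.
Implicit Types (x y z : R) (k : nat).

Lemma phi_lo_small x : `|x| <= 1 -> `|phi_lo x| <= `|x| / 4%:R.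
Proof.
move=> hx; have hx2 := hx; rewrite ler_norml in hx2.
have [|] := @phi_loP _ x; first by lra.
move: (phi_lo x) => a xE a2.
have a1 : `|a| <= 1 by rewrite ler_norml; apply/andP; split; nra.
rewrite {1}xE normrM ler_pdivlMr // ler_wpM2l //.
by move: a1; rewrite ler_norml => a1; rewrite ger0_norm; lra.
Qed.

Lemma iter_phi_lo_small x k : `|x| <= 1 -> `|iter k (@phi_lo R) x| <= 4%:R^-1 ^+ k.
Proof.
move=> hx; elim: k => [|k IH]; first by rewrite expr0.
have h1 : 4%:R^-1 ^+ k <= (1 : R) by apply: exprn_ile1; lra.
rewrite iterS exprS mulrC; apply: le_trans (phi_lo_small (le_trans IH h1)) _.
by apply: ler_wpM2r => //; lra.
Qed.

Lemma iter_phi_loS x k : `|x| <= 1 ->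
  iter k (@phi_lo R) x = iter k.+1 (@phi_lo R) x * (5%:R - iter k.+1 (@phi_lo R) x).
Proof.
move=> hx; rewrite iterS; apply: (proj1 (phi_loP _)).
have := iter_phi_lo_small k hx; have : 4%:R^-1 ^+ k <= (1 : R) by apply: exprn_ile1; lra.
by rewrite ler_norml; lra.
Qed.

Lemma phi_lo0 : phi_lo (0 : R) = 0.
Proof.
have := @phi_lo_small 0; rewrite normr0 ler01 => /(_ isT).
by rewrite mul0r normr_le0 => /eqP.
Qed.

Lemma iter_phi_lo0 k : iter k (@phi_lo R) 0 = 0.
Proof. by elim: k => //= k ->; exact: phi_lo0. Qed.

(** One more iterate divides the scaled difference by 1 - e with |e| at most 4^-k / 10. The factors
    (1 + 4^-k)/2 and 2 - 4^-k absorb all these corrections and stay between 1/2 and 2. *)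
Lemma iter_phi_lo_dist x y k : -1 <= y -> y <= x -> x <= 1 ->
  (1 + 4%:R^-1 ^+ k) / 2%:R * (x - y) <=
    5%:R ^+ k * (iter k (@phi_lo R) x - iter k (@phi_lo R) y) <=
  (2%:R - 4%:R^-1 ^+ k) * (x - y).
Proof.
move=> y1 yx x1.
have hx : `|x| <= 1 by rewrite ler_norml; lra.
have hy : `|y| <= 1 by rewrite ler_norml; lra.
elim: k => [|k /andP[IH1 IH2]]; first by rewrite !expr0 /=; lra.
move: IH1 IH2; rewrite (iter_phi_loS k hx) (iter_phi_loS k hy).
have := iter_phi_lo_small k.+1 hx; have := iter_phi_lo_small k.+1 hy.
move: (iter k.+1 _ x) (iter k.+1 _ y) => a c; rewrite !exprS.
have q0 : 0 <= 4%:R^-1 ^+ k :> R by apply: exprn_ge0; lra.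
have : 4%:R^-1 ^+ k <= (1 : R) by apply: exprn_ile1; lra.
move: (4%:R^-1 ^+ k) (5%:R ^+ k) q0 => q f q0 q1.
rewrite !ler_norml => /andP[c1 c2] /andP[a1 a2].
have -> : f * (a * (5%:R - a) - c * (5%:R - c)) =
  (5%:R * f * (a - c)) * (1 - (a + c) / 5%:R) by field.
move: (5%:R * f * (a - c)) => D.
have : - (q / 10%:R) <= (a + c) / 5%:R <= q / 10%:R by lra.
move: ((a + c) / 5%:R) => e /andP[e1 e2].
have : 0 <= x - y by lra.
move: (x - y) => d d0 D1 D2.
have e0 : 0 < 1 - e by lra.
apply/andP; split.
  rewrite -(ler_pM2r e0); apply: le_trans D1.
  rewrite mulrAC; apply: ler_wpM2r => //.
  apply: (@le_trans _ _ ((1 + 4%:R^-1 * q) / 2%:R * (1 + q / 10%:R))).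
    by apply: ler_wpM2l; lra.
  by nra.
rewrite -(ler_pM2r e0); apply: (le_trans D2).
rewrite mulrAC; apply: ler_wpM2r => //.
apply: (@le_trans _ _ ((2%:R - 4%:R^-1 * q) * (1 - q / 10%:R))).
  by nra.
by apply: ler_wpM2l; lra.
Qed.

Definition psi_seq x k : R := 3%:R / 2%:R * 5%:R ^+ k * iter k (@phi_lo R) x.

(* The inverse of the linearizer of z(5 - z) at its repelling fixed point 0. *)
Definition psi x : R := limn (psi_seq x).

(** The increments are 3/2 5^k times a square, so the sequence increases for either sign of x. *)
Lemma psi_cvg x : `|x| <= 1 -> psi_seq x @ \oo --> psi x.
Proof.
move=> hx; apply: nondecreasing_is_cvgn.
  apply/nondecreasing_seqP => k; rewrite /psi_seq (iter_phi_loS k hx) exprS.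
  have : 0 <= 5%:R ^+ k :> R by apply: exprn_ge0.
  move: (5%:R ^+ k) (iter k.+1 _ x) => f a f0.
  rewrite -subr_ge0 (_ : _ - _ = 3%:R / 2%:R * f * (a * a)); last by field.
  by apply: mulr_ge0; [apply: mulr_ge0 => //; lra | rewrite -expr2 sqr_ge0].
exists 3%:R => _ [k _ <-]; rewrite /psi_seq.
have q0 : 0 <= 4%:R^-1 ^+ k :> R by apply: exprn_ge0; lra.
move: hx; rewrite ler_norml => /andP[x1 x2].
have [x0|x0] := leP 0 x.
  have /andP[_] := @iter_phi_lo_dist x 0 k (@lerN10 R) x0 x2.
  rewrite iter_phi_lo0 !subr0 -mulrA.
  by move: (5%:R ^+ k * _) => D; nra.
have /andP[+ _] := @iter_phi_lo_dist 0 x k x1 (ltW x0) ler01.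
have : 0 <= (1 + 4%:R^-1 ^+ k) / 2%:R * (0 - x) by apply: mulr_ge0; lra.
rewrite iter_phi_lo0 !sub0r -[3%:R / 2%:R * _ * _]mulrA [5%:R ^+ k * - _]mulrN.
by move: (5%:R ^+ k * _) => D; lra.
Qed.

Lemma cvgn_ge (u : nat -> R) l c : u @ \oo --> l -> (forall k, c <= u k) -> c <= l.
Proof.
move=> ul H; rewrite -(cvg_lim _ ul) //; apply: limr_ge; first exact: cvgP ul.
exact: nearW.
Qed.

Lemma cvgn_le (u : nat -> R) l c : u @ \oo --> l -> (forall k, u k <= c) -> l <= c.
Proof.
move=> ul H; rewrite -(cvg_lim _ ul) //; apply: limr_le; first exact: cvgP ul.
exact: nearW.
Qed.

Lemma psi_dist x y : -1 <= y -> y <= x -> x <= 1 ->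
  3%:R / 4%:R * (x - y) <= psi x - psi y <= 3%:R * (x - y).
Proof.
move=> y1 yx x1.
have hx : `|x| <= 1 by rewrite ler_norml; lra.
have hy : `|y| <= 1 by rewrite ler_norml; lra.
have C := cvgB (FF := eventually_filter) (psi_cvg hx) (psi_cvg hy).
have H k : 3%:R / 4%:R * (x - y) <= psi_seq x k - psi_seq y k <= 3%:R * (x - y).
  have := iter_phi_lo_dist k y1 yx x1; rewrite /psi_seq -!mulrA -!mulrBr.
  have q0 : 0 <= 4%:R^-1 ^+ k :> R by apply: exprn_ge0; lra.
  by move: (5%:R ^+ k * _) => D; nra.
apply/andP; split.
  by apply: (cvgn_ge C) => k; have /andP[] := H k.
by apply: (cvgn_le C) => k; have /andP[] := H k.
Qed.

Lemma psi0 : psi 0 = 0.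
Proof.
rewrite /psi (_ : psi_seq 0 = fun=> 0) ?lim_cst //.
by apply/funext => k; rewrite /psi_seq iter_phi_lo0 mulr0.
Qed.

Lemma psi_phi_lo x : `|x| <= 1 -> 5%:R * psi (phi_lo x) = psi x.
Proof.
move=> hx; have hp : `|phi_lo x| <= 1 by apply: le_trans (phi_lo_small hx) _; lra.
have C := psi_cvg hp; apply: (@cvg_unique _ _ (psi_seq x @ \oo)) => //; last exact: psi_cvg.
rewrite /= -(cvg_shiftS (psi_seq x)).
rewrite (_ : [sequence _]_n = fun n => 5%:R * psi_seq (phi_lo x) n).
  by apply: cvgMl_tmp.
by apply/funext => k; rewrite /psi_seq /= -iterSr iterS exprS; ring.
Qed.

(** The argument is clamped to [-1, 1], where the bilipschitz bounds hold, to obtain a function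
    continuous on the line for the intermediate value theorem. *)
Lemma psi_cont : continuous (fun x => psi (Num.max (-1) (Num.min 1 x))).
Proof.
pose c x : R := Num.max (-1) (Num.min 1 x).
have c1 x : -1 <= c x <= 1.
  by rewrite /c le_max lexx ge_max ge_min lexx /= andbT; lra.
have cd x y : y <= x -> c y <= c x /\ c x - c y <= x - y.
  move=> yx; rewrite /c /Num.max /Num.min.
  by case: ifP; case: ifP; case: ifP; case: ifP => *; lra.
move=> x; apply/cvgrPdist_lt => e e0; near=> y.
have : `|x - y| < e / 3%:R by near: y; apply: cvgr_dist_lt => //; rewrite divr_gt0.
rewrite ltr_norml => /andP[h1 h2] /=; rewrite -/(c x) -/(c y).
have /andP[? ?] := c1 x; have /andP[? ?] := c1 y.
have [yx|/ltW xy] := leP y x.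
  have [h3 h4] := cd _ _ yx.
  have /andP[] : 3%:R / 4%:R * (c x - c y) <= psi (c x) - psi (c y) <= 3%:R * (c x - c y).
    by apply: psi_dist.
  by rewrite ltr_norml; lra.
have [h3 h4] := cd _ _ xy.
have /andP[] : 3%:R / 4%:R * (c y - c x) <= psi (c y) - psi (c x) <= 3%:R * (c y - c x).
  by apply: psi_dist.
by rewrite ltr_norml; lra.
Unshelve. all: by end_near. Qed.

Lemma psi_surj a b t : -1 <= a -> a <= b -> b <= 1 -> psi a <= t <= psi b ->
  exists2 x, a <= x <= b & psi x = t.
Proof.
move=> a1 ab b1 tab.
have C x : a <= x <= b -> Num.max (-1) (Num.min 1 x) = x.
  by move=> h; rewrite min_r ?max_r //; lra.
have := @IVT R (fun x => psi (Num.max (-1) (Num.min 1 x))) a b t ab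
  (continuous_subspaceT psi_cont).
rewrite !C ?lexx ?ab // ge_min le_max.
case; first by case/andP: tab => -> ->; rewrite orbT.
by move=> x; rewrite in_itv /= => xab; rewrite C // => <-; exists x.
Qed.

Lemma psi_homo x y : -1 <= y -> x <= 1 -> y <= x -> psi y <= psi x.
Proof.
move=> y1 x1 yx; have /andP[h _] := psi_dist y1 yx x1.
by lra.
Qed.

Lemma psi_le x y : -1 <= x <= 1 -> -1 <= y <= 1 -> (psi x <= psi y) = (x <= y).
Proof.
move=> hx hy; apply/idP/idP => [|xy]; last by apply: psi_homo; lra.
rewrite leNgt => h; rewrite leNgt; apply: contra h => yx.
have /andP[h _] : 3%:R / 4%:R * (x - y) <= psi x - psi y <= 3%:R * (x - y).
  by apply: psi_dist; lra.
by lra.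
Qed.

End Linearizer.

(** * Barycentric coordinates and intersections of cells *)

Section Geometry.
Variables (R : realType) (q : 'I_3 -> 'rV[R]_2).
Hypothesis hq : equilateral q.

Lemma sqdist2 (x y : 'rV[R]_2) :
  sqdist x y = (x 0 0 - y 0 0) ^+ 2 + (x 0 1 - y 0 1) ^+ 2.
Proof.
rewrite /sqdist !big_ord_recl big_ord0 addr0.
by congr (_ + (x 0 _ - y 0 _) ^+ 2); apply: val_inj.
Qed.

Definition side : R := projT1 (cid2 hq).

Lemma side_gt0 : 0 < side.
Proof. by rewrite /side; case: cid2. Qed.

Lemma sqdist_side i j : i != j -> sqdist (q i) (q j) = side.
Proof. by rewrite /side; case: cid2 => s s0 H; exact: H. Qed.

(* Barycentric coordinates, read off from the squared distances to the vertices. *)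
Definition bary i (x : 'rV[R]_2) : R :=
  3%:R^-1 + (\sum_j sqdist x (q j) - 3%:R * sqdist x (q i)) / (3%:R * side).

Lemma bary_q i j : bary i (q j) = (i == j)%:R.
Proof.
have s0 : side != 0 by rewrite gt_eqF // side_gt0.
have D k l : sqdist (q k) (q l) = if k == l then 0 else side.
  case: eqP => [->|/eqP /sqdist_side //].
  by rewrite sqdist2 !subrr expr0n addr0.
by rewrite /bary !sumI3 !D; move: i j; apply: I3P; apply: I3P => /=; field.
Qed.

Lemma bary_Fmap i j x : bary i (Fmap q j x) = (bary i x + (i == j)%:R) / 2%:R.
Proof.
have s0 : side != 0 by rewrite gt_eqF // side_gt0.
by rewrite -bary_q /bary !sumI3 !sqdist2 /Fmap !mxE; field.
Qed.

Lemma bary_sum x : \sum_i bary i x = 1.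
Proof.
have s0 : side != 0 by rewrite gt_eqF // side_gt0.
by rewrite /bary !sumI3; field.
Qed.

Definition comb (x : 'rV[R]_2) : 'rV[R]_2 := \sum_i bary i x *: q i.

Lemma comb_Fmap j x : comb (Fmap q j x) = 2%:R^-1 *: (comb x + q j).
Proof.
rewrite /comb !sumI3 !bary_Fmap; apply/rowP => k; rewrite !mxE.
by move: j; apply: I3P => /=; field.
Qed.

(** The closed triangle. The equation [comb hq x = x] says that the coordinates determine the point;
    as a condition preserved by the maps [Fmap] it can be propagated together with positivity. *)
Definition tri : set 'rV[R]_2 := [set x | comb x = x /\ forall i, 0 <= bary i x].

Lemma tri_q i : tri (q i).
Proof.
split; last by move=> j; rewrite bary_q ler0n.
rewrite /comb (bigD1 i) //= big1 ?addr0 ?bary_q ?eqxx ?scale1r // => j /negbTE ji.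
by rewrite bary_q ji scale0r.
Qed.

Lemma tri_Fmap i x : tri x -> tri (Fmap q i x).
Proof.
move=> [cx bx]; split; first by rewrite comb_Fmap cx.
by move=> j; rewrite bary_Fmap divr_ge0 // addr_ge0 ?ler0n.
Qed.

Lemma tri_vertex b y : tri y -> 1 <= bary b y -> y = q b.
Proof.
move=> [cy by0] h; have := bary_sum y; rewrite (bigD1 b) //= => S.
have S0 : \sum_(i | i != b) bary i y = 0.
  by apply/eqP; rewrite eq_le sumr_ge0 // andbT; lra.
have h0 i : i != b -> bary i y = 0 by exact: (psumr_eq0P (fun j _ => by0 j) S0).
rewrite -cy /comb (bigD1 b) //= big1 => [|i /h0 ->]; last by rewrite scale0r.
by rewrite addr0 (_ : bary b y = 1) ?scale1r //; lra.
Qed.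

Lemma bary_le1 i y : tri y -> bary i y <= 1.
Proof.
move=> [_ by0]; rewrite -(bary_sum y) (bigD1 i) //= lerDl.
exact: sumr_ge0.
Qed.

Lemma Fmap_inj i : injective (Fmap q i).
Proof.
move=> x y; rewrite /Fmap => /(scalerI _) -/(_ _)/addIr; apply.
by rewrite invr_eq0 pnatr_eq0.
Qed.

(** Coordinate b is at most 1/2 on the image of F_a and at least 1/2 on that of F_b, so at a common
    point both bounds are attained. *)
Lemma Fmap_sep a b y y' : a != b -> tri y -> tri y' ->
  Fmap q a y = Fmap q b y' -> y = q b /\ y' = q a.
Proof.
move=> ab ty ty' E; have ba : (b == a) = false by rewrite eq_sym (negbTE ab).
split.
  apply: tri_vertex => //; have := congr1 (bary b) E.
  by rewrite !bary_Fmap eqxx ba /=; have := ty'.2 b; lra.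
apply: tri_vertex => //; have := congr1 (bary a) E.
by rewrite !bary_Fmap eqxx (negbTE ab) /=; have := ty.2 a; lra.
Qed.

Lemma Fmap_vertex a b y : tri y -> Fmap q a y = q b -> a = b /\ y = q b.
Proof.
move=> ty E; have := congr1 (bary b) E; rewrite bary_Fmap bary_q eqxx.
have := bary_le1 b ty; case: (eqVneq b a) E => [->|_] _ /= h1 h2; last by exfalso; lra.
by split=> //; apply: tri_vertex => //; lra.
Qed.

Lemma Fword_tri s y : tri y -> tri (Fword q s y).
Proof. by move=> ty; elim: s => //= a s IH; apply: tri_Fmap. Qed.

Lemma Fword_vertex s b y : tri y -> Fword q s y = q b -> y = q b.
Proof.
move=> ty; elim: s => //= a s IH E.
by apply: IH; have [] := Fmap_vertex (Fword_tri s ty) E.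
Qed.

(** The letter of the second word at the first place where the two differ: the only vertex of the
    first cell that can be common to both. *)
Fixpoint sep (s s' : seq 'I_3) : 'I_3 :=
  match s, s' with
  | a :: s1, b :: s1' => if a == b then sep s1 s1' else b
  | _, _ => 0
  end.

(* Distinct cells of the same level meet in at most one point, a vertex of both. *)
Lemma Fword_meet s s' y y' : size s = size s' -> tri y -> tri y' ->
  Fword q s y = Fword q s' y' ->
  (s = s' /\ y = y') \/ [/\ s <> s', y = q (sep s s') & y' = q (sep s' s)].
Proof.
elim: s s' => [|a s IH] [|b s'] //=; first by move=> _ _ _ ->; left.
move=> [ss] ty ty'.
have [->|ab] := eqVneq a b.
  move=> /Fmap_inj /(IH _ ss ty ty')[[-> ->]|[ne y1 y2]]; first by left.
  by right; split => // -[/ne].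
move=> E; have [E1 E2] := Fmap_sep ab (Fword_tri s ty) (Fword_tri s' ty') E.
right; split.
- by move=> [abE _]; rewrite abE eqxx in ab.
- exact: Fword_vertex E1.
- exact: Fword_vertex E2.
Qed.

Fixpoint wseq m : word m -> seq 'I_3 :=
  match m return word m -> seq 'I_3 with
  | 0 => fun=> [::]
  | m'.+1 => fun cw => rcons (wseq cw.2) cw.1
  end.

Definition wmap m (w : word m) : 'rV[R]_2 -> 'rV[R]_2 := Fword q (wseq w).

Lemma wmapS m c (w : word m) x : @wmap m.+1 (c, w) x = wmap w (Fmap q c x).
Proof. by rewrite /wmap /= /Fword foldr_rcons. Qed.

Lemma size_wseq m (w : word m) : size (wseq w) = m.
Proof. by elim: m w => //= m IH [c w]; rewrite size_rcons IH. Qed.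

Lemma wseq_inj m : injective (@wseq m).
Proof.
elim: m => [[] []//|m IH] [c w] [c' w'] /= /rcons_inj[/IH -> ->] //.
Qed.

Lemma wseq_surj m (s : seq 'I_3) : size s = m -> exists w : word m, wseq w = s.
Proof.
elim: m s => [[]// _|m IH s]; first by exists tt.
case/lastP: s => // s c; rewrite size_rcons => -[/IH[w <-]].
by exists (c, w).
Qed.

Lemma wmap_meet m (w w' : word m) y y' : tri y -> tri y' -> wmap w y = wmap w' y' ->
  (w = w' /\ y = y') \/ [/\ w <> w', y = q (sep (wseq w) (wseq w')) &
     y' = q (sep (wseq w') (wseq w))].
Proof.
move=> ty ty' /Fword_meet[]//; first by rewrite !size_wseq.
  by move=> [/wseq_inj -> ->]; left.
by move=> [ne -> ->]; right; split => // ww; apply: ne; rewrite ww.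
Qed.

Lemma q_inj : injective q.
Proof.
move=> i j ij; apply/eqP/negPn/negP => ne; have := sqdist_side ne.
by rewrite ij sqdist2 !subrr expr0n addr0 => /eqP; rewrite lt_eqF // side_gt0.
Qed.

Definition mid (j : 'I_3) : 'rV[R]_2 := 2%:R^-1 *: (q (j + 1) + q (j - 1)).

Lemma Fmap_mid c i : c != i -> Fmap q c (q i) = mid (- (c + i)).
Proof.
move=> ci; have : (- (c + i) + 1 = i /\ - (c + i) - 1 = c) \/
    (- (c + i) + 1 = c /\ - (c + i) - 1 = i).
  by move: c i ci; apply: I3P; apply: I3P => // _;
    first [left; split; exact: val_inj | right; split; exact: val_inj].
by rewrite /Fmap /mid => -[[-> ->]|[-> ->]] //; rewrite addrC.
Qed.

Lemma Fmap_fix c : Fmap q c (q c) = q c.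
Proof.
by rewrite /Fmap; apply/rowP => k; rewrite !mxE; field.
Qed.

Lemma mid_Fmap j : mid j = Fmap q (j + 1) (q (j - 1)).
Proof. by rewrite /mid /Fmap addrC. Qed.

Lemma bary_mid i j : bary i (mid j) = (i != j)%:R / 2%:R.
Proof.
rewrite mid_Fmap bary_Fmap bary_q; congr (_ / _).
by move: i j; apply: I3P; apply: I3P; rewrite /= ?addr0 ?add0r.
Qed.

Lemma tri_mid j : tri (mid j).
Proof. by rewrite mid_Fmap; apply/tri_Fmap/tri_q. Qed.

Lemma mid_neq_q j b : mid j <> q b.
Proof.
by move=> /(congr1 (bary b)); rewrite bary_mid bary_q eqxx; case: (b != j) => /=; lra.
Qed.

Lemma mid_inj : injective mid.
Proof.
move=> i j /(congr1 (bary i)); rewrite !bary_mid eqxx /=.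
by case: eqVneq => //= _ h; exfalso; move: h; lra.
Qed.

(** The labelling misses no coincidence of points. A corner of a subcell is either a corner of the
    parent, settled by induction, or a midpoint, which is not a vertex of the parent and hence lies
    in no other cell of that level. *)
Lemma wmap_corner b m (w w' : word m) i i' :
  wmap w (q i) = wmap w' (q i') -> corner b w i = corner b w' i'.
Proof.
elim: m w w' i i' => [|m IH].
  by move=> [] [] i i' /q_inj ->.
move=> [c w] [c' w'] i i'; rewrite !wmapS /=.
have [<-|ci] := eqVneq c i; have [<-|ci'] := eqVneq c' i'.
- by rewrite !Fmap_fix => /IH ->.
- rewrite Fmap_fix (Fmap_mid ci') => /(wmap_meet (tri_q _) (tri_mid _)).
  by case=> [[_ /esym/mid_neq_q]|[_ _ /mid_neq_q]].
- rewrite Fmap_fix (Fmap_mid ci) => /(wmap_meet (tri_mid _) (tri_q _)).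
  by case=> [[_ /mid_neq_q]|[_ /mid_neq_q]].
- rewrite (Fmap_mid ci) (Fmap_mid ci') => /(wmap_meet (tri_mid _) (tri_mid _)).
  by case=> [[-> /mid_inj ->]|[_ /mid_neq_q]].
Qed.

Fixpoint pos b m : vertex b m -> 'rV[R]_2 :=
  match m return vertex b m -> 'rV[R]_2 with
  | 0 => (if b as b0 return vertex b0 0 -> 'rV[R]_2 then q
          else fun x : void => match x with end)
  | m'.+1 => fun x => match x with
      | inl y => pos y
      | inr (w, j) => wmap w (mid j)
      end
  end.

Lemma pos_corner b m (w : word m) i (x : vertex b m) :
  corner b w i = Some x -> pos x = wmap w (q i).
Proof.
elim: m w i x => [|m IH]; first by case: b => //= w i x [<-].
move=> [c w] i x /=; rewrite wmapS; case: eqVneq => [<-|ci].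
  by case E: corner => [y|] //= [<-]; rewrite Fmap_fix; apply: IH.
by case=> <-; rewrite Fmap_mid.
Qed.

End Geometry.

(** * Interior and boundary vertices *)

Section InteriorBoundary.
Variable R : realType.

Fixpoint emb m : vertex false m -> vertex true m :=
  match m return vertex false m -> vertex true m with
  | 0 => fun x : void => match x with end
  | m'.+1 => fun x => match x with inl y => inl (emb y) | inr p => inr p end
  end.

Fixpoint bdry m (i : 'I_3) : vertex true m :=
  match m return vertex true m with 0 => i | m'.+1 => inl (bdry m' i) end.

(** The constant word, that is, the only cell of its level at the boundary vertex [i]. *)
Fixpoint cword (i : 'I_3) m : word m :=
  match m return word m with 0 => tt | m'.+1 => (i, cword i m') end.

Lemma corner_true m (w : word m) i :
  corner true w i = Some (oapp (@emb m) (bdry m i) (corner false w i)).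
Proof.
elim: m w i => [//|m IH] [c w] i /=; case: eqVneq => // _.
by rewrite IH /=; case: (corner false w i).
Qed.

Lemma emb_inj m : injective (@emb m).
Proof. by elim: m => [[]|m IH] [x|p] [y|p'] //= [] => [/IH ->|->]. Qed.

Lemma emb_bdry m (x : vertex false m) i : emb x <> bdry m i.
Proof. by elim: m x => [[]|m IH] [x|p] //= []; exact: IH. Qed.

Lemma vertex_true_cases m (x : vertex true m) :
  (exists y, x = emb y) \/ exists i, x = bdry m i.
Proof.
elim: m x => [|m IH] x; first by right; exists x.
case: x => [x|p]; last by left; exists (inr p).
by case: (IH x) => [[y ->]|[i ->]]; [left; exists (inl y)|right; exists i].
Qed.

Lemma incid_emb m (w : word m) i (x : vertex false m) :
  incid R w i (emb x) = incid R w i x.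
Proof.
rewrite /incid corner_true; congr ((_ : bool)%:R); case: corner => [y|] /=.
  by apply/eqP/eqP => [[/emb_inj ->]|[->]].
by apply/eqP => -[/esym]; exact: emb_bdry.
Qed.

Lemma sum_incid_false m (x : vertex false m) : \sum_w \sum_i incid R w i x = 2%:R.
Proof.
elim: m x => [[]|m IH] [x|[w j]].
  rewrite -[RHS](IH x).
  have := sum_incid_inl (fun _ _ => 1 : R) x.
  under eq_bigr do under eq_bigr do rewrite mulr1.
  by under [in RHS]eq_bigr do under eq_bigr do rewrite mulr1.
have := sum_incid_inr false (fun _ _ => 1 : R) w j.
under eq_bigr do under eq_bigr do rewrite mulr1.
by move=> ->; rewrite big_mkcond sumI3; move: j; apply: I3P => /=; lra.
Qed.

Lemma sum_incid_bdry m i (F : word m -> 'I_3 -> R) :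
  \sum_w \sum_j incid R w j (bdry m i) * F w j = F (cword i m) i.
Proof.
elim: m F => [|m IH] F; last by rewrite (sum_incid_inl F) IH.
rewrite (bigD1 tt) //= [X in _ + X]big1 ?addr0; last by case.
rewrite (bigD1 i) //= /incid eqxx mul1r big1 ?addr0 // => j /negbTE ji.
by rewrite (_ : (_ == _) = false) ?mul0r.
Qed.

Lemma residual_bdry m z i (f : word m -> 'I_3 -> R) :
  residual z f (bdry m i) =
  (3%:R - z / 2%:R) * f (cword i m) i - \sum_j f (cword i m) j.
Proof.
by rewrite /residual (sum_incid_bdry i (fun w j => (3%:R - z / 2%:R) * f w j - \sum_j f w j)).
Qed.

Lemma residual_emb m z (f : word m -> 'I_3 -> R) (x : vertex false m) :
  residual z f (emb x) = residual z f x.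
Proof.
by apply: eq_bigr => w _; apply: eq_bigr => i _; rewrite incid_emb.
Qed.

End InteriorBoundary.

(** * The graph Laplacian as a sum over cells *)

Section CellFunctions.
Variables (R : realType) (q : 'I_3 -> 'rV[R]_2).
Hypothesis hq : equilateral q.

Lemma pos_bdry m i : pos q (bdry m i) = q i.
Proof. by elim: m => //= m IH. Qed.

Lemma wmap_cword m i x : wmap q (cword i m) x = iter m (Fmap q i) x.
Proof. by elim: m x => //= m IH x; rewrite wmapS IH -iterSr. Qed.

Lemma wmap_cword_fix m i : wmap q (cword i m) (q i) = q i.
Proof. by rewrite wmap_cword; elim: m => //= m ->; rewrite Fmap_fix. Qed.

Lemma corner_cword m i : corner false (cword i m) i = None.
Proof. by elim: m => //= m IH; rewrite eqxx IH. Qed.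

Lemma pos_false_neq m (x : vertex false m) i : pos q x <> q i.
Proof.
have [w [j wj]] := corner_surj x; rewrite (pos_corner q wj) => E.
have := @wmap_corner _ _ hq false m w (cword i m) j i.
by rewrite E wmap_cword_fix wj corner_cword => /(_ erefl).
Qed.

Lemma VsetP m x : Vset q m x <-> exists (w : word m) i, x = wmap q w (q i).
Proof.
have H : Vset q m x <-> exists2 s, size s = m & exists i, x = Fword q s (q i).
  elim: m x => [|m IH] x /=; split.
  - by move=> [i _ <-]; exists [::] => //; exists i.
  - by move=> [[]// _ [i ->]]; exists i.
  - move=> [a _ [y /IH[s ss [i ->]] <-]]; exists (a :: s); rewrite /= ?ss //.
    by exists i.
  - move=> [[//|a s] [ss] [i ->]]; exists a => //=; exists (Fword q s (q i)) => //.
    by apply/IH; exists s => //; exists i.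
rewrite H; split.
  by move=> [s /wseq_surj[w <-] [i ->]]; exists w, i.
by move=> [w [i ->]]; exists (wseq w); rewrite ?size_wseq //; exists i.
Qed.

Lemma Vset_interiorP m x : (Vset q m `\` Vset q 0) x <->
  exists y : vertex false m, x = pos q y.
Proof.
split.
  move=> [/VsetP[w [i xE]] n0].
  case E : (corner false w i) => [y|]; first by exists y; rewrite xE (pos_corner q E).
  exfalso; apply: n0; exists i => //.
  have := corner_true w i; rewrite E /= => /(pos_corner q).
  by rewrite pos_bdry xE.
move=> [y ->]; have [w [i wi]] := corner_surj y; split.
  by apply/VsetP; exists w, i; rewrite (pos_corner q wi).
by move=> [j _ /esym/pos_false_neq].
Qed.

Definition cellf (u : 'rV[R]_2 -> R) m (w : word m) (i : 'I_3) : R :=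
  u (wmap q w (q i)).

Lemma cellf_subdivide u m :
  cellf u (m := m.+1) = subdivide (cellf u (m := m)) (fun w j => u (wmap q w (mid q j))).
Proof.
apply/funext => -[c w]; apply/funext => i; rewrite /cellf /subdivide wmapS /=.
by case: eqVneq => [<-|ci]; rewrite ?Fmap_fix ?Fmap_mid.
Qed.

Lemma incid_cellf u b m (w : word m) i (x : vertex b m) :
  incid R w i x * cellf u w i = incid R w i x * u (pos q x).
Proof.
rewrite /incid; case: eqP => [/(pos_corner q) ->//|_].
by rewrite !mul0r.
Qed.

Lemma vval_pos (u : 'rV[R]_2 -> R) (b : bool) m : b \/ (forall i, u (q i) = 0) ->
  vval (fun x : vertex b m => u (pos q x)) = cellf u (m := m).
Proof.
move=> bu; apply/funext => w; apply/funext => i; rewrite /vval /cellf.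
case E : (corner b w i) => [x|] /=; first by rewrite (pos_corner q E).
have := corner_true w i; case: b bu E => [_ E|[//|u0] E]; first by rewrite E.
by rewrite E => /(pos_corner q) <-; rewrite pos_bdry u0.
Qed.

(** The Laplacian sums over a set of points, the residual over cells. They agree because distinct
    cells share at most one point, so that a neighbour arises from exactly one triple of a cell, its
    corner at x and another corner. *)
Lemma graph_laplacianE u m (x : vertex false m) :
  graph_laplacian q m u (pos q x) =
  \sum_w \sum_i incid R w i x * (\sum_j cellf u w j - 3%:R * u (pos q x)).
Proof.
pose P := [pred p : (word m * 'I_3) * 'I_3 |
  (corner false p.1.1 p.1.2 == Some x) && (p.2 != p.1.2)].
pose h (p : (word m * 'I_3) * 'I_3) := wmap q p.1.1 (q p.2).
have hP p : P p -> wmap q p.1.1 (q p.1.2) = pos q x.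
  by case/andP => /eqP /(pos_corner q).
have meet w w' i i' : wmap q w (q i) = wmap q w' (q i') ->
    (w = w' /\ i = i') \/ [/\ w <> w', q i = q (sep (wseq w) (wseq w')) &
       q i' = q (sep (wseq w') (wseq w))].
  move=> /(wmap_meet (tri_q hq i) (tri_q hq i'))[[-> /(q_inj hq) ->]|]; first by left.
  by right.
(* If two triples gave the same neighbour from different cells, the cells would share both x and
   this neighbour. *)
have us : uniq [seq h p | p <- enum P].
  rewrite map_inj_in_uniq ?enum_uniq // => -[[w i] j] [[w' i'] j'].
  rewrite !mem_enum => Pp Pp' /meet /= [[ww jj]|[ww q1 q2]].
    subst w' j'; have := hP _ Pp; rewrite -(hP _ Pp') /= => /meet[[_ ->]//|[//]].
  have := hP _ Pp; rewrite -(hP _ Pp') /= => /meet[[//]|[_ q3 q4]].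
  case/andP: Pp => _ /=; have -> : i = j; last by rewrite eqxx.
  by apply: (q_inj hq); rewrite q1 q3.
rewrite /graph_laplacian (_ : [set y | _] = [set` [seq h p | p <- enum P]]); last first.
  apply/seteqP; split => y /=.
    move=> [xy [t [[_ [i _ <-] E1] [_ [j _ <-] E2]]]].
    have [w wt] := wseq_surj (size_tuple t).
    have [w0 [i0 wi0]] := corner_surj x.
    have wi : corner false w i = Some x.
      rewrite -wi0; apply: (wmap_corner hq); rewrite -(pos_corner q wi0) -E1 /wmap wt //.
    apply/mapP; exists ((w, i), j).
      rewrite mem_enum inE /= wi eqxx /=; apply/eqP => ij; apply: xy.
      by rewrite -E1 -E2 ij.
    by rewrite /h /wmap /= wt.
  case/mapP => -[[w i] j]; rewrite mem_enum => Pp ->; split.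
    rewrite -(hP _ Pp) /h /= => /meet[[_ ij]|[]//].
    by case/andP: Pp => _ /=; rewrite ij eqxx.
  exists (Tuple (introT eqP (size_wseq w))) => /=; split.
    by exists (q i); [exists i | have := hP _ Pp].
  by exists (q j); [exists j |].
rewrite -fsbig_seq // big_map big_enum /= big_mkcond /=.
pose F p := if P p then u (h p) - u (pos q x) else 0.
have G w i : incid R w i x * (\sum_j cellf u w j - 3%:R * u (pos q x)) =
    \sum_j F ((w, i), j).
  rewrite /F /h /incid /=; case: eqP => /= wi; last by rewrite mul0r big1.
  have E : cellf u w i = u (pos q x) by rewrite (pos_corner q wi).
  rewrite mul1r !sumI3; move: E; rewrite -/(cellf u w 0) -/(cellf u w 1) -/(cellf u w (-1)).
  by move: i {wi}; apply: I3P => /= ->; ring.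
transitivity (\sum_w \sum_i \sum_j F ((w, i), j)); last first.
  by apply: eq_bigr => w _; apply: eq_bigr => i _; rewrite G.
rewrite (pair_bigA _ (fun w i => \sum_j F ((w, i), j))) /=.
rewrite (pair_bigA _ (fun p j => F ((p.1, p.2), j))) /=.
by apply: eq_bigr => -[[w i] j] _.
Qed.

Lemma residual_laplacian u m z (x : vertex false m) :
  residual z (cellf u (m := m)) x =
  - (graph_laplacian q m u (pos q x) + z * u (pos q x)).
Proof.
rewrite graph_laplacianE.
have -> : z * u (pos q x) = \sum_w \sum_i incid R w i x * (z / 2%:R * u (pos q x)).
  transitivity ((\sum_w \sum_i incid R w i x) * (z / 2%:R * u (pos q x))).
    by rewrite sum_incid_false; field.
  by rewrite mulr_suml; apply: eq_bigr => w _; rewrite mulr_suml.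
rewrite -big_split -sumrN; apply: eq_bigr => w _ /=.
rewrite -big_split -[RHS]sumrN; apply: eq_bigr => i _ /=.
rewrite mulrBr mulrCA incid_cellf; move: (\sum_j _) => S; ring.
Qed.

End CellFunctions.

Lemma cvgn_geometric (R : realType) (V : normedModType R) (v : nat -> V) x (C r : R) :
  0 <= r -> r < 1 -> (forall k, `|x - v k| <= C * r ^+ k) -> v @ \oo --> x.
Proof.
move=> r0 r1 H; apply/cvgrPdist_lt => e e0.
have L : (fun k => C * r ^+ k) @ \oo --> (0 : R).
  rewrite -[X in _ --> X](mulr0 C); apply: cvgMl_tmp; apply: cvg_expr.
  by rewrite ger0_norm.
near=> k; apply: le_lt_trans (H k) _.
have : `|0 - C * r ^+ k| < e by near: k; apply: cvgr_dist_lt.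
by rewrite sub0r normrN; apply: le_lt_trans; exact: ler_norm.
Unshelve. all: by end_near. Qed.

(** * Cells, density of vertices and continuity on the gasket *)

Section Gasket.
Variables (R : realType) (q : 'I_3 -> 'rV[R]_2) (SG : set 'rV[R]_2).
Hypotheses (hq : equilateral q) (hSG : is_gasket q SG).

Lemma gasket_Fmap i x : SG x -> SG (Fmap q i x).
Proof. by move=> Sx; case: hSG => _ _ ->; exists i => //; exists x. Qed.

Lemma gasket_inv x : SG x -> exists i y, SG y /\ x = Fmap q i y.
Proof.
case: hSG => _ _ E Sx; have : (\bigcup_(i in [set: 'I_3]) Fmap q i @` SG) x by rewrite -E.
by case=> i _ [y Sy <-]; exists i, y.
Qed.

Lemma gasket_wmap m (w : word m) x : SG x -> SG (wmap q w x).
Proof.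
by elim: m w x => [//|m IH] [c w] x Sx; rewrite wmapS; apply/IH/gasket_Fmap.
Qed.

Lemma gasket_cell m x : SG x -> exists (w : word m) y, SG y /\ x = wmap q w y.
Proof.
elim: m x => [|m IH] x Sx; first by exists tt, x.
have [w [y [Sy ->]]] := IH x Sx; have [c [z [Sz ->]]] := gasket_inv Sy.
by exists (c, w), z; rewrite wmapS.
Qed.

Lemma gasket_norm_bounded : exists2 M : R, 0 < M & forall x, SG x -> `|x| <= M.
Proof.
case: hSG => /compact_bounded/ex_strict_bound_gt0[M M0 HM] _ _; exists M => // x Sx.
exact: ltW (HM x Sx).
Qed.

Lemma gasket_bounded : exists2 M : R, 0 < M & forall x, SG x -> forall k, `|x 0 k| <= M.
Proof.
have [M M0 HM] := gasket_norm_bounded; exists M => // x Sx k.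
apply: le_trans (HM x Sx); rewrite /Num.norm /= mx_normrE.
exact: (@le_bigmax _ _ _ 0 (fun ij : 'I_1 * 'I_2 => `|x ij.1 ij.2|) (0, k)).
Qed.

Definition affine_fun (f : 'rV[R]_2 -> R) : Prop :=
  exists a b c, forall x, f x = a + b * x 0 0 + c * x 0 1.

Lemma affine_fun_lin a b f g : affine_fun f -> affine_fun g ->
  affine_fun (fun x => a * f x + b * g x).
Proof.
move=> [a1 [b1 [c1 Hf]]] [a2 [b2 [c2 Hg]]].
exists (a * a1 + b * a2), (a * b1 + b * b2), (a * c1 + b * c2) => x.
by rewrite Hf Hg; ring.
Qed.

Lemma affine_bary i : affine_fun (bary hq i).
Proof.
have s0 : side hq != 0 by rewrite gt_eqF // side_gt0.
pose B k := (- 2%:R * \sum_j q j 0 k + 6%:R * q i 0 k) / (3%:R * side hq).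
exists (bary hq i 0), (B 0), (B 1) => x.
by rewrite /bary /B !sumI3 !sqdist2 !mxE; field.
Qed.

(** A negative value at F_j z at least doubles in size at z; repeated preimages stay in the gasket,
    where f is bounded. *)
Lemma affine_gasket_ge0 f : affine_fun f ->
  (forall j y, SG y -> f y / 2%:R <= f (Fmap q j y)) -> forall x, SG x -> 0 <= f x.
Proof.
move=> [a [b [c Hf]]] H x Sx; have [M M0 HM] := gasket_bounded.
pose B := `|a| + `|b| * M + `|c| * M.
have HB y : SG y -> - B <= f y.
  move=> Sy; rewrite lerNl (le_trans (ler_norm _)) // normrN Hf /B.
  apply: le_trans (ler_normD _ _) _; apply: lerD.
    apply: le_trans (ler_normD _ _) _; rewrite lerD2l normrM.
    by apply: ler_wpM2l => //; apply: HM.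
  by rewrite normrM; apply: ler_wpM2l => //; apply: HM.
have Hk k y : SG y -> - B <= f y * 2%:R ^+ k.
  elim: k y => [|k IH] y Sy; first by rewrite expr0 mulr1; apply: HB.
  have [j [z [Sz ->]]] := gasket_inv Sy; apply: le_trans (IH z Sz) _.
  have := H j z Sz; rewrite exprS; have : 0 < 2%:R ^+ k :> R by apply: exprn_gt0.
  by move: (2%:R ^+ k) => t t0 h; rewrite mulrA ler_pM2r //; lra.
rewrite leNgt; apply/negP => fx.
have B0 : 0 <= B by rewrite !addr_ge0 ?mulr_ge0 // ltW.
pose n := (Num.truncn (B / - f x)).+1.
have : B / - f x < n%:R by rewrite truncnS_gt.
have n2 : n%:R <= 2%:R ^+ n :> R by rewrite -natrX ler_nat ltnW // ltn_expl.
rewrite ltr_pdivrMr ?oppr_gt0 // => h.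
have := Hk n x Sx; have fx' : 0 < - f x by rewrite oppr_gt0.
have : n%:R * - f x <= 2%:R ^+ n * - f x by rewrite ler_pM2r.
by lra.
Qed.

(** The barycentric coordinates, and the components of [comb hq x - x] with either sign, are affine
    functions that at least halve along each map, so [affine_gasket_ge0] applies to all of them. *)
Lemma gasket_tri x : SG x -> tri hq x.
Proof.
move=> Sx; split; last first.
  move=> i; apply: (affine_gasket_ge0 (affine_bary i)) => // j y _.
  have : 0 <= (i == j)%:R :> R by rewrite ler0n.
  by rewrite bary_Fmap; lra.
have A k : affine_fun (fun y => comb hq y 0 k - y 0 k).
  have A1 : affine_fun (fun y : 'rV[R]_2 => y 0 k).
    case: k => -[|[|//]] Hk.
      by exists 0, 1, 0 => y; rewrite add0r mul1r mul0r addr0; congr (y _ _); apply: val_inj.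
    by exists 0, 0, 1 => y; rewrite add0r mul1r mul0r add0r; congr (y _ _); apply: val_inj.
  have A2 := affine_fun_lin (q 0 0 k) (q 1 0 k) (affine_bary 0) (affine_bary 1).
  have A3 := affine_fun_lin (q (-1) 0 k) (-1) (affine_bary (-1)) A1.
  have [a [b [c H]]] := affine_fun_lin 1 1 A2 A3; exists a, b, c => y.
  by rewrite -H /comb sumI3 !mxE; ring.
have E j y k : comb hq (Fmap q j y) 0 k - Fmap q j y 0 k = (comb hq y 0 k - y 0 k) / 2%:R.
  by rewrite comb_Fmap /Fmap !mxE; field.
apply/rowP => k; apply/eqP; rewrite -subr_eq0 eq_le; apply/andP; split.
  rewrite -oppr_ge0; have [a [b [c H]]] := A k.
  apply: (@affine_gasket_ge0 (fun y => - (comb hq y 0 k - y 0 k))) => // [|j y _].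
    by exists (- a), (- b), (- c) => y; rewrite H; ring.
  by rewrite E; lra.
apply: (@affine_gasket_ge0 (fun y => comb hq y 0 k - y 0 k)) => // j y _.
by rewrite E.
Qed.

Lemma gasket_closed : closed SG.
Proof. by apply: compact_closed; [exact: norm_hausdorff | case: hSG]. Qed.

Lemma iter_Fmap i k x : iter k (Fmap q i) x = q i + 2%:R^-1 ^+ k *: (x - q i).
Proof.
elim: k => [|k IH]; first by rewrite expr0 scale1r addrC subrK.
by rewrite iterS IH /Fmap exprS; apply/rowP => l; rewrite !mxE; field.
Qed.

Lemma gasket_q i : SG (q i).
Proof.
have [_ [x0 Sx0] _] := hSG.
have H : (fun k => iter k (Fmap q i) x0) @ \oo --> q i.
  rewrite (_ : (fun k => _) = fun k => q i + 2%:R^-1 ^+ k *: (x0 - q i)); last first.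
    by apply/funext => k; rewrite iter_Fmap.
  rewrite -[X in _ --> X]addr0 -(scale0r (x0 - q i)).
  apply: cvgD; first exact: cvg_cst.
  by apply: cvgZr_tmp; apply: cvg_expr; rewrite ger0_norm; lra.
apply: (closed_cvg _ gasket_closed _ _ H); apply: nearW => k.
by elim: k => //= k IH; apply: gasket_Fmap.
Qed.

Lemma gasket_vertex m (w : word m) i : SG (wmap q w (q i)).
Proof. by apply/gasket_wmap/gasket_q. Qed.

Lemma Fmap_continuous i : continuous (Fmap q i).
Proof.
move=> x.
have C : (fun y => y + q i) @ x --> x + q i.
  exact: (cvgD cvg_id (cvg_cst (q i))).
exact: (cvgZ (cvg_cst (2%:R^-1 : R)) C).
Qed.

Lemma wmap_continuous m (w : word m) : continuous (wmap q w).
Proof.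
elim: m w => [|m IH] w; first by move=> x; exact: cvg_id.
case: w => c w; rewrite (_ : wmap q _ = wmap q w \o Fmap q c).
  by move=> x; apply: continuous_comp; [exact: Fmap_continuous|exact: IH].
by apply/funext => x; rewrite /= wmapS.
Qed.

Lemma gasket_cell_closed m (w : word m) : closed (wmap q w @` SG).
Proof.
apply: compact_closed; first exact: norm_hausdorff.
apply: continuous_compact; last by case: hSG.
exact: continuous_subspaceT (@wmap_continuous m w).
Qed.

(* Finitely many closed cells: those avoiding x stay away from x. *)
Lemma near_gasket_cell m x : \forall y \near x, SG y ->
  exists (w : word m) a b, [/\ SG a, SG b, x = wmap q w a & y = wmap q w b].
Proof.
have H (w : word m) : \forall y \near x, (wmap q w @` SG) y -> (wmap q w @` SG) x.
  have [Sx|nSx] := pselect ((wmap q w @` SG) x); first by apply: (@nearW _ (nbhs x)) => y _.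
  have : open (~` (wmap q w @` SG)) by apply: closed_openC; exact: gasket_cell_closed.
  rewrite openE => /(_ x nSx); apply: filterS => y nSy Sy.
  by case: nSy.
have HA : \forall y \near x, forall w : word m, (wmap q w @` SG) y -> (wmap q w @` SG) x.
  exact: (@filter_forall _ _ (fun (w : word m) y =>
    (wmap q w @` SG) y -> (wmap q w @` SG) x) (nbhs x) _ H).
apply: filterS HA => y Hy Sy; have [w [b [Sb yE]]] := gasket_cell m Sy.
have [a Sa aE] := Hy w (ex_intro2 _ _ b Sb (esym yE)).
by exists w, a, b.
Qed.

Lemma wmap_diff m (w : word m) a b :
  wmap q w a - wmap q w b = 2%:R^-1 ^+ m *: (a - b).
Proof.
elim: m w a b => [|m IH] w a b; first by rewrite expr0 scale1r.
case: w => c w; rewrite !wmapS IH exprSr -scalerA; congr (_ *: _).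
by rewrite /Fmap; apply/rowP => k; rewrite !mxE; field.
Qed.

Lemma gasket_vertex_cvg m0 x : SG x -> exists v : nat -> 'rV[R]_2,
  [/\ v @ \oo --> x, forall k, SG (v k) &
    forall k, exists (w : word (k + m0)) i, v k = wmap q w (q i)].
Proof.
move=> Sx; have [M M0 HM] := gasket_norm_bounded.
have /choice[v Hv] : forall k, exists v, [/\ `|x - v| <= (2%:R * M) * 2%:R^-1 ^+ k,
    SG v & exists (w : word (k + m0)) i, v = wmap q w (q i)].
  move=> k; have [w [y [Sy ->]]] := gasket_cell (k + m0) Sx.
  exists (wmap q w (q 0)); split; last by exists w, 0.
    have p n : 0 <= 2%:R^-1 ^+ n :> R by apply: exprn_ge0; rewrite invr_ge0.
    rewrite wmap_diff normrZ (ger0_norm (p _)) mulrC.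
    have h : `|y - q 0| <= 2%:R * M.
      apply: le_trans (ler_normB _ _) _; rewrite mulr_natl mulr2n.
      by apply: lerD; apply: HM => //; exact: gasket_q.
    have h2 : 2%:R^-1 ^+ (k + m0) <= 2%:R^-1 ^+ k :> R.
      rewrite exprD -[leRHS]mulr1; apply: ler_wpM2l => //.
      by apply: exprn_ile1; lra.
    exact: ler_pM.
  exact: gasket_vertex.
exists v; split; [|by move=> k; case: (Hv k)..].
by apply: (@cvgn_geometric _ _ _ _ (2%:R * M) 2%:R^-1) => [||k]; [lra|lra|case: (Hv k)].
Qed.

Lemma gasket_continuous_cvg (u : 'rV[R]_2 -> R) (v : nat -> 'rV[R]_2) x :
  {within SG, continuous u} -> SG x -> v @ \oo --> x -> (forall k, SG (v k)) ->
  u \o v @ \oo --> u x.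
Proof.
move=> /subspace_continuousP uc Sx vx Sv.
apply: (cvg_comp v u _ (uc x Sx)) => A WA.
have : \forall k \near \oo, SG (v k) -> A (v k) := vx _ WA.
by apply: filterS => k; apply; exact: Sv.
Qed.

Lemma gasket_continuous_eq0 (u : 'rV[R]_2 -> R) m0 : {within SG, continuous u} ->
  (forall m (w : word (m + m0)) i, u (wmap q w (q i)) = 0) ->
  forall x, SG x -> u x = 0.
Proof.
move=> uc u0 x Sx; have [v [vx Sv Hv]] := gasket_vertex_cvg m0 Sx.
have C := gasket_continuous_cvg uc Sx vx Sv.
rewrite -(cvg_lim _ C) // (_ : u \o v = fun=> 0) ?lim_cst //.
by apply/funext => k /=; have [w [i ->]] := Hv k.
Qed.

Lemma gasket_continuous_bounded (u : 'rV[R]_2 -> R) : {within SG, continuous u} ->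
  exists2 M : R, 0 < M & forall x, SG x -> `|u x| <= M.
Proof.
move=> uc; have [cS _ _] := hSG.
have /compact_bounded/ex_strict_bound_gt0[M M0 HM] := continuous_compact uc cS.
by exists M => // x Sx; apply: ltW; apply: HM; exists x.
Qed.

End Gasket.

(** * Eigenfunctions on the gasket have zero discrete residual *)

(** After collecting terms m0 has coefficient -2 and m1, m2 have z - 4, whence 2 + 2(4 - z). *)
Lemma midres_combination_bound (R : realDomainType) (z r m0 m1 m2 : R) : z < 2%:R ->
  `|m0| <= r -> `|m1| <= r -> `|m2| <= r ->
  `|(2%:R - z) * m0 + (z - 4%:R) * (m0 + m1 + m2)| <= (10%:R - 2%:R * z) * r.
Proof.
move=> z2; rewrite !ler_norml => /andP[h1 h2] /andP[h3 h4] /andP[h5 h6].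
have z4 : 0 <= 4%:R - z by lra.
have H (t : R) : - r <= t -> t <= r -> - ((4%:R - z) * r) <= (4%:R - z) * t <= (4%:R - z) * r.
  by move=> t1 t2; rewrite -mulrN !ler_wpM2l.
have /andP[? ?] := H _ h3 h4; have /andP[? ?] := H _ h5 h6.
by apply/andP; split; lra.
Qed.

(** The vertex contributes (2 - z)(5 - z) and its two cells 2(10 - 2z), in total (5 - z)(6 - z);
    division by 6 - z leaves exactly 5 - z. Nothing larger at z = 0 would do. *)
Lemma residual_bound (R : realType) m (z r : R) (a p : word m -> 'I_3 -> R) : z < 2%:R ->
  (forall x : vertex false m.+1, `|residual z (subdivide a p) x| <= r) ->
  forall x : vertex false m, `|residual (z * (5%:R - z)) a x| <= (5%:R - z) * r.
Proof.
move=> z2 H x.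
have M w j : `|midres z (a w) (p w) j| <= r.
  by rewrite -(residual_inr false); apply: H.
have D := residual_decimation z a p x.
have z6 : 0 < 6%:R - z by lra.
have -> : residual (z * (5%:R - z)) a x = ((2%:R - z) * (5%:R - z) *
    residual z (subdivide a p) (inl x : vertex false m.+1) -
    \sum_w \sum_c incid R w c x * ((2%:R - z) * midres z (a w) (p w) c +
     (z - 4%:R) * \sum_j midres z (a w) (p w) j)) / (6%:R - z).
  by rewrite D addrK mulrAC mulfV ?mul1r // gt_eqF.
have B : `|\sum_w \sum_c incid R w c x * ((2%:R - z) * midres z (a w) (p w) c +
     (z - 4%:R) * \sum_j midres z (a w) (p w) j)| <= 2%:R * ((10%:R - 2%:R * z) * r).
  apply: (@le_trans _ _ ((\sum_w \sum_c incid R w c x) * ((10%:R - 2%:R * z) * r))); last first.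
    by rewrite sum_incid_false.
  rewrite mulr_suml; apply: le_trans (ler_norm_sum _ _ _) _; apply: ler_sum => w _.
  rewrite mulr_suml; apply: le_trans (ler_norm_sum _ _ _) _; apply: ler_sum => c _.
  rewrite normrM ger0_norm ?ler0n //; apply: ler_wpM2l; first exact: ler0n.
  have Q c1 c2 c3 := midres_combination_bound z2 (M w c1) (M w c2) (M w c3).
  rewrite sumI3; move: c; apply: I3P.
  - exact: (Q 0 1 (-1)).
  - have := Q 1 0 (-1); congr (`|_ + _ * _| <= _); ring.
  - have := Q (-1) 0 1; congr (`|_ + _ * _| <= _); ring.
rewrite normrM normfV (gtr0_norm z6) ler_pdivrMr //.
apply: le_trans (ler_normB _ _) _.
have H1 := H (inl x).
have z25 : 0 < (2%:R - z) * (5%:R - z) by apply: mulr_gt0; lra.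
rewrite normrM (gtr0_norm z25).
have : (2%:R - z) * (5%:R - z) * `|residual z (subdivide a p) (inl x : vertex false m.+1)| <=
   (2%:R - z) * (5%:R - z) * r by rewrite ler_pM2l.
by lra.
Qed.

Section Eigenfunction.
Variables (R : realType) (q : 'I_3 -> 'rV[R]_2) (SG : set 'rV[R]_2).
Hypotheses (hq : equilateral q) (hSG : is_gasket q SG).
Variables (u : 'rV[R]_2 -> R) (m : nat) (y : R).
Hypothesis y1 : `|y| <= 1.
Hypothesis eu : eigen_equation q SG (5%:R ^+ m * psi y) u.

Let z k := iter k (@phi_lo R) y.

Let zS k : z k = z k.+1 * (5%:R - z k.+1).
Proof. exact: iter_phi_loS. Qed.

Let zsmall k : `|z k.+1| <= 4%:R^-1 ^+ k / 4%:R.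
Proof. by rewrite mulrC -exprS; apply: iter_phi_lo_small. Qed.

Let q01 k : 0 < (4%:R^-1 ^+ k : R) <= 1.
Proof. by rewrite exprn_gt0 ?invr_gt0 //=; apply: exprn_ile1; lra. Qed.

(** The factors 5 - z multiply to at most 2 5^k because the iterates decay like 4^-k; the term 4^-k
    strengthens the bound for the induction. *)
Lemma residual_chain k (r : R) :
  (forall x : vertex false (k + m), `|residual (z k) (cellf q u (m := k + m)) x| <= r) ->
  forall x : vertex false m,
    `|residual y (cellf q u (m := m)) x| <= 5%:R ^+ k * (2%:R - 4%:R^-1 ^+ k) * r.
Proof.
elim: k r => [|k IH] r H x; first by have := H x; rewrite !expr0; lra.
have /andP[q0 q1] := q01 k; have zk := zsmall k; rewrite ler_norml in zk.
have H' : forall x : vertex false (k + m),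
    `|residual (z k) (cellf q u (m := k + m)) x| <= (5%:R - z k.+1) * r.
  rewrite zS; apply: (@residual_bound _ _ _ _ _ (fun w j => u (wmap q w (mid q j)))); first by lra.
  by move=> x'; rewrite -cellf_subdivide //; apply: H.
have r0 : 0 <= r.
  exact: le_trans (normr_ge0 _) (H (inr (cword 0 (k + m), 0))).
apply: le_trans (IH _ H' x) _; rewrite !exprS.
have f0 : 0 < 5%:R ^+ k :> R by apply: exprn_gt0.
move: zk f0 q0 q1; move: (z k.+1) (4%:R^-1 ^+ k) (5%:R ^+ k) => t c f tc f0 c0 c1.
rewrite -!mulrA [5%:R * (f * _)]mulrCA ler_pM2l // !mulrA; apply: ler_wpM2r => //.
by nra.
Qed.

Lemma psi_seq_cvg : (fun k => 3%:R / 2%:R * 5%:R ^+ k * z k) @ \oo --> psi y.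
Proof. exact: psi_cvg. Qed.

Lemma eigen_residual (x : vertex false m) : residual y (cellf q u (m := m)) x = 0.
Proof.
have [uc _ lap] := eu; have [B B0 HB] := gasket_continuous_bounded hSG uc.
suff H0 (e : R) : 0 < e -> `|residual y (cellf q u (m := m)) x| <= e.
  by apply/eqP; rewrite -normr_le0; apply/ler_addgt0Pl => e e0; rewrite addr0 H0.
move=> e0; pose d : R := e / (2%:R * (1 + B)).
have d0 : 0 < d by rewrite divr_gt0 // mulr_gt0 //; lra.
have d5 : 0 < d / 5%:R ^+ m by rewrite divr_gt0 // exprn_gt0.
have [K1 _ HK1] := lap d d0.
have /cvgrPdist_lt/(_ _ d5)[K2 _ HK2] := psi_seq_cvg.
pose k := maxn K1 K2.
have f0 : 0 < 5%:R ^+ (k + m) :> R by apply: exprn_gt0.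
(* Two errors: [d] from the definition of the Laplacian, and at most [B * d] from replacing [psi y]
   by the k-th term of its sequence. *)
have H (x' : vertex false (k + m)) : `|residual (z k) (cellf q u (m := k + m)) x'| <=
    (1 + B) * d / (3%:R / 2%:R * 5%:R ^+ (k + m)).
  have t0 : 0 < 3%:R / 2%:R * 5%:R ^+ (k + m) :> R by apply: mulr_gt0 => //; lra.
  rewrite ler_pdivlMr // -[X in _ * X](gtr0_norm t0) -normrM (residual_laplacian hq).
  have L := HK1 (k + m)%N _ (pos q x') _.
  have Vx : (Vset q (k + m) `\` Vset q 0) (pos q x') by apply/Vset_interiorP => //; exists x'.
  have /L/(_ Vx) {L} L : (K1 <= k + m)%N by rewrite (leq_trans (leq_maxl K1 K2)) ?leq_addr.
  have := HK2 k (leq_maxr _ _) => /= L2.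
  have Sx : SG (pos q x').
    have [w [i wi]] := corner_surj x'; rewrite (pos_corner q wi); exact: gasket_vertex.
  have := HB _ Sx => uB.
  set g := graph_laplacian _ _ _ _ in L *; move: (u (pos q x')) uB L => v vB L.
  have -> : - (g + z k * v) * (3%:R / 2%:R * 5%:R ^+ (k + m)) =
     - (3%:R / 2%:R * 5%:R ^+ (k + m) * g - - (5%:R ^+ m * psi y * v)) +
     5%:R ^+ m * (psi y - 3%:R / 2%:R * 5%:R ^+ k * z k) * v.
    by rewrite exprD; field.
  apply: le_trans (ler_normD _ _) _; rewrite normrN [(1 + B) * d]mulrDl [1 * d]mul1r.
  apply: lerD; first exact: ltW.
  rewrite normrM [B * d]mulrC; apply: ler_pM => //.
  rewrite normrM ger0_norm ?exprn_ge0 // [_ * `|_|]mulrC -ler_pdivlMr ?exprn_gt0 //.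
  exact: ltW.
apply: le_trans (residual_chain H x) _; rewrite exprD.
have /andP[q0 q1] := q01 k.
have fk : 0 < 5%:R ^+ k :> R by apply: exprn_gt0.
have fm : 1 <= 5%:R ^+ m :> R by rewrite exprn_ege1 // ler1n.
have -> : 5%:R ^+ k * (2%:R - 4%:R^-1 ^+ k) *
    ((1 + B) * d / (3%:R / 2%:R * (5%:R ^+ k * 5%:R ^+ m))) =
    (2%:R - 4%:R^-1 ^+ k) / 3%:R * e * (5%:R ^+ m)^-1.
  rewrite /d; field; rewrite !gt_eqF //=; lra.
apply: (@le_trans _ _ (1 * e * 1)); last by rewrite mul1r mulr1.
have fm0 : 0 < 5%:R ^+ m :> R by apply: exprn_gt0.
have A1 : (2%:R - 4%:R^-1 ^+ k) / 3%:R * e <= 1 * e by apply: ler_wpM2r; [exact: ltW|lra].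
have A2 : 0 <= (2%:R - 4%:R^-1 ^+ k) / 3%:R * e by apply: mulr_ge0; [lra|exact: ltW].
by apply: ler_pM => //; rewrite ?invr_ge0 ?invf_le1 // ltW.
Qed.

End Eigenfunction.

(** Lets the same eigenvalue be written at every finer level, with y replaced by its iterate. *)
Lemma psi_iter (R : realType) (y : R) k : `|y| <= 1 ->
  5%:R ^+ k * psi (iter k (@phi_lo R) y) = psi y.
Proof.
move=> y1; elim: k => [|k IH]; first by rewrite mul1r.
have h : `|iter k (@phi_lo R) y| <= 1.
  by apply: le_trans (iter_phi_lo_small k y1) _; apply: exprn_ile1; lra.
by rewrite -IH iterS exprSr -mulrA psi_phi_lo.
Qed.

Lemma sumI3_rot (V : nmodType) (F : 'I_3 -> V) i :
  \sum_j F j = F i + F (i + 1) + F (i - 1).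
Proof.
rewrite sumI3; move: i; apply: I3P; rewrite ?add0r ?addr0 ?subrr ?addNr //.
  rewrite (_ : 1 + 1 = -1 :> 'I_3); last exact: val_inj.
  by rewrite -addrA addrC.
rewrite (_ : -1 - 1 = 1 :> 'I_3); last exact: val_inj.
by rewrite addrC addrA.
Qed.

(** * Normal derivatives as limits of boundary residuals *)

Section NormalDerivative.
Variables (R : realType) (q : 'I_3 -> 'rV[R]_2) (SG : set 'rV[R]_2).
Hypotheses (hq : equilateral q) (hSG : is_gasket q SG).
Variables (u : 'rV[R]_2 -> R) (m : nat) (y : R).
Hypothesis y1 : `|y| <= 1.
Hypothesis eu : eigen_equation q SG (5%:R ^+ m * psi y) u.

Let z k := iter k (@phi_lo R) y.

Lemma eigen_residual_iter k (x : vertex false (k + m)) :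
  residual (z k) (cellf q u (m := k + m)) x = 0.
Proof.
apply: (eigen_residual hq hSG).
  by apply: le_trans (iter_phi_lo_small k y1) _; apply: exprn_ile1; lra.
by rewrite addnC exprD -mulrA psi_iter.
Qed.

Let zS k : z k = z k.+1 * (5%:R - z k.+1).
Proof. exact: iter_phi_loS. Qed.

Let zsmall k : `|z k.+1| <= 4%:R^-1 ^+ k / 4%:R.
Proof. by rewrite mulrC -exprS; apply: iter_phi_lo_small. Qed.

Let q01 k : 0 < (4%:R^-1 ^+ k : R) <= 1.
Proof. by rewrite exprn_gt0 ?invr_gt0 //=; apply: exprn_ile1; lra. Qed.

Let rho k i := residual (z k) (cellf q u (m := k + m)) (bdry (k + m) i).

(** From one level to the next the boundary residual is multiplied by (6 - z)/((2 - z)(5 - z)). At z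
    = 0 this is 3/5, which the renormalization 5/3 cancels, so that g(0) = 1 and the products [P]
    stay bounded. *)
Let g (t : R) := 5%:R / 3%:R * (6%:R - t) / ((2%:R - t) * (5%:R - t)).

Let P k := \prod_(j < k) g (z j.+1).

Lemma rho_step k i : 5%:R / 3%:R * rho k.+1 i = g (z k.+1) * rho k i.
Proof.
have := @residual_decimation R true (k + m) (z k.+1) (cellf q u (m := k + m))
  (fun w j => u (wmap q w (mid q j))) (bdry (k + m) i).
rewrite -zS [X in _ = _ + X]big1 ?addr0 => [|w _]; last first.
  have M j : midres (z k.+1) (cellf q u w) (fun j => u (wmap q w (mid q j))) j = 0.
    have := @eigen_residual_iter k.+1 (inr (w, j)).
    rewrite [cellf q u (m := _)](cellf_subdivide q u) -[(k.+1 + m)%N]/(k + m).+1.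
    by rewrite (residual_inr false).
  by rewrite big1 // => c _; rewrite M big1 ?mulr0 ?addr0 ?mulr0.
rewrite -cellf_subdivide // => D.
have /andP[q0 q1] := q01 k; have := zsmall k; rewrite ler_norml => zk.
have t0 : (2%:R - z k.+1) * (5%:R - z k.+1) != 0 by rewrite mulf_neq0 ?subr_eq0 //; apply/eqP; lra.
apply: (mulfI t0); rewrite mulrCA /rho D /g.
by field; apply/andP; split; apply/eqP; lra.
Qed.

Lemma rhoE k i : (5%:R / 3%:R) ^+ k * rho k i = P k * rho 0 i.
Proof.
elim: k => [|k IH]; first by rewrite /P big_ord0 expr0.
rewrite exprSr -mulrA rho_step mulrCA IH /P big_ord_recr /= mulrCA mulrA.
by rewrite mulrC mulrA.
Qed.

Lemma P_bounds k : (1 + 4%:R^-1 ^+ k) / 2%:R <= P k <= 2%:R - 4%:R^-1 ^+ k.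
Proof.
rewrite /P; elim: k => [|k]; first by rewrite big_ord0 expr0; lra.
rewrite big_ord_recr /= -[phi_lo (z k)]/(z k.+1) !exprS; have /andP[q0 q1] := q01 k.
have := zsmall k; rewrite ler_norml; move: q0 q1.
move: (4%:R^-1 ^+ k) (z k.+1) (\prod_(i < k) _) => c t p c0 c1 tc /andP[p1 p2].
have d0 : 0 < (2%:R - t) * (5%:R - t) by apply: mulr_gt0; lra.
have gb : 1 - 3%:R / 8%:R * c <= g t <= 1 + 3%:R / 8%:R * c.
  rewrite /g ler_pdivlMr // ler_pdivrMr //; apply/andP; split; nra.
move: gb; move: (g t) => h /andP[h1 h2].
apply/andP; split.
  apply: (@le_trans _ _ ((1 + c) / 2%:R * (1 - 3%:R / 8%:R * c))); first by nra.
  by apply: ler_pM => //; lra.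
apply: (@le_trans _ _ ((2%:R - c) * (1 + 3%:R / 8%:R * c))); last by nra.
by apply: ler_pM => //; lra.
Qed.

(** The difference quotient and the boundary residual differ by z/2 times the boundary value; this
    term disappears in the limit because 5/3 is less than 4. *)
Lemma normal_seqE k i : (5%:R / 3%:R) ^+ (k + m) *
     (2%:R * u (q i) - u (iter (k + m) (Fmap q i) (q (i + 1)))
        - u (iter (k + m) (Fmap q i) (q (i - 1)))) =
  (5%:R / 3%:R) ^+ m * (P k * rho 0 i) +
  (5%:R / 3%:R) ^+ m * (u (q i) / 2%:R) * ((5%:R / 3%:R) ^+ k * z k).
Proof.
rewrite -rhoE /rho residual_bdry (sumI3_rot _ i) /cellf !wmap_cword.
have -> : iter (k + m) (Fmap q i) (q i) = q i by rewrite -wmap_cword wmap_cword_fix.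
by rewrite exprD; field.
Qed.

Lemma z_vanish : (fun k => (5%:R / 3%:R) ^+ k * z k) @ \oo --> (0 : R).
Proof.
apply: (@cvgn_geometric _ _ _ _ 1 (5%:R / 12%:R)) => [||k]; [lra|lra|].
have p0 : 0 <= (5%:R / 3%:R) ^+ k :> R by apply: exprn_ge0; lra.
rewrite sub0r normrN normrM (ger0_norm p0) [1 * _]mul1r.
have -> : 5%:R / 12%:R = 5%:R / 3%:R * 4%:R^-1 :> R by field.
by rewrite [(_ * 4%:R^-1) ^+ k]exprMn ler_wpM2l // iter_phi_lo_small.
Qed.

Lemma normal_derivative_cvg i (d : R) : (fun k => P k * rho 0 i) @ \oo --> d ->
  has_normal_derivative q u i ((5%:R / 3%:R) ^+ m * d).
Proof.
move=> Pd; rewrite /has_normal_derivative -(cvg_shiftn m).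
rewrite (_ : [sequence _]_n = (fun k => (5%:R / 3%:R) ^+ m * (P k * rho 0 i) +
  (5%:R / 3%:R) ^+ m * (u (q i) / 2%:R) * ((5%:R / 3%:R) ^+ k * z k))); last first.
  by apply/funext => k; rewrite -normal_seqE.
have -> : (5%:R / 3%:R) ^+ m * d = (5%:R / 3%:R) ^+ m * d +
    (5%:R / 3%:R) ^+ m * (u (q i) / 2%:R) * 0 by rewrite mulr0 addr0.
by apply: cvgD; apply: cvgMl_tmp => //; exact: z_vanish.
Qed.

Lemma residual_bdry_eq0 i : has_normal_derivative q u i 0 <->
  residual y (cellf q u (m := m)) (bdry m i) = 0.
Proof.
rewrite -/(rho 0 i); split => [nd|r0]; last first.
  rewrite -(mulr0 ((5%:R / 3%:R) ^+ m)); apply: normal_derivative_cvg.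
  by under eq_fun do rewrite r0 mulr0; exact: cvg_cst.
have c0 : (5%:R / 3%:R) ^+ m != 0 :> R by rewrite expf_neq0 // mulf_neq0 ?invr_eq0 ?pnatr_eq0.
have C : (fun k => P k * rho 0 i) @ \oo --> (0 : R).
  move: nd; rewrite /has_normal_derivative -(cvg_shiftn m) => nd.
  rewrite (_ : (fun k => _) = (fun k => ((5%:R / 3%:R) ^+ m)^-1 * ((5%:R / 3%:R) ^+ (k + m) *
     (2%:R * u (q i) - u (iter (k + m) (Fmap q i) (q (i + 1)))
        - u (iter (k + m) (Fmap q i) (q (i - 1))))) - u (q i) / 2%:R * ((5%:R / 3%:R) ^+ k * z k))).
    have -> : (0 : R) = ((5%:R / 3%:R) ^+ m)^-1 * 0 - u (q i) / 2%:R * 0 by rewrite !mulr0 subr0.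
    by apply: cvgB; apply: cvgMl_tmp => //; exact: z_vanish.
  by apply/funext => k; rewrite normal_seqE mulrDr -!mulrA !mulKf // addrK.
(* The products are at least 1/2, so a vanishing limit forces the initial residual to vanish even if
   [P] is not known to converge. *)
apply/eqP; rewrite -normr_le0.
have CN : (fun k => 2%:R * `|P k * rho 0 i|) @ \oo --> 2%:R * `|0 : R|.
  by apply: cvgMl_tmp; apply: cvg_norm.
rewrite normr0 mulr0 in CN; apply: (cvgn_ge CN) => k.
rewrite normrM mulrA -[leLHS]mul1r; apply: ler_wpM2r => //.
have /andP[h _] := P_bounds k; have /andP[h0 _] := q01 k.
by rewrite ger0_norm; lra.
Qed.

(** For nonnegative y each factor is at least 1 and the products increase. Existence is what the
    gluing condition on the double cover asks of Dirichlet eigenfunctions. *)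
Lemma normal_derivative_ex i : 0 <= y -> exists d, has_normal_derivative q u i d.
Proof.
move=> y0.
have z0 k : 0 <= z k.
  elim: k => // k IH; have /andP[q0 q1] := q01 k; have := zsmall k.
  by rewrite ler_norml; move: IH; rewrite zS; nra.
have /cvg_ex[l Pl] : cvgn P.
  apply: nondecreasing_is_cvgn; last first.
    by exists 2%:R => _ [k _ <-]; have /andP[_ h] := P_bounds k; have /andP[h0 _] := q01 k; lra.
  apply/nondecreasing_seqP => k; rewrite {2}/P big_ord_recr /= -[phi_lo (z k)]/(z k.+1) -/(P k).
  have /andP[h _] := P_bounds k; have /andP[h0 _] := q01 k.
  rewrite -[leLHS]mulr1; apply: ler_wpM2l; first by lra.
  have := z0 k.+1; have := zsmall k; have /andP[_ q1] := q01 k; rewrite ler_norml.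
  move: (z k.+1) => t tc t0.
  have d0 : 0 < (2%:R - t) * (5%:R - t) by apply: mulr_gt0; lra.
  by rewrite /g ler_pdivlMr //; nra.
exists ((5%:R / 3%:R) ^+ m * (l * rho 0 i)); apply: normal_derivative_cvg.
by apply: cvgMr_tmp.
Qed.

End NormalDerivative.

(** * Continuous extension of functions given at the vertices *)

(** With c the tail of the geometric series, s - c increases and s + c decreases, so the limit lies
    between them at every k. *)
Lemma cauchy_geometric (R : realType) (s : nat -> R) (B r : R) : 0 <= r -> r < 1 ->
  (forall k, `|s k.+1 - s k| <= B * r ^+ k) ->
  exists l, forall k, `|l - s k| <= B * r ^+ k / (1 - r).
Proof.
move=> r0 r1 H; have r1' : 0 < 1 - r by lra.
have B0 : 0 <= B by have := H 0%N; rewrite expr0 mulr1; apply: le_trans.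
pose c k := B * r ^+ k / (1 - r).
have c0 k : 0 <= c k by rewrite /c !mulr_ge0 ?exprn_ge0 // invr_ge0 ltW.
have cS k : c k - c k.+1 = B * r ^+ k.
  by rewrite /c exprS; field; rewrite gt_eqF.
have lo : {homo (fun k => s k - c k) : i j / (i <= j)%N >-> i <= j}.
  apply/nondecreasing_seqP => k; have := H k; have := cS k.
  by rewrite ler_norml; lra.
have hi : {homo (fun k => s k + c k) : i j / (i <= j)%N >-> j <= i}.
  apply/nonincreasing_seqP => k; have := H k; have := cS k.
  by rewrite ler_norml; lra.
have /cvg_ex[l L] : cvgn (fun k => s k - c k).
  apply: nondecreasing_is_cvgn lo _; exists (s 0%N + c 0%N) => _ [k _ <-].
  by have := hi 0%N k (leq0n k); have := c0 k; lra.
exists l => k; rewrite -/(c k) ler_distlC; apply/andP; split.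
  rewrite lerBlDr; apply: (cvgn_le L) => j; have [jk|/ltnW kj] := leqP j k.
    by have := lo j k jk; have := c0 k; lra.
  by have := hi k j kj; have := c0 j; lra.
rewrite -lerBlDr; apply: (@cvgn_ge _ (fun j => s (j + k)%N - c (j + k)%N)).
  by rewrite (cvg_shiftn k (fun k => s k - c k)); exact: L.
by move=> j; apply: lo; apply: leq_addl.
Qed.

Section Extension.
Variables (R : realType) (q : 'I_3 -> 'rV[R]_2) (SG : set 'rV[R]_2).
Hypotheses (hq : equilateral q) (hSG : is_gasket q SG).
Variables (m : nat) (V p : forall k : nat, word (k + m) -> 'I_3 -> R) (D r : R).
Hypotheses (r0 : 0 < r) (r1 : r < 1).
Hypothesis V_subdivide : forall k, V (k := k.+1) = subdivide (V (k := k)) (p (k := k)).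
Hypothesis V_osc : forall k (w : word (k + m)) i j, `|V w i - V w j| <= D * r ^+ k.
Hypothesis V_compat : forall k (w w' : word (k + m)) i i',
  wmap q w (q i) = wmap q w' (q i') -> V w i = V w' i'.

Let VS k c (w : word (k + m)) : V (k := k.+1) (c, w) c = V w c.
Proof. by rewrite V_subdivide /subdivide /= eqxx. Qed.

Lemma adjacent_cells k (w w' : word (k + m)) a a' i j : SG a -> SG a' ->
  wmap q w a = wmap q w' a' -> `|V w i - V w' j| <= 2%:R * (D * r ^+ k).
Proof.
move=> Sa Sa' E.
have D0 : 0 <= D * r ^+ k by apply: le_trans (V_osc w 0 0); exact: normr_ge0.
have [[<- _]|[_ aE a'E]] := wmap_meet (gasket_tri hq hSG Sa) (gasket_tri hq hSG Sa') E.
  by apply: le_trans (V_osc w i j) _; lra.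
rewrite aE a'E in E; have C := V_compat E.
set s := sep _ _ in C E; set s' := sep _ _ in C E.
have -> : V w i - V w' j = (V w i - V w s) + (V w' s' - V w' j) by rewrite C; ring.
apply: le_trans (ler_normD _ _) _; rewrite mulr_natl mulr2n.
by apply: lerD.
Qed.

(** The cells chosen around x need not be nested, as x may lie in several cells of one level.
    Consecutive choices differ by D for the step inside a cell plus 2 D for changing to an adjacent
    one, whence 3 D; the last 2 D makes the estimate hold for every cell containing x. *)
Lemma extension_value x : SG x -> exists l, forall k (w : word (k + m)) a i, SG a ->
  x = wmap q w a -> `|l - V w i| <= (3%:R * D / (1 - r) + 2%:R * D) * r ^+ k.
Proof.
move=> Sx.
have X k : exists wa : word (k + m) * 'rV[R]_2, SG wa.2 /\ x = wmap q wa.1 wa.2.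
  by have [w [a [Sa xE]]] := gasket_cell hSG (k + m) Sx; exists (w, a).
pose f k := projT1 (cid (X k)).
have Hf k : SG (f k).2 /\ x = wmap q (f k).1 (f k).2 := projT2 (cid (X k)).
pose s k := V (f k).1 0.
have D0 : 0 <= D.
  by have := V_osc (cword 0 (0 + m)) 0 0; rewrite expr0 mulr1; apply: le_trans.
have Hs k : `|s k.+1 - s k| <= 3%:R * D * r ^+ k.
  rewrite /s; case E : (f k.+1) => [[c w] a].
  have [Sa xE] := Hf k.+1; rewrite E /= in Sa xE.
  have [Sb xE2] := Hf k.
  have A := @adjacent_cells k w (f k).1 (Fmap q c a) (f k).2 c 0 (gasket_Fmap hSG c Sa) Sb.
  have {}A := A (etrans (esym (wmapS q c w a)) (etrans (esym xE) xE2)).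
  have B := @V_osc k.+1 (c, w) 0 c; rewrite VS in B.
  rewrite [X in X <= _](_ : _ = `|(V (k := k.+1) (c, w) 0 - V w c) + (V w c - V (f k).1 0)|).
    apply: le_trans (ler_normD _ _) _.
    have : D * r ^+ k.+1 <= D * r ^+ k.
      by rewrite exprS; apply: ler_wpM2l => //; rewrite ler_piMl ?exprn_ge0 // ltW.
    by lra.
  by congr `|_|; rewrite /=; ring.
have [l Hl] := cauchy_geometric (ltW r0) r1 Hs.
exists l => k w a i Sa xE; have [Sb xE2] := Hf k.
have A := @adjacent_cells k (f k).1 w (f k).2 a 0 i Sb Sa (etrans (esym xE2) xE).
have -> : l - V w i = (l - s k) + (s k - V w i) by ring.
apply: le_trans (ler_normD _ _) _; rewrite mulrDl; apply: lerD.
  by apply: le_trans (Hl k) _; rewrite mulrAC.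
by rewrite -mulrA.
Qed.

Lemma continuous_extension : exists U : 'rV[R]_2 -> R, {within SG, continuous U} /\
  forall k (w : word (k + m)) i, U (wmap q w (q i)) = V w i.
Proof.
pose E := 3%:R * D / (1 - r) + 2%:R * D.
have /choice[U HU] : forall x, exists l, SG x -> forall k (w : word (k + m)) a i, SG a ->
    x = wmap q w a -> `|l - V w i| <= E * r ^+ k.
  move=> x; have [Sx|nSx] := pselect (SG x); last by exists 0.
  by have [l Hl] := extension_value Sx; exists l.
have rk : (fun k => E * r ^+ k) @ \oo --> (0 : R).
  rewrite -(mulr0 E); apply: cvgMl_tmp; apply: cvg_expr.
  by rewrite ger0_norm // ltW.
exists U; split; last first.
  move=> k w i; pose x := wmap q w (q i).
  have Sx : SG x by apply: gasket_vertex.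
  (* A vertex remains a corner, with unchanged value, of some cell on every finer level. *)
  have W j : exists w' : word (j + k + m), wmap q w' (q i) = x /\ V w' i = V w i.
    elim: j => [|j [w' [h1 h2]]]; first by exists w.
    by exists (i, w'); rewrite -[(j.+1 + k + m)%N]/(j + k + m).+1 wmapS Fmap_fix VS.
  apply/eqP; rewrite -subr_eq0 -normr_le0.
  apply: (@cvgn_ge _ (fun j => E * r ^+ (j + k))).
    by rewrite (cvg_shiftn k (fun k => E * r ^+ k)); exact: rk.
  move=> j; have [w' [h1 <-]] := W j.
  exact: (HU x Sx (j + k)%N w' (q i) i (gasket_q hSG i) (esym h1)).
apply/subspace_continuousP => x Sx.
have FW : Filter (within SG (nbhs x)) by exact: within_filter.
apply: (iffRL (@cvgrPdist_lt _ _ _ (within SG (nbhs x)) FW U (U x))) => e e0.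
have e20 : 0 < e / 2%:R by lra.
have /cvgrPdist_lt/(_ _ e20)[k _ /(_ k (leqnn k)) Hk] := rk.
rewrite sub0r normrN in Hk.
(* A point y close to x shares with x a cell of level k + m, and both values are compared with one
   corner of it. *)
apply: (@filterS _ (nbhs x) _ _ _ _ (near_gasket_cell hSG (k + m) x)) => y Hy Sy.
have [w [a [b [Sa Sb xE yE]]]] := Hy Sy.
have h1 := HU x Sx k w a 0 Sa xE; have h2 := HU y Sy k w b 0 Sb yE.
have h3 := ler_norm (E * r ^+ k).
have -> : U x - U y = (U x - V w 0) - (U y - V w 0) by ring.
apply: le_lt_trans (ler_normB _ _) _.
by lra.
Qed.

End Extension.

(** * Size and oscillation of iterated discrete extensions *)

(** At t = 0 this is the harmonic extension, with weights 1/5, 2/5, 2/5; in general the weights add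
    up to 2/(2 - t), at most 1 + t for small t. *)
Lemma midext_bound (R : realType) (t M : R) (a : 'I_3 -> R) j : 0 <= t <= 4%:R^-1 ->
  (forall i, `|a i| <= M) -> `|midext t a j| <= (1 + t) * M.
Proof.
move=> /andP[t0 t1] H; have M0 : 0 <= M by apply: le_trans (H 0); exact: normr_ge0.
have d0 : 0 < (2%:R - t) * (5%:R - t) by apply: mulr_gt0; lra.
rewrite /midext normrM normfV (gtr0_norm d0) ler_pdivrMr //.
apply: (@le_trans _ _ (`|2%:R * a j| + (`|(4%:R - t) * a (j + 1)| + `|(4%:R - t) * a (j - 1)|))).
  rewrite (sumI3_rot a j).
  rewrite (_ : _ - _ = 2%:R * a j + ((4%:R - t) * a (j + 1) + (4%:R - t) * a (j - 1))).
    by apply: le_trans (ler_normD _ _) _; rewrite lerD2l ler_normD.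
  by ring.
have t4 : 0 <= 4%:R - t by lra.
have n2 : `|2%:R| = 2%:R :> R by rewrite ger0_norm.
rewrite !normrM n2 (ger0_norm t4).
have h1 := ler_wpM2l t4 (H (j + 1)); have h2 := ler_wpM2l t4 (H (j - 1)).
have h0 := H j.
apply: (@le_trans _ _ ((10%:R - 2%:R * t) * M)); first by lra.
rewrite mulrAC; apply: ler_wpM2r => //.
by nra.
Qed.

Lemma midext_osc (R : realType) (t O : R) (a : 'I_3 -> R) i j : 0 <= t <= 4%:R^-1 ->
  (forall i j, `|a i - a j| <= O) -> `|midext t a i - midext t a j| <= 4%:R / 5%:R * O.
Proof.
move=> /andP[t0 t1] H.
have -> : midext t a i - midext t a j = (a j - a i) / (5%:R - t).
  by rewrite /midext; field; apply/andP; split; apply/eqP; lra.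
have d0 : 0 < 5%:R - t by lra.
have := H j i; have O0 : 0 <= O by apply: le_trans (H 0 0); exact: normr_ge0.
rewrite normrM normfV (gtr0_norm d0) ler_pdivrMr //.
have : 0 <= (4%:R^-1 - t) * O by apply: mulr_ge0; lra.
by lra.
Qed.

(** The factor of [O] is (6 - t)/((2 - t)(5 - t)), which is 3/5 at t = 0; 4/5 leaves room for t up
    to 1/4. The term t M appears because constants are not preserved. *)
Lemma midext_corner_osc (R : realType) (t M O : R) (a : 'I_3 -> R) c j : c != j ->
  0 <= t <= 4%:R^-1 -> (forall i, `|a i| <= M) -> (forall i j, `|a i - a j| <= O) ->
  `|a c - midext t a j| <= 4%:R / 5%:R * O + t * M.
Proof.
move=> cj /andP[t0 t1] HM HO; pose l := - (c + j).
have M0 : 0 <= M by apply: le_trans (HM 0); exact: normr_ge0.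
have O0 : 0 <= O by apply: le_trans (HO 0 0); exact: normr_ge0.
have S : \sum_i a i = a c + a j + a l.
  by rewrite sumI3 /l; move: c j cj {l}; apply: I3P; apply: I3P => // _; rewrite ?thirdE; ring.
have d0 : 0 < (2%:R - t) * (5%:R - t) by apply: mulr_gt0; lra.
have -> : a c - midext t a j = (2%:R * (a c - a j) + (4%:R - t) * (a c - a l) -
    (t * (5%:R - t)) * a c) / ((2%:R - t) * (5%:R - t)).
  by rewrite /midext S; field; apply/andP; split; apply/eqP; lra.
rewrite normrM normfV (gtr0_norm d0) ler_pdivrMr //.
apply: le_trans (ler_normB _ _) _.
apply: le_trans (lerD (ler_normD _ _) (lexx _)) _.
have t4 : 0 <= 4%:R - t by lra.
have t5 : 0 <= t * (5%:R - t) by apply: mulr_ge0; lra.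
rewrite !normrM (ger0_norm t4) -normrM -normrM.
have h2 : `|2%:R| = 2%:R :> R by rewrite ger0_norm.
rewrite !normrM h2 -normrM (ger0_norm t5).
have h3 := HO c j; have h4 := ler_wpM2l t4 (HO c l); have h5 := ler_wpM2l t5 (HM c).
apply: (@le_trans _ _ ((6%:R - t) * O + t * (5%:R - t) * M)); first by lra.
rewrite [leRHS]mulrDl; apply: lerD.
  by rewrite mulrAC; apply: ler_wpM2r => //; nra.
rewrite [t * M * _]mulrAC; apply: ler_wpM2r => //.
rewrite mulrA [t * _ * _]mulrAC; apply: ler_peMr; first by apply: mulr_ge0; lra.
by lra.
Qed.

Section DiscreteExtension.
Variables (R : realType) (b : bool) (m : nat) (y : R) (v : vertex b m -> R).
Hypothesis y01 : 0 <= y <= 1.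
Hypothesis Ev : deigen y v.

Let y1 : `|y| <= 1.
Proof. by rewrite ger0_norm; case/andP: y01. Qed.

Let z k := iter k (@phi_lo R) y.

Let zS k : z k = z k.+1 * (5%:R - z k.+1).
Proof. exact: iter_phi_loS. Qed.

Let q01 k : 0 < (4%:R^-1 ^+ k : R) <= 1.
Proof. by rewrite exprn_gt0 ?invr_gt0 //=; apply: exprn_ile1; lra. Qed.

Let zr k : 0 <= z k.+1 <= 4%:R^-1 ^+ k / 4%:R.
Proof.
have zs j : `|z j.+1| <= 4%:R^-1 ^+ j / 4%:R.
  by rewrite mulrC -exprS; apply: iter_phi_lo_small.
elim: k => [|k IH].
  have := zs 0%N; rewrite ler_norml expr0; case/andP: y01 => y0 _.
  by move: y0; rewrite -[y]/(z 0) zS; nra.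
have := zs k.+1; have := q01 k.+1; rewrite ler_norml; case/andP: IH => z0 _.
by move: z0; rewrite zS; nra.
Qed.

Fixpoint discrete_ext k : vertex b (k + m) -> R :=
  match k return vertex b (k + m) -> R with
  | 0 => v
  | k'.+1 => dext (z k'.+1) (discrete_ext (k := k'))
  end.

Let V k := vval (discrete_ext (k := k)).

Let C := \sum_x `|v x|.

Lemma discrete_ext_subdivide k :
  @V k.+1 = subdivide (@V k) (fun w => midext (z k.+1) (@V k w)).
Proof. by rewrite /V (vval_subdivide (discrete_ext (k := k.+1))). Qed.

Let z4 k : 0 <= z k.+1 <= 4%:R^-1.
Proof. by have := zr k; have := q01 k; lra. Qed.

Lemma discrete_ext_deigen k : deigen (z k) (discrete_ext (k := k)).
Proof.
elim: k => [//|k IH]; apply: dext_deigen.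
- by apply/eqP => h; have := z4 k; lra.
- by apply/eqP => h; have := z4 k; lra.
- by right; rewrite -zS.
Qed.

Lemma discrete_ext_bound k w i : `|@V k w i| <= C * (2%:R - 4%:R^-1 ^+ k).
Proof.
have C0 : 0 <= C by apply: sumr_ge0.
elim: k w i => [|k IH] w i.
  rewrite expr0 (_ : 2%:R - 1 = 1 :> R); last by lra.
  rewrite mulr1 /V /vval /=; case: corner => [x|] /=; last by rewrite normr0.
  by rewrite /C (bigD1 x) //= lerDl sumr_ge0.
have /andP[q0 q1] := q01 k.
case: w => c w; rewrite discrete_ext_subdivide /subdivide /= exprS.
have M := @midext_bound R _ _ (@V k w) (- (c + i)) (z4 k) (IH w).
case: ifP => _.
  by apply: le_trans (IH w i) _; apply: ler_wpM2l => //; lra.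
apply: (le_trans M); rewrite mulrCA; apply: ler_wpM2l => //.
by have := zr k; move: (z k.+1) => t; nra.
Qed.

(** The oscillation contracts by 4/5 up to an error z 2C, with z at most (19/20)^k / 4. In units of
    C (19/20)^k this is 8 + 1/2, below 10 times 19/20. *)
Lemma discrete_ext_osc k w i j :
  `|@V k w i - @V k w j| <= 10%:R * C * (19%:R / 20%:R) ^+ k.
Proof.
have C0 : 0 <= C by apply: sumr_ge0.
elim: k w i j => [|k IH] w i j.
  have := discrete_ext_bound (k := 0) w i; have := discrete_ext_bound (k := 0) w j.
  by rewrite expr0 !ler_norml; lra.
case: w => c w; rewrite discrete_ext_subdivide /subdivide /=.
have /andP[q0 q1] := q01 k.
have qr : 4%:R^-1 ^+ k <= (19%:R / 20%:R) ^+ k :> R.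
  by apply: lerXn2r; rewrite ?nnegrE; lra.
have B a : `|@V k w a| <= 2%:R * C.
  by apply: le_trans (discrete_ext_bound w a) _; nra.
have [z0 zq] := andP (zr k).
have s0 : 0 <= (19%:R / 20%:R) ^+ k :> R by apply: exprn_ge0; lra.
have D0 : 0 <= 10%:R * C * (19%:R / 20%:R) ^+ k by rewrite !mulr_ge0.
have F x : x <= 4%:R / 5%:R * (10%:R * C * (19%:R / 20%:R) ^+ k) + z k.+1 * (2%:R * C) ->
    x <= 10%:R * C * (19%:R / 20%:R) ^+ k.+1.
  move/le_trans; apply; rewrite exprS.
  have : z k.+1 * (2%:R * C) <= (19%:R / 20%:R) ^+ k / 4%:R * (2%:R * C).
    by apply: ler_wpM2r; lra.
  have : 0 <= C * (19%:R / 20%:R) ^+ k by rewrite mulr_ge0.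
  by move: (_ ^+ k) => s; lra.
have zC : 0 <= z k.+1 * (2%:R * C) by apply: mulr_ge0 => //; apply: mulr_ge0.
case: (eqVneq c i) => [<-|ci]; case: (eqVneq c j) => [<-|cj].
- by rewrite subrr normr0; apply: F; lra.
- apply: F; apply: (midext_corner_osc _ (z4 k) B (IH w)).
  by move: c j cj; apply: I3P; apply: I3P.
- apply: F; rewrite distrC; apply: (midext_corner_osc _ (z4 k) B (IH w)).
  by move: c i ci; apply: I3P; apply: I3P.
- apply: F; apply: le_trans (midext_osc _ _ (z4 k) (IH w)) _; lra.
Qed.

End DiscreteExtension.

(** * Eigenspaces on the gasket and on the graphs *)

Section Spaces.
Variables (R : realType) (q : 'I_3 -> 'rV[R]_2) (SG : set 'rV[R]_2).
Hypotheses (hq : equilateral q) (hSG : is_gasket q SG).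

Lemma graph_laplacian_lin a u v n (x : vertex false n) :
  graph_laplacian q n (fun t => a * u t + v t) (pos q x) =
  a * graph_laplacian q n u (pos q x) + graph_laplacian q n v (pos q x).
Proof.
rewrite !graph_laplacianE // mulr_sumr -big_split; apply: eq_bigr => w _ /=.
rewrite mulr_sumr -big_split; apply: eq_bigr => i _ /=.
by rewrite !sumI3 /cellf; ring.
Qed.

Lemma within_continuous_lin (f g : 'rV[R]_2 -> R) c :
  {within SG, continuous f} -> {within SG, continuous g} ->
  {within SG, continuous (fun t => c * f t + g t)}.
Proof.
by move=> fc gc x; apply: cvgD; [apply: cvgMl_tmp; exact: fc|exact: gc].
Qed.

Lemma within_continuous_oppM (f : 'rV[R]_2 -> R) c :
  {within SG, continuous f} -> {within SG, continuous (fun t => - (c * f t))}.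
Proof.
move=> fc; have := within_continuous_lin (g := fun=> 0) (c := - c) fc (fun x => cvg_cst 0).
by under eq_fun do rewrite addr0 mulNr; exact.
Qed.

Lemma eigen_equation_lin l a u v : eigen_equation q SG l u -> eigen_equation q SG l v ->
  eigen_equation q SG l (fun t => a * u t + v t).
Proof.
move=> [uc _ ul] [vc _ vl].
have wc := within_continuous_lin (c := a) uc vc; split => //; first exact: within_continuous_oppM.
move=> e e0; pose d := e / (2%:R * (`|a| + 1)).
have a0 : 0 < `|a| + 1 by rewrite ltr_wpDl.
have d0 : 0 < d by rewrite divr_gt0 // mulr_gt0.
have e20 : 0 < e / 2%:R by lra.
have := ul d d0; have := vl _ e20; apply: filterS2 => n Hv Hu x Vx.
have := Hv x Vx; have := Hu x Vx.
have [Y ->] : exists Y : vertex false n, x = pos q Y by apply/Vset_interiorP.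
rewrite graph_laplacian_lin.
move: (graph_laplacian _ _ _ _) (graph_laplacian _ _ _ _) (u _) (v _) (5%:R ^+ n).
move=> lv lu ux vx f h1 h2.
have -> : 3%:R / 2%:R * f * (a * lu + lv) - - (l * (a * ux + vx)) =
  a * (3%:R / 2%:R * f * lu - - (l * ux)) + (3%:R / 2%:R * f * lv - - (l * vx)) by ring.
apply: le_lt_trans (ler_normD _ _) _; rewrite normrM.
have : `|a| * `|3%:R / 2%:R * f * lu - - (l * ux)| <= e / 2%:R.
  apply: (@le_trans _ _ ((`|a| + 1) * d)).
    by apply: ler_pM => //; [lra|exact: ltW].
  by have -> : (`|a| + 1) * d = e / 2%:R by rewrite /d; field; rewrite gt_eqF.
by lra.
Qed.

Lemma eigen_equation0 l : eigen_equation q SG l (fun=> 0).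
Proof.
split; [by move=> x; exact: cvg_cst|by move=> x; rewrite mulr0; exact: cvg_cst|].
move=> e e0; apply: nearW => n x Vx.
have [Y ->] : exists Y : vertex false n, x = pos q Y by apply/Vset_interiorP.
have := graph_laplacian_lin (-1) (fun=> 0) (fun=> 0) Y.
under eq_fun do rewrite mulr0 addr0.
rewrite mulN1r addNr => L0; change (`|3%:R / 2%:R * 5%:R ^+ n *
  graph_laplacian q n (fun=> 0) (pos q Y) - - (l * 0)| < e).
by rewrite L0 !mulr0 oppr0 subrr normr0.
Qed.

Lemma has_normal_derivative_lin a u v i (d d' : R) : has_normal_derivative q u i d ->
  has_normal_derivative q v i d' ->
  has_normal_derivative q (fun t => a * u t + v t) i (a * d + d').
Proof.
move=> ud vd; rewrite /has_normal_derivative.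
rewrite (_ : (fun n : nat => _) = (fun n : nat =>
  a * ((5%:R / 3%:R) ^+ n * (2%:R * u (q i) - u (iter n (Fmap q i) (q (i + 1)))
        - u (iter n (Fmap q i) (q (i - 1))))) +
  (5%:R / 3%:R) ^+ n * (2%:R * v (q i) - v (iter n (Fmap q i) (q (i + 1)))
        - v (iter n (Fmap q i) (q (i - 1)))))).
  by apply: cvgD => //; apply: cvgMl_tmp.
by apply/funext => n; ring.
Qed.

Lemma has_normal_derivative0 i : has_normal_derivative q (fun=> 0) i 0.
Proof.
rewrite /has_normal_derivative (_ : (fun n : nat => _) = fun=> 0); first exact: cvg_cst.
by apply/funext => n; rewrite mulr0 !subr0 mulr0.
Qed.

Definition bspace (b : bool) (l : R) : set ('rV[R]_2 -> R) :=
  if b then neumann_space q SG l else dirichlet_space q SG l.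

Lemma bspace_eigen b l u : bspace b l u -> eigen_equation q SG l u.
Proof. by case: b => -[]. Qed.

Lemma bspace_lin b l : lin_closed (bspace b l).
Proof.
apply: lin_closedP.
  case: b; split; try exact: eigen_equation0; last by [].
  by move=> i; exact: has_normal_derivative0.
move=> a u v; case: b => -[Eu Du] [Ev Dv]; split; try exact: eigen_equation_lin.
  move=> i; rewrite -(addr0 (0 : R)) -{1}(mulr0 a).
  exact: has_normal_derivative_lin.
by move=> i; rewrite Du Dv mulr0 addr0.
Qed.

Lemma bspace_vval b l u n : bspace b l u ->
  vval (fun x : vertex b n => u (pos q x)) = cellf q u (m := n).
Proof.
case: b => -[Eu Du]; apply: vval_pos; first by left.
by right.
Qed.

Lemma bspace_trace b m (y : R) u : `|y| <= 1 -> bspace b (5%:R ^+ m * psi y) u ->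
  deigen y (fun x : vertex b m => u (pos q x)).
Proof.
move=> y1 bu x; rewrite (bspace_vval _ bu).
case: b bu x => -[Eu Du] x; last exact: (eigen_residual hq hSG).
have [[X ->]|[i ->]] := vertex_true_cases x.
  by rewrite residual_emb; exact: (eigen_residual hq hSG).
by apply/(residual_bdry_eq0 hq hSG y1 Eu).
Qed.

Lemma bspace_trace_iter b m (y : R) u k : `|y| <= 1 -> bspace b (5%:R ^+ m * psi y) u ->
  deigen (iter k (@phi_lo R) y) (fun x : vertex b (k + m) => u (pos q x)).
Proof.
move=> y1 bu; apply: bspace_trace.
  by apply: le_trans (iter_phi_lo_small k y1) _; apply: exprn_ile1; lra.
by rewrite addnC exprD -mulrA psi_iter.
Qed.

Lemma bspace_eq0 b l m u : bspace b l u ->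
  (forall k (x : vertex b (k + m)), u (pos q x) = 0) -> forall x, SG x -> u x = 0.
Proof.
move=> bu u0; have [uc _ _] := bspace_eigen bu.
apply: (gasket_continuous_eq0 hSG (m0 := m) uc) => k w i.
have := bspace_vval (k + m) bu => /(congr1 (fun f => f w i)).
by rewrite /cellf => <-; rewrite /vval; case: corner => [x|] //=.
Qed.

Lemma dext0 b n (z : R) (x : vertex b n.+1) : dext z (fun=> 0) x = 0.
Proof.
case: x => [//|[w j]] /=.
have v0 i : vval (fun=> 0 : R) w i = 0 by rewrite /vval; case: corner.
by rewrite /midext big1 ?v0 // !mulr0 subrr mul0r.
Qed.

Lemma eigen_equation_of_residual m (y : R) u : `|y| <= 1 -> {within SG, continuous u} ->
  (forall k (x : vertex false (k + m)),
     residual (iter k (@phi_lo R) y) (cellf q u (m := k + m)) x = 0) ->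
  eigen_equation q SG (5%:R ^+ m * psi y) u.
Proof.
move=> y1 uc r0; split => //; first exact: within_continuous_oppM.
move=> e e0; have [B B0 HB] := gasket_continuous_bounded hSG uc.
have f0 : 0 < 5%:R ^+ m :> R by apply: exprn_gt0.
have d0 : 0 < e / (B * 5%:R ^+ m) by rewrite divr_gt0 // mulr_gt0.
have /cvgrPdist_lt/(_ _ d0)[K _ HK] := psi_cvg y1.
exists (K + m)%N => // n /= Kn x Vx.
have [k nE] : exists k, n = (k + m)%N.
  by exists (n - m)%N; rewrite subnK // (leq_trans _ Kn) ?leq_addl.
subst n; have Kk : (K <= k)%N by rewrite leq_add2r in Kn.
have [Y xE] : exists Y : vertex false (k + m), x = pos q Y by apply/Vset_interiorP.
have Sx : SG x.
  have [w [i wi]] := corner_surj Y; rewrite xE (pos_corner q wi); exact: gasket_vertex.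
have := r0 k Y; rewrite (residual_laplacian hq) -xE => /eqP.
rewrite oppr_eq0 addr_eq0 => /eqP ->.
have uB := HB x Sx; have := HK k Kk; rewrite /= /psi_seq => L.
rewrite (_ : _ - _ = u x *
  (5%:R ^+ m * (psi y - 3%:R / 2%:R * 5%:R ^+ k * iter k (@phi_lo R) y))); last first.
  by rewrite exprD; ring.
rewrite !normrM (gtr0_norm f0).
apply: le_lt_trans (ler_wpM2r _ uB) _; first by rewrite mulr_ge0 // ltW.
by move: L; rewrite ltr_pdivlMr ?mulr_gt0 //; move: (`|psi y - _|) => X; lra.
Qed.

Lemma bspace_extend b m (y : R) (v : vertex b m -> R) : 0 <= y <= 1 -> deigen y v ->
  exists2 u, bspace b (5%:R ^+ m * psi y) u & forall x, u (pos q x) = v x.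
Proof.
move=> y01 Ev; have y1 : `|y| <= 1 by rewrite ger0_norm; case/andP: y01.
have r0 : 0 < 19%:R / 20%:R :> R by lra.
have r1 : 19%:R / 20%:R < 1 :> R by lra.
have compat k (w w' : word (k + m)) i i' : wmap q w (q i) = wmap q w' (q i') ->
    vval (discrete_ext y v (k := k)) w i = vval (discrete_ext y v (k := k)) w' i'.
  by move=> /(wmap_corner hq) E; rewrite /vval E.
have [u [uc uV]] := continuous_extension hq hSG r0 r1 (discrete_ext_subdivide y v)
  (fun k => discrete_ext_osc v y01 (k := k)) compat.
have cE k : cellf q u (m := k + m) = vval (discrete_ext y v (k := k)).
  by apply/funext => w; apply/funext => i; exact: uV.
have Du k := discrete_ext_deigen y01 Ev (k := k).
have eu : eigen_equation q SG (5%:R ^+ m * psi y) u.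
  apply: eigen_equation_of_residual => // k x; rewrite cE.
  (* The eigenvalue equation concerns interior vertices only; in the Neumann model these are the
     images of [emb]. *)
  case: b v Ev compat uV cE Du => v Ev _ _ _ Du; last exact: (Du k x).
  by rewrite -residual_emb; exact: (Du k (emb x)).
exists u; last first.
  move=> x; have [w [i wi]] := corner_surj x.
  by rewrite (pos_corner q wi) (uV 0%N) /vval /= wi.
case: b v Ev compat uV cE Du => v Ev _ uV cE Du; split => // i.
  by apply/(residual_bdry_eq0 hq hSG y1 eu); rewrite (cE 0%N); exact: (Du 0%N (bdry m i)).
by have := uV 0%N (cword i m) i; rewrite wmap_cword_fix /vval corner_cword.
Qed.

Lemma bspace_dim b m (y : R) n : 0 <= y <= 1 -> has_dim setT (@deigen R b m y) n ->
  has_dim SG (bspace b (5%:R ^+ m * psi y)) n.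
Proof.
move=> y01; have y1 : `|y| <= 1 by rewrite ger0_norm; case/andP: y01.
have z4 k : iter k.+1 (@phi_lo R) y <= 4%:R^-1.
  have := iter_phi_lo_small k.+1 y1; rewrite ler_norml => /andP[_ /le_trans]; apply.
  by rewrite exprS -[leRHS]mulr1; apply: ler_wpM2l; [lra|apply: exprn_ile1; lra].
apply: (@has_dim_pullback _ _ _ SG setT _ _ (@pos R q b m)).
- by move=> x _; have [w [i wi]] := corner_surj x; rewrite (pos_corner q wi); apply: gasket_vertex.
- exact: bspace_lin.
- by move=> u; exact: bspace_trace.
(* On finer levels the spectral parameter is at most 1/4, so the extension is unique and zero values
   at level m propagate to all vertices, which are dense. *)
- move=> u bu u0; apply: (@bspace_eq0 b _ m u bu); elim=> [|k IH] x; first exact: u0.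
  have E := @deigen_unique R b (k + m) (iter k.+1 (@phi_lo R) y)
    (fun x => u (pos q x)) _ _ (@bspace_trace_iter b m y u k.+1 y1 bu).
  rewrite -[LHS]/((fun x : vertex b (k + m).+1 => u (pos q x)) x) E.
  - rewrite (_ : _ \o _ = fun=> 0); first exact: dext0.
    by apply/funext => t; exact: IH.
  - by apply/eqP => h; have := z4 k; lra.
  - by apply/eqP => h; have := z4 k; lra.
- by move=> v Ev; have [u bu uE] := bspace_extend y01 Ev; exists u => // x _; exact: uE.
Qed.

(** A negative l is 5^m psi(y) for some y in [-1, 0[. The traces of u would then be eigenfunctions
    for negative parameters, whereas the discrete spectra lie in [0, 6]. *)
Lemma bspace_neg b l u : l < 0 -> bspace b l u -> forall x, SG x -> u x = 0.
Proof.
move=> l0 bu.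
have [m lm] : exists m, - l <= 5%:R ^+ m * (3%:R / 4%:R) :> R.
  pose n := (Num.truncn (- l * (4%:R / 3%:R))).+1; exists n.
  have h1 : - l * (4%:R / 3%:R) < n%:R by rewrite truncnS_gt.
  have : n%:R <= 5%:R ^+ n :> R by rewrite -natrX ler_nat ltnW // ltn_expl.
  by lra.
have f0 : 0 < 5%:R ^+ m :> R by apply: exprn_gt0.
have N1 : psi (-1) <= - (3%:R / 4%:R) :> R.
  have /andP[] : 3%:R / 4%:R * (0 - (-1)) <= psi (0 : R) - psi (-1) <= 3%:R * (0 - (-1)).
    by apply: psi_dist; lra.
  by rewrite psi0; lra.
have [y yr yE] : exists2 y : R, -1 <= y <= 0 & psi y = l / 5%:R ^+ m.
  apply: psi_surj; try lra.
  rewrite psi0 ler_pdivrMr // mul0r (ltW l0) andbT ler_pdivlMr //.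
  by apply: le_trans (_ : - (3%:R / 4%:R) * 5%:R ^+ m <= _); [rewrite ler_pM2r|lra].
have y1 : `|y| <= 1 by rewrite ler_norml; lra.
have y0 : y < 0.
  rewrite lt_neqAle; case/andP: yr => _ ->; rewrite andbT; apply/eqP => yz.
  by move: yE; rewrite yz psi0 => /esym/eqP; rewrite mulf_eq0 invr_eq0 (lt_eqF l0) (gt_eqF f0).
have lE : l = 5%:R ^+ m * psi y by rewrite yE mulrC divfK // gt_eqF.
rewrite lE in bu.
have zneg k : iter k (@phi_lo R) y < 0.
  elim: k => [//|k IH]; have := iter_phi_loS k y1; have := iter_phi_lo_small k.+1 y1.
  have : 4%:R^-1 ^+ k.+1 <= (1 : R) by apply: exprn_ile1; lra.
  by rewrite ler_norml; move: IH; move: (iter k.+1 _ _) (iter k _ _) => a c; nra.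
apply: (@bspace_eq0 b _ m u bu) => k.
have tr := bspace_trace_iter (k := k) y1 bu.
have := dspec_dim b (k + m) (iter k (@phi_lo R) y).
have -> : count_mem (iter k (@phi_lo R) y) (dspec R b (k + m)) = 0%N.
  apply/eqP; rewrite -leqn0 leqNgt -has_count has_pred1; apply/negP => /dspec_range.
  by have := zneg k; lra.
by case=> c [_ _ H] x; have [d ->] := H _ tr; rewrite // big_ord0.
Qed.

End Spaces.

(** * Counting functions and the double cover *)

(** The list may contain values that are not eigenvalues, as they contribute dimension 0; this
    allows one list for all three problems. *)
Lemma counting_seq (R : realType) (T : Type) (D : set T) (E : R -> set (T -> R))
    (t : R) (s : seq R) : uniq s -> (forall l, l \in s -> l <= t) ->
  (forall l, eigenvalue_of D E l -> l <= t -> l \in s) ->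
  (forall l, exists n, has_dim D (E l) n) ->
  Defs.counting D E t = (\sum_(l <- s) fdim D (E l))%N.
Proof.
move=> us st sE fin; rewrite /Defs.counting [RHS]fsbig_seq //; apply: fsbig_widen.
  by move=> l [] /sE; apply.
move=> l /= [ls nl]; have [n hn] := fin l.
rewrite (has_dim_fdim hn); apply/eqP; rewrite -leqn0 leqNgt; apply/negP => n0.
by apply: nl; split; [apply/(eigenvalue_has_dim hn)|exact: st].
Qed.

Lemma sum_count_mem (T : eqType) (U s : seq T) (p : pred T) : uniq U ->
  (forall y, y \in U -> p y) -> (forall y, y \in s -> p y -> y \in U) ->
  (\sum_(y <- U) count_mem y s)%N = count p s.
Proof.
move=> uU Up sU; elim: s sU => [|x s IH] sU.
  by rewrite big1.
rewrite /= big_split /= IH; last by move=> y ys; apply: sU; rewrite inE ys orbT.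
congr addn; have [px|npx] := boolP (p x).
  have xU : x \in U by apply: sU; rewrite ?inE ?eqxx.
  rewrite (bigD1_seq x) //= eqxx big1 // => y /negbTE.
  by rewrite eq_sym => ->.
rewrite big_seq big1 // => y yU; case: eqP => // xy.
by rewrite xy (Up _ yU) in npx.
Qed.

Section Counting.
Variables (R : realType) (q : 'I_3 -> 'rV[R]_2) (SG : set 'rV[R]_2).
Hypotheses (hq : equilateral q) (hSG : is_gasket q SG).

Lemma psi1_ge : 3%:R / 4%:R <= psi (1 : R).
Proof.
have /andP[] : 3%:R / 4%:R * (1 - 0) <= psi (1 : R) - psi 0 <= 3%:R * (1 - 0).
  by apply: psi_dist; lra.
by rewrite psi0; lra.
Qed.

Lemma psi_scale_surj (l : R) : 0 <= l -> exists m y, 0 <= y <= 1 /\ l = 5%:R ^+ m * psi y.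
Proof.
move=> l0; have [m lm] : exists m, l <= 5%:R ^+ m * (3%:R / 4%:R) :> R.
  pose n := (Num.truncn (l * (4%:R / 3%:R))).+1; exists n.
  have h1 : l * (4%:R / 3%:R) < n%:R by rewrite truncnS_gt.
  have : n%:R <= 5%:R ^+ n :> R by rewrite -natrX ler_nat ltnW // ltn_expl.
  by lra.
have f0 : 0 < 5%:R ^+ m :> R by apply: exprn_gt0.
have [y y01 yE] : exists2 y : R, 0 <= y <= 1 & psi y = l / 5%:R ^+ m.
  apply: psi_surj; try lra.
  rewrite psi0 divr_ge0 ?(ltW f0) //= ler_pdivrMr //.
  apply: (le_trans lm); rewrite mulrC; apply: ler_wpM2r; [exact: ltW|exact: psi1_ge].
by exists m, y; split => //; rewrite yE mulrC divfK // gt_eqF.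
Qed.

Lemma bspace_findim b l : exists n, has_dim SG (bspace q SG b l) n.
Proof.
have [l0|l0] := leP 0 l.
  have [m [y [y01 ->]]] := psi_scale_surj l0.
  by eexists; apply: (bspace_dim hq hSG y01 (dspec_dim b m y)).
by exists 0%N; apply: has_dim0 => u bu; exact: (bspace_neg hq hSG l0 bu).
Qed.

Definition copy_sign (c : bool) : R := if c then 1 else -1.

(** The even part is Neumann because the two normal derivatives add up to zero, the odd part is
    Dirichlet because glued values agree. *)
Lemma double_cover_split l (u : bool * 'rV[R]_2 -> R) : double_cover_space q SG l u ->
  bspace q SG true l (fun x => 2%:R^-1 * u (true, x) + 2%:R^-1 * u (false, x)) /\
  bspace q SG false l (fun x => 2%:R^-1 * u (true, x) + - 2%:R^-1 * u (false, x)).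
Proof.
move=> [eu uq nu].
have half a : eigen_equation q SG l (fun x => 2%:R^-1 * u (true, x) + a * u (false, x)).
  apply: eigen_equation_lin => //.
  have := eigen_equation_lin hq a (eu false) (eigen_equation0 SG hq l).
  by under eq_fun do rewrite addr0.
split; split; try exact: half.
  move=> i; have [d [d' [h1 h2 h3]]] := nu i.
  rewrite (_ : 0 = 2%:R^-1 * d + (2%:R^-1 * d' + 0)); last by lra.
  apply: has_normal_derivative_lin => //.
  have := has_normal_derivative_lin (a := 2%:R^-1) h2 (has_normal_derivative0 q i).
  by under eq_fun do rewrite addr0.
by move=> i; rewrite uq mulNr subrr.
Qed.

Lemma double_cover_even l u : bspace q SG true l u ->
  double_cover_space q SG l (fun p => u p.2).
Proof. by move=> [eu nu]; split => // i; exists 0, 0; split => //; rewrite addr0. Qed.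

(** Nonnegativity of l gives a nonnegative parameter y, and with it the existence of the normal
    derivatives. *)
Lemma double_cover_odd l u : 0 <= l -> bspace q SG false l u ->
  double_cover_space q SG l (fun p => copy_sign p.1 * u p.2).
Proof.
move=> l0 [eu u0]; split => /=.
- move=> c; have := eigen_equation_lin hq (copy_sign c) eu (eigen_equation0 SG hq l).
  by under eq_fun do rewrite addr0.
- by move=> i; rewrite u0 !mulr0.
- move=> i; have [m [y [/andP[y0 y1] lE]]] := psi_scale_surj l0.
  rewrite lE in eu; have ny : `|y| <= 1 by rewrite ger0_norm.
  have [d hd] := normal_derivative_ex hq hSG ny eu i y0.
  have hc c := has_normal_derivative_lin (a := c) hd (has_normal_derivative0 q i).
  exists (1 * d + 0), (-1 * d + 0); split; last by lra.
    by have := hc 1; under eq_fun do rewrite addr0.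
  by have := hc (-1); under eq_fun do rewrite addr0.
Qed.

Lemma double_cover_dim l n n' : has_dim SG (bspace q SG true l) n ->
  has_dim SG (bspace q SG false l) n' ->
  has_dim [set p : bool * 'rV[R]_2 | SG p.2] (double_cover_space q SG l) (n + n').
Proof.
have [l0|l0] := leP 0 l; last first.
  have Z b k : has_dim SG (bspace q SG b l) k -> k = 0%N.
    by move/has_dim_inj; apply; apply: has_dim0 => u bu; exact: (bspace_neg hq hSG l0 bu).
  move=> /Z -> /Z ->; apply: has_dim0 => u /double_cover_split[e o] [c x] /= Sx.
  have := bspace_neg hq hSG l0 e Sx; have := bspace_neg hq hSG l0 o Sx.
  by case: c; lra.
move=> [be [Ee fe ge]] [bo [Eo fo go]].
pose bb (i : 'I_(n + n')) (p : bool * 'rV[R]_2) : R := match fintype.split i with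
  | inl j => be j p.2 | inr j => copy_sign p.1 * bo j p.2 end.
have sumE (c : 'I_(n + n') -> R) p : \sum_i c i * bb i p =
    \sum_j c (lshift n' j) * be j p.2 + copy_sign p.1 * \sum_j c (rshift n j) * bo j p.2.
  rewrite big_split_ord mulr_sumr /=; congr (_ + _); apply: eq_bigr => j _.
    by rewrite /bb (unsplitK (inl _ j)).
  by rewrite /bb (unsplitK (inr _ j)) mulrCA.
exists bb; split.
- move=> i; rewrite /bb; case: (fintype.split i) => j; first exact: double_cover_even.
  exact: double_cover_odd.
- move=> c c0; have H x : SG x -> \sum_j c (lshift n' j) * be j x = 0 /\
      \sum_j c (rshift n j) * bo j x = 0.
    move=> Sx; have := c0 (true, x) Sx; have := c0 (false, x) Sx; rewrite !sumE /copy_sign /=.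
    by split; lra.
  move=> i; rewrite -(fintype.splitK i); case: (fintype.split i) => j /=.
    by apply: (fe (fun j => c (lshift n' j))) => x /H[].
  by apply: (fo (fun j => c (rshift n j))) => x /H[].
- move=> u /double_cover_split[/ge[ce He] /go[co Ho]].
  exists (fun i => match fintype.split i with inl j => ce j | inr j => co j end) => -[c x] /= Sx.
  rewrite sumE; under eq_bigr do rewrite (unsplitK (inl _ _)).
  under [X in _ + _ * X]eq_bigr do rewrite (unsplitK (inr _ _)).
  by rewrite -He // -Ho // /copy_sign; case: c => /=; lra.
Qed.

Lemma N_psi m (x : R) : 0 <= x <= 1 ->
  [/\ N_neumann q SG (5%:R ^+ m * psi x) = dcount true m x,
      N_dirichlet q SG (5%:R ^+ m * psi x) = dcount false m x &
      N_double q SG (5%:R ^+ m * psi x) = (dcount true m x + dcount false m x)%N].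
Proof.
move=> x01; pose h (y : R) := 5%:R ^+ m * psi y.
have f0 : 0 < 5%:R ^+ m :> R by apply: exprn_gt0.
(* Candidates from both discrete spectra, so that the Neumann, Dirichlet and double cover counts are
   sums over the same list. *)
pose U := undup [seq y <- dspec R true m ++ dspec R false m | y <= x].
have UP y : y \in U -> 0 <= y <= x.
  rewrite mem_undup mem_filter mem_cat => /andP[yx ys]; rewrite yx andbT.
  by case/orP: ys => /dspec_range/andP[].
have hle y y' : 0 <= y <= 1 -> 0 <= y' <= 1 -> (h y <= h y') = (y <= y').
  by move=> y0 y1; rewrite /h ler_pM2l // psi_le //; lra.
have uU : uniq [seq h y | y <- U].
  rewrite map_inj_in_uniq ?undup_uniq // => y y' /UP y0 /UP y1 hyy.
  have a1 : 0 <= y <= 1 by lra.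
  have a2 : 0 <= y' <= 1 by lra.
  by apply/eqP; rewrite eq_le -(hle _ _ a1 a2) -(hle _ _ a2 a1) hyy lexx.
have Ule l : l \in [seq h y | y <- U] -> l <= h x.
  by case/mapP => y /UP y0 ->; rewrite hle //; lra.
have bdim b y : 0 <= y <= 1 -> has_dim SG (bspace q SG b (h y)) (count_mem y (dspec R b m)).
  by move=> y01; apply: (bspace_dim hq hSG y01); exact: dspec_dim.
have Urep l : 0 <= l -> l <= h x -> exists2 y, 0 <= y <= x & l = h y.
  move=> l0 lx; have [||||y yx yE] := @psi_surj R 0 x (l / 5%:R ^+ m); try lra.
    by rewrite psi0 divr_ge0 ?(ltW f0) //= ler_pdivrMr // mulrC.
  by exists y => //; rewrite /h yE mulrC divfK // gt_eqF.
have Umem b l : eigenvalue_of SG (bspace q SG b) l -> l <= h x -> l \in [seq h y | y <- U].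
  move=> el lx; have [l0|l0] := leP 0 l; last first.
    by case: el => u [bu [t St]]; rewrite (bspace_neg hq hSG l0 bu St) eqxx.
  have [y yx lE] := Urep l l0 lx; rewrite lE; apply: map_f.
  have y01 : 0 <= y <= 1 by lra.
  move: el; rewrite lE => /(eigenvalue_has_dim (bdim b y y01)).
  rewrite -has_count has_pred1 mem_undup mem_filter mem_cat => ys.
  by case/andP: yx => _ ->; case: b ys => ->; rewrite ?orbT.
have fE b y : y \in U -> fdim SG (bspace q SG b (h y)) = count_mem y (dspec R b m).
  by move=> /UP yx; apply: has_dim_fdim; apply: bdim; lra.
have cE b : (\sum_(y <- U) count_mem y (dspec R b m))%N = dcount b m x.
  apply: sum_count_mem => [|y /UP/andP[]//|y ys yx]; first exact: undup_uniq.
  by rewrite mem_undup mem_filter mem_cat yx /=; case: b ys => ->; rewrite ?orbT.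
have NE b : Defs.counting SG (bspace q SG b) (h x) = dcount b m x.
  rewrite (counting_seq uU Ule (@Umem b) (bspace_findim b)) big_map -cE.
  by apply: eq_big_seq => y /fE.
split; [exact: (NE true)|exact: (NE false)|].
have dfin l : exists k, has_dim [set p : bool * 'rV[R]_2 | SG p.2] (double_cover_space q SG l) k.
  have [n hn] := bspace_findim true l; have [n' hn'] := bspace_findim false l.
  by exists (n + n')%N; apply: double_cover_dim.
rewrite /N_double (counting_seq uU Ule _ dfin).
  rewrite big_map -!cE -big_split; apply: eq_big_seq => y yU /=.
  have y01 : 0 <= y <= 1 by have := UP y yU; lra.
  by apply: has_dim_fdim; apply: double_cover_dim; exact: bdim.
move=> l [u [du [[c t] /= St ut]]] lx.
have [e o] := double_cover_split du.
(* Where u does not vanish, its even or its odd part does not, so l is a Neumann or a Dirichlet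
   eigenvalue. *)
have [et|et] := eqVneq (2%:R^-1 * u (true, t) + 2%:R^-1 * u (false, t)) 0; last first.
  by apply: (Umem true) => //; eexists; split; [exact: e|exists t].
apply: (Umem false) => //; eexists; split; first exact: o.
exists t => //; apply/eqP => ot; move/eqP: ut; apply.
by case: c; lra.
Qed.

End Counting.

(** * The set of good points: openness, scaling and full measure *)

Lemma lebesgue_measure_cover (R : realType) (s : seq (R * R)) (X : set R) :
  measurable X -> (forall p, p \in s -> p.1 <= p.2) ->
  (forall t, X t -> exists2 p, p \in s & p.1 <= t <= p.2) ->
  (lebesgue_measure X <= (\sum_(p <- s) (p.2 - p.1))%:E)%E.
Proof.
elim: s X => [|[a b] s IH] X mX s1 sX.
  rewrite big_nil (_ : X = set0) ?measure0 //.
  by apply/seteqP; split => // t /sX[].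
have ab : a <= b := s1 (a, b) (mem_head _ _).
have mI : measurable (`[a, b]%classic : set R) by exact: measurable_itv.
have mD : measurable (X `\` `[a, b]%classic) by exact: measurableD.
have h1 : (lebesgue_measure X <= lebesgue_measure (`[a, b]%classic `|` (X `\` `[a, b]%classic)))%E.
  apply: le_measure; rewrite ?inE //; first exact: measurableU.
  by move=> t Xt; have [tab|ntab] := pselect (`[a, b]%classic t); [left|right].
apply: (le_trans h1).
apply: (@le_trans _ _ (lebesgue_measure (`[a, b]%classic : set R) +
  lebesgue_measure (X `\` `[a, b]%classic))%E).
  exact: measureU2.
rewrite big_cons EFinD; apply: leeD.
  rewrite lebesgue_measure_itv /=; case: ifP => // _.
  by rewrite lee_fin subr_ge0.
apply: IH => // [p ps|t [Xt ntab]]; first by apply: s1; rewrite inE ps orbT.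
have [p + pt] := sX t Xt; rewrite inE => /orP[/eqP pE|ps]; last by exists p.
by exfalso; apply: ntab; rewrite /= in_itv /=; rewrite pE in pt.
Qed.

Lemma powR_alpha (R : realType) m (t : R) : 0 <= t ->
  (5%:R ^+ m * t) `^ alpha R = 3%:R ^+ m * t `^ alpha R.
Proof.
have ln5 : 0 < ln (5%:R : R) by rewrite ln_gt0 // ltr1n.
have p5 : 5%:R `^ alpha R = 3%:R.
  rewrite /powR pnatr_eq0 /= /alpha divfK ?gt_eqF // lnK // posrE.
  by rewrite ltr0n.
move=> t0; rewrite powRM ?exprn_ge0 //; congr (_ * _).
elim: m => [|m IH]; first by rewrite !expr0 powR1.
by rewrite !exprS powRM ?exprn_ge0 // IH p5.
Qed.

Lemma bounded_expr3_eq0 (R : realType) (d C : R) (m0 : nat) :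
  (forall m, (m0 <= m)%N -> `|d| * 3%:R ^+ m <= C) -> d = 0.
Proof.
move=> H; apply/eqP; rewrite -normr_le0 leNgt; apply/negP => d0.
pose n := ((Num.truncn (C / `|d|)).+1 + m0)%N.
have h1 : C / `|d| < n%:R.
  by apply: lt_le_trans (truncnS_gt _) _; rewrite ler_nat leq_addr.
have h2 : n%:R <= 3%:R ^+ n :> R by rewrite -natrX ler_nat ltnW // ltn_expl.
have := H n (leq_addl _ _); move: h1; rewrite ltr_pdivrMr //.
have : `|d| * n%:R <= `|d| * 3%:R ^+ n by apply: ler_wpM2l.
by move: (`|d|) => x; lra.
Qed.

Section MainTheorem.
Variables (R : realType) (q : 'I_3 -> 'rV[R]_2) (SG : set 'rV[R]_2).
Hypotheses (hq : equilateral q) (hSG : is_gasket q SG).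

Definition stable_counts (a b : R) (m0 : nat) (t : R) : Prop :=
  forall m, (m0 <= m)%N ->
    [/\ (N_double q SG (5%:R ^+ m * t))%:R = 2%:R * a * 3%:R ^+ m,
        (N_neumann q SG (5%:R ^+ m * t))%:R = a * 3%:R ^+ m + b &
        (N_dirichlet q SG (5%:R ^+ m * t))%:R = a * 3%:R ^+ m - b].

(** The constants and the starting level are shared by a neighbourhood: this gives openness and the
    continuity of G. The bound [e <= t] keeps the neighbourhood among the positive numbers. *)
Definition good_point (t : R) : Prop :=
  exists e a b m0, [/\ 0 < e, e <= t &
    forall s, `|s - t| < e -> stable_counts a b m0 s].

Lemma good_point_gt0 t : good_point t -> 0 < t.
Proof. by case=> e [a [b [m0 [e0 et _]]]]; apply: lt_le_trans et. Qed.

Lemma good_point_open : open good_point.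
Proof.
rewrite openE => t [e [a [b [m0 [e0 et H]]]]].
apply/nbhs_ballP; exists (e / 2%:R) => /=; first lra.
move=> s; rewrite -ball_normE /= => hs.
exists (e / 2%:R), a, b, m0; split; [lra| |].
  by move: hs; rewrite ltr_norml; lra.
move=> r hr; apply: H; move: hs hr; rewrite !ltr_norml; lra.
Qed.

Lemma stable_counts_up a b m0 t : stable_counts a b m0 t ->
  stable_counts (3%:R * a) b m0 (5%:R * t).
Proof.
move=> H m hm; have [h1 h2 h3] := H m.+1 (leqW hm).
by rewrite mulrA -exprSr h1 h2 h3 !exprS; split; ring.
Qed.

Lemma stable_counts_down a b m0 t : stable_counts a b m0 (5%:R * t) ->
  stable_counts (a / 3%:R) b m0.+1 t.
Proof.
move=> H [//|m] hm; have [h1 h2 h3] := H m hm.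
by rewrite exprSr -mulrA h1 h2 h3 !exprS; split; field.
Qed.

Lemma good_point5 t : good_point (5%:R * t) <-> good_point t.
Proof.
split=> -[e [a [b [m0 [e0 et H]]]]].
  exists (e / 5%:R), (a / 3%:R), b, m0.+1; split; [lra|lra|].
  move=> s hs; apply: stable_counts_down; apply: H.
  by rewrite -mulrBr normrM ger0_norm //; lra.
exists (5%:R * e), (3%:R * a), b, m0; split; [lra|lra|].
move=> s hs; have -> : s = 5%:R * (s / 5%:R) by field.
apply: stable_counts_up; apply: H.
rewrite (_ : s / 5%:R - t = (s - 5%:R * t) / 5%:R); last by field.
by rewrite normrM [`|5%:R^-1|]ger0_norm ?invr_ge0 //; lra.
Qed.

Lemma good_pointX k t : good_point (5%:R ^+ k * t) <-> good_point t.
Proof.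
elim: k => [|k IH]; first by rewrite expr0 mul1r.
by rewrite exprS -mulrA good_point5.
Qed.

Lemma gap_point_good (x : R) : 0 < x -> x < 1 -> gap_point x -> good_point (psi x).
Proof.
move=> x0 x1 [e [a [b [m0 [e0 H]]]]].
have D (y y' : R) : 0 <= y' -> y' <= y -> y <= 1 ->
    3%:R / 4%:R * (y - y') <= psi y - psi y' <= 3%:R * (y - y').
  by move=> *; apply: psi_dist; lra.
have := D x 0 (lexx 0) (ltW x0) (ltW x1); rewrite psi0 => D1.
have := D 1 x (ltW x0) (ltW x1) (lexx 1) => D2.
(* 3/4 is the lower Lipschitz constant of [psi]; the other terms keep s between psi(0) and psi(1),
   where it has a preimage. *)
exists (Num.min (3%:R / 4%:R * e) (Num.min (psi x) (psi 1 - psi x))), a, b, m0; split.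
- by rewrite !lt_min; apply/and3P; split; lra.
- by rewrite !ge_min lexx orbT.
move=> s; rewrite !lt_min => /and3P[h1 h2 h3] m hm.
have [||||y y01 yE] := @psi_surj R 0 1 s; try lra.
  by move: h2 h3; rewrite psi0 !ltr_norml; lra.
have yx : `|y - x| < e.
  move: h1; rewrite -yE !ltr_norml; have [yx|xy] := leP y x.
    by have := D x y _ yx (ltW x1); lra.
  by have := D y x _ (ltW xy) _; lra.
have [h4 h5 h6] := N_psi hq hSG m y01; rewrite -yE h4 h5 h6 natrD.
rewrite !(H y yx m hm) /bsign; split; ring.
Qed.

Lemma bad_set_null K :
  lebesgue_measure (([set t | 0 < t] `\` good_point) `&` [set t | t < 5%:R ^+ K * psi 1]) = 0%E.
Proof.
set Z := _ `&` _.
have mpos : measurable ([set t | 0 < t] : set R).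
  by rewrite -[X in measurable X]set_itvoy; exact: measurable_itv.
have mZ : measurable Z.
  apply: measurableI.
    by apply: measurableD => //; apply: measurable_realfun.open_measurable; exact: good_point_open.
  by rewrite -[X in measurable X]set_itvNyo; exact: measurable_itv.
have f0 : 0 < 5%:R ^+ K :> R by apply: exprn_gt0.
(* 15 is the length 5 of the initial interval of the cover times the upper Lipschitz constant 3 of
   [psi]. *)
have B k : (lebesgue_measure Z <= (15%:R * 5%:R ^+ K * (10%:R / 11%:R) ^+ k)%:E)%E.
  have [s [s1 s2 s3]] := bad_point_cover R k.
  (* The cover reaches up to 5, whereas [psi] is controlled up to 1 only: intervals are cut at 1,
     which is harmless since t < 5^K psi(1). *)
  pose h (p : R * R) := (5%:R ^+ K * psi (Num.min p.1 1), 5%:R ^+ K * psi (Num.min p.2 1)).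
  have hp p : p \in s -> (h p).1 <= (h p).2 /\
      (h p).2 - (h p).1 <= 5%:R ^+ K * (3%:R * (p.2 - p.1)).
    move=> /s1[p0 p12 _].
    have [c1 c2] : [/\ Num.min p.1 1 <= Num.min p.2 1 &
        Num.min p.2 1 - Num.min p.1 1 <= p.2 - p.1].
      by rewrite /Num.min; case: ifP; case: ifP => *; split; lra.
    have c3 : 0 <= Num.min p.1 1 by rewrite le_min p0 ler01.
    have c4 : Num.min p.2 1 <= 1 by rewrite ge_min lexx orbT.
    have /andP[d1 d2] : 3%:R / 4%:R * (Num.min p.2 1 - Num.min p.1 1) <=
        psi (Num.min p.2 1) - psi (Num.min p.1 1) <= 3%:R * (Num.min p.2 1 - Num.min p.1 1).
      by apply: psi_dist; lra.
    by rewrite /h /= -mulrBr !ler_pM2l //; split; lra.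
  apply: (@le_trans _ _ (\sum_(p <- [seq h p | p <- s]) (p.2 - p.1))%:E).
    apply: lebesgue_measure_cover => // [_ /mapP[p ps ->]|t [[/= t0 ng] tK]].
      by have [] := hp p ps.
    have [||||x x01 xE] := @psi_surj R 0 1 (t / 5%:R ^+ K); try lra.
      by rewrite psi0 divr_ge0 ?(ltW t0) ?(ltW f0) //= ler_pdivrMr // mulrC ltW.
    have tE : t = 5%:R ^+ K * psi x by rewrite xE mulrC divfK // gt_eqF.
    have x0 : 0 < x.
      rewrite lt_neqAle; case/andP: x01 => -> _; rewrite andbT; apply/eqP => x0.
      by move: t0; rewrite tE -x0 psi0 mulr0 ltxx.
    have x1 : x < 1.
      rewrite lt_neqAle; case/andP: x01 => _ ->; rewrite andbT; apply/eqP => x1.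
      by move: tK; rewrite /= tE x1 ltxx.
    have bx : bad_point x.
      split; first by lra.
      by move=> g; apply: ng; rewrite tE good_pointX; apply: gap_point_good.
    have [p ps /andP[p1x xp2]] := s3 x bx; have [p0 p12 _] := s1 p ps.
    exists (h p); first exact: map_f.
    rewrite tE /h /= !ler_pM2l // !psi_le ?ge_min ?le_min ?p1x ?xp2 ?(ltW x1) ?lexx ?orbT //=.
    - lra.
    - by rewrite andbT; lra.
    - lra.
    - by rewrite andbT; lra.
  rewrite lee_fin big_map.
  apply: (@le_trans _ _ (\sum_(p <- s) 5%:R ^+ K * (3%:R * (p.2 - p.1)))).
    by rewrite big_seq [leRHS]big_seq; apply: ler_sum => p /hp[].
  rewrite -!mulr_sumr.
  have : 5%:R ^+ K * (3%:R * \sum_(p <- s) (p.2 - p.1)) <=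
     5%:R ^+ K * (3%:R * (5%:R * (10%:R / 11%:R) ^+ k)).
    by rewrite !ler_pM2l.
  by move: (_ ^+ k) => r; lra.
apply/eqP; rewrite eq_le measure_ge0 andbT.
apply/lee_addgt0Pr => e e0; rewrite add0e.
have L : (fun k => 15%:R * 5%:R ^+ K * (10%:R / 11%:R) ^+ k) @ \oo --> (0 : R).
  rewrite -(mulr0 (15%:R * 5%:R ^+ K)); apply: cvgMl_tmp; apply: cvg_expr.
  by rewrite ger0_norm; lra.
have /cvgrPdist_lt/(_ _ e0)[k _ /(_ k (leqnn k)) Hk] := L.
apply: (le_trans (B k)); rewrite lee_fin.
rewrite sub0r normrN in Hk.
exact: le_trans (ler_norm _) (ltW Hk).
Qed.

Lemma good_point_full : lebesgue_measure ([set t : R | 0 < t] `\` good_point) = 0%E.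
Proof.
have mpos : measurable ([set t | 0 < t] : set R).
  by rewrite -[X in measurable X]set_itvoy; exact: measurable_itv.
have mgood : measurable (good_point : set R).
  by apply: measurable_realfun.open_measurable; exact: good_point_open.
pose Z K := ([set t | 0 < t] `\` good_point) `&` [set t | t < 5%:R ^+ K * psi 1].
have nZ : (@lebesgue_measure R).-negligible (\bigcup_K Z K).
  apply: negligible_bigcup => K; exists (Z K); split => //.
    apply: measurableI; first exact: measurableD.
    by rewrite -[X in measurable X]set_itvNyo; exact: measurable_itv.
  exact: bad_set_null.
apply: measure_negligible; first exact: measurableD.
apply: negligibleS nZ => t Zt.
pose n := (Num.truncn (t * (4%:R / 3%:R))).+1; exists n => //; split => //=.
have h1 : t * (4%:R / 3%:R) < n%:R by rewrite truncnS_gt.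
have h2 : n%:R <= 5%:R ^+ n :> R by rewrite -natrX ler_nat ltnW // ltn_expl.
have h3 := psi1_ge R; have : 5%:R ^+ n * (3%:R / 4%:R) <= 5%:R ^+ n * psi (1 : R).
  by apply: ler_wpM2l => //; apply: exprn_ge0.
by lra.
Qed.

End MainTheorem.

(** * Identification of the constants with G and the remainder *)

(** Periodicity turns the asymptotics along 5^m t into a bound on d 3^m + b, with d the difference
    of the leading coefficients. Growth of 3^m forces d = 0, and what remains bounds b by C
    uniformly in t. *)
Lemma stable_counts_asymptotic (R : realType) (q : 'I_3 -> 'rV[R]_2)
    (SG : set 'rV[R]_2) (G : R -> R) (C a b t : R) m0 :
  (forall t, 0 < t -> G (5%:R * t) = G t) ->
  (\forall t \near +oo, `|(N_neumann q SG t)%:R - G t * t `^ alpha R| <= C) ->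
  0 < t -> stable_counts q SG a b m0 t ->
  a = G t * t `^ alpha R /\ `|b| <= C.
Proof.
move=> Gper [M [_ HM]] t0 H.
have GX m : G (5%:R ^+ m * t) = G t.
  elim: m => [|m IH]; first by rewrite expr0 mul1r.
  by rewrite exprS -mulrA Gper // mulr_gt0 // exprn_gt0.
pose n := (Num.truncn (`|M| / t)).+1.
set d := a - G t * t `^ alpha R.
have main m : (maxn m0 n <= m)%N -> `|d * 3%:R ^+ m + b| <= C.
  rewrite geq_max => /andP[m0m nm].
  have : M < 5%:R ^+ m * t.
    apply: le_lt_trans (ler_norm M) _; rewrite -ltr_pdivrMr //.
    apply: lt_le_trans (truncnS_gt _) _; rewrite -natrX ler_nat.
    by apply: leq_trans nm _; rewrite ltnW // ltn_expl.
  move=> /HM /=; have [_ -> _] := H m m0m.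
  rewrite GX powR_alpha ?(ltW t0) // (_ : _ - _ = d * 3%:R ^+ m + b) //.
  by rewrite /d; ring.
have d0 : d = 0.
  apply: (@bounded_expr3_eq0 _ d (C + `|b|) (maxn m0 n)) => m /main hm.
  rewrite -[X in _ * X]ger0_norm ?exprn_ge0 // -normrM.
  rewrite -[_ * _](addrK b); apply: le_trans (ler_normB _ _) _.
  by rewrite lerD2r.
split; first by apply/eqP; rewrite -subr_eq0; apply/eqP.
by have := main _ (leqnn _); rewrite d0 mul0r add0r.
Qed.

Theorem mainTheorem1 (R : realType) (q : 'I_3 -> 'rV[R]_2)
    (SG : set 'rV[R]_2) (G : R -> R)
    (hq : equilateral q) (hSG : is_gasket q SG)
    (hGper : forall t : R, 0 < t -> G (5%:R * t) = G t)
    (hGaway : exists2 c : R, 0 < c & forall t : R, 0 < t -> c <= `| G t |)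
    (hGN : has_asymptotics (N_neumann q SG) G)
    (hGD : has_asymptotics (N_dirichlet q SG) G) :
  exists (A : set R) (G1 : R -> R),
    [/\ [/\ open A,
            A `<=` [set t | 0 < t],
            lebesgue_measure ([set t | 0 < t] `\` A) = 0%E &
            [set 5%:R * t | t in A] = A],
        (exists M : R, forall t, A t -> `| G1 t | <= M) /\
        (forall t, A t -> G1 (5%:R * t) = G1 t),
        {within A, continuous G} &
        forall t, A t -> exists m0 : int, forall m : int, m0 <= m ->
          [/\ (N_double q SG (5%:R ^ m * t))%:R
                = 2%:R * G (5%:R ^ m * t) * (5%:R ^ m * t) `^ alpha R,
              2%:R * G (5%:R ^ m * t) * (5%:R ^ m * t) `^ alpha R
                = 2%:R * G t * t `^ alpha R * 3%:R ^ m,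
              (N_neumann q SG (5%:R ^ m * t))%:R
                = G t * t `^ alpha R * 3%:R ^ m + G1 t &
              (N_dirichlet q SG (5%:R ^ m * t))%:R
                = G t * t `^ alpha R * 3%:R ^ m - G1 t]].
Proof.
have [C HC] := hGN.
have uniq a b m0 t : 0 < t -> stable_counts q SG a b m0 t ->
    a = G t * t `^ alpha R /\ `|b| <= C by exact: stable_counts_asymptotic.
(* [G1] is the constant b of a good point, and 0 elsewhere. *)
have /choice[G1 HG1] t : exists b, good_point q SG t ->
    exists m0, stable_counts q SG (G t * t `^ alpha R) b m0 t.
  have [gt|] := pselect (good_point q SG t); last by exists 0.
  have t0 := good_point_gt0 gt; case: gt => e [a [b [m0 [e0 et H]]]].
  have Ht : stable_counts q SG a b m0 t by apply: H; rewrite subrr normr0.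
  by exists b => _; exists m0; have [<- _] := uniq _ _ _ _ t0 Ht.
exists (good_point q SG), G1; split; first split.
- exact: good_point_open.
- by move=> t; exact: good_point_gt0.
- exact: good_point_full.
- apply/seteqP; split=> [_ [t gt <-]|t gt] /=; first exact/good_point5.
  have tE : 5%:R * (t / 5%:R) = t by field.
  by exists (t / 5%:R) => //; apply/good_point5; rewrite tE.
- split.
    exists C => t gt; have [m0 H] := HG1 t gt.
    by have [] := uniq _ _ _ _ (good_point_gt0 gt) H.
  move=> t gt; have [m0 H] := HG1 t gt.
  have [m1 H'] := HG1 (5%:R * t) ((good_point5 q SG t).2 gt).
  have t0 : 0 < 5%:R * t by rewrite mulr_gt0 // (good_point_gt0 gt).
  have H5 := stable_counts_up H.
  (* The scaled expansion at t and the one chosen at 5t have the same leading term, so one common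
     level shows that their remainders agree. *)
  have [E _] := uniq _ _ _ _ t0 H5; rewrite -E in H'.
  have [_ h1 _] := H5 _ (leq_maxl m0 m1).
  have [_ h2 _] := H' _ (leq_maxr m0 m1).
  by apply: (@addrI _ (3%:R * (G t * t `^ alpha R) * 3%:R ^+ maxn m0 m1)); rewrite -h1 -h2.
- apply/subspace_continuousP => t gt; have t0 := good_point_gt0 gt.
  case: gt => e [a [b [m0 [e0 et H]]]].
  (* The constant [a] is the same for all s near t, so that G equals the continuous function a /
     s^alpha there. *)
  have GE s : `|s - t| < e -> a / s `^ alpha R = G s.
    move=> hs; have s0 : 0 < s by move: hs; rewrite ltr_norml; lra.
    by have [-> _] := uniq _ _ _ _ s0 (H s hs); rewrite mulfK // gt_eqF // powR_gt0.
  have tt : `|t - t| < e by rewrite subrr normr0.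
  have Gt : G s @[s --> t] --> G t.
    have vt : s `^ alpha R @[s --> t] --> t `^ alpha R.
      have /derivable1_diffP/differentiable_continuous : derivable (fun s : R => s `^ alpha R) t 1.
        by apply: derivable_powR; rewrite in_itv /= t0.
      exact.
    have nt : t `^ alpha R != 0 by rewrite gt_eqF // powR_gt0.
    rewrite -(GE t tt); apply: cvg_trans (cvgM (cvg_cst a) (cvgV nt vt)).
    apply: near_eq_cvg; near=> s; apply: GE; near: s.
    by apply/nbhs_ballP; exists e => //= s; rewrite /ball /= distrC.
  exact: cvg_within_filter Gt.
move=> t gt; have [n0 H] := HG1 t gt; have t0 := good_point_gt0 gt.
(* The bound is nonnegative, so negative exponents do not occur and integer powers reduce to natural
   ones. *)
exists n0%:Z => -[n|n] //; rewrite lez_nat => n0n.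
have [h1 h2 h3] := H n n0n.
have GX m : G (5%:R ^+ m * t) = G t.
  elim: m => [|m IH]; first by rewrite expr0 mul1r.
  by rewrite exprS -mulrA hGper // mulr_gt0 // exprn_gt0.
rewrite -!exprnP h1 h2 h3 GX powR_alpha ?(ltW t0) //.
by split => //; ring.
Unshelve. all: by end_near.
Qed.
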